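(* Let $n\ge 1$, $r\ge 0$ be integers, let $J:\mathbb{R}^n\to\mathbb{R}$ be twice continuously differentiable, let $\hat{\mathbb{U}}\subset\mathbb{R}^n$, and let $\mathcal{O}\subset\mathbb{R}^n$ be the set of solutions (minimizers, or maximizers, depending on the application) of the problem of optimizing $J(u)$ subject to $u\in\hat{\mathbb{U}}$; assume $\mathcal{O}$ is nonempty and compact. Let $C_{u,z},D_{u,z}\subset\mathbb{R}^{n+r}$ and, for each $\delta>0$, let $\hat F_\delta:\mathbb{R}^{n+r}\times\mathbb{R}^n\rightrightarrows\mathbb{R}^{n+r}$ and $\hat G_\delta:\mathbb{R}^{n+r}\rightrightarrows\mathbb{R}^{n+r}$ be set-valued maps. Write $x_{u,z}=(\hat u,\hat z)\in\mathbb{R}^n\times\mathbb{R}^r$. Assume: (a) There exists $\delta^*>0$ such that for all $\delta\in(0,\delta^*]$: the sets $C_{u,z}$ and $D_{u,z}$ are closed and their projections onto the $\hat u$-component are contained in $\hat{\mathbb{U}}$; $\hat F_\delta$ is outer semicontinuous, locally bounded, and nonempty- and convex-valued relative to $C_{u,z}\times\mathbb{R}^n$; $\hat G_\delta$ is outer semicontinuous, locally bounded and nonempty-valued relative to $D_{u,z}$. (b) There exists a compact set $\Psi\subset\mathbb{R}^r$ such that the set $\mathcal{A}:=\mathcal{O}\times\Psi$ is SGPAS as $\delta\to0^+$ for the hybrid system with state $x_{u,z}$ $$x_{u,z}\in C_{u,z},\ \dot x_{u,z}\in\hat F_\delta(x_{u,z},\nabla J(\hat u));\qquad x_{u,z}\in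 D_{u,z},\ x_{u,z}^+\in\hat G_\delta(x_{u,z}).$$ Let $k_f>0$, $\lambda_\xi>0$, $\Lambda_\xi:=\lambda_\xi\mathbb{B}\subset\mathbb{R}^n$, and for $\delta,\varepsilon_f,\varepsilon_a,\varepsilon_\omega>0$ consider the hybrid system with state $x=(x_{u,z},\xi,\mu)\in\mathbb{R}^{n+r}\times\mathbb{R}^n\times\mathbb{R}^{2n}$ given by $$x\in C_{u,z}\times\Lambda_\xi\times\mathbb{S}^n:\quad \dot x_{u,z}\in\hat F_\delta(x_{u,z},\xi),\quad \dot\xi=-\frac{k_f}{\varepsilon_f}\Big(\xi-\frac{2}{\varepsilon_a}\,J(\hat u+\varepsilon_a\mathbb{D}\mu)\,\mathbb{D}\mu\Big),\quad \dot\mu=\Phi_\omega\mu,$$ $$x\in D_{u,z}\times\Lambda_\xi\times\mathbb{S}^n:\quad x_{u,z}^+\in\hat G_\delta(x_{u,z}),\quad \xi^+=\xi,\quad \mu^+=\mu .$$ Then this hybrid system renders the set $\mathcal{A}\times\Lambda_\xi\times\mathbb{S}^n$ SGPAS as $(\delta,\varepsilon_f,\varepsilon_a,\varepsilon_\omega)\to0^+$.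
   Context: Notation. $\mathbb{B}$ is the closed Euclidean unit ball of appropriate dimension; $|x|_{\mathcal{A}}$ is the Euclidean distance from $x$ to $\mathcal{A}$; $\mathbb{S}^1\subset\mathbb{R}^2$ is the unit circle and $\mathbb{S}^n:=\mathbb{S}^1\times\dots\times\mathbb{S}^1\subset\mathbb{R}^{2n}$ ($n$ factors). A set-valued map $M$ is outer semicontinuous (OSC) relative to $K$ if $z_i\in K$, $s_i\in M(z_i)$, $z_i\to z\in K$, $s_i\to s$ imply $s\in M(z)$; it is locally bounded (LB) relative to $K$ if every $z\in K$ has a neighborhood $N$ with $M(N\cap K)$ bounded. Dither generator. $\mu=(\mu_1,\dots,\mu_n)$ with $\mu_i=(\mu_{i,1},\mu_{i,2})\in\mathbb{S}^1$; $\Phi_\omega\in\mathbb{R}^{2n\times 2n}$ is block diagonal with blocks $\omega_i\mathbf{R}_o$, where $\mathbf{R}_o=\begin{bmatrix}0&1\\-1&0\end{bmatrix}$ and $\omega_i=\kappa_i/\varepsilon_\omega$, with $\kappa_1,\dots,\kappa_n$ fixed, positive, pairwise distinct rational numbers. The matrix $\mathbb{D}\in\mathbb{R}^{n\times 2n}$ extracts the odd entries: $\mathbb{D}\mu=(\mu_{1,1},\dots,\mu_{n,1})$. Hybrid systems. A hybrid system with state $x\in\mathbb{R}^p$ is written $x\in C,\ \dot x\in F(x)$; $x\in D,\ x^+\in G(x)$. A compact hybrid time domain is a set $\bigcup_{j=0}^{N-1}([t_j,t_{j+1}]\times\{j\})$ with $0=t_0\le t_1\le\dots\le t_N$; a hybrid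 time domain is a union of a nondecreasing sequence of compact hybrid time domains. A hybrid arc is a function $x:\mathrm{dom}(x)\to\mathbb{R}^p$ on a hybrid time domain such that $t\mapsto x(t,j)$ is locally absolutely continuous on $I_j:=\{t:(t,j)\in\mathrm{dom}(x)\}$ for each $j$ for which $I_j$ has nonempty interior. It is a solution if $x(0,0)\in C\cup D$; for each $j$ such that $I_j$ has nonempty interior, $x(t,j)\in C$ and $\dot x(t,j)\in F(x(t,j))$ for almost all $t\in I_j$; and whenever $(t,j),(t,j+1)\in\mathrm{dom}(x)$, $x(t,j)\in D$ and $x(t,j+1)\in G(x(t,j))$. A solution is maximal if it cannot be extended to a solution with strictly larger domain. Solutions need not be unique or complete (have unbounded domain). Class $\mathcal{KL}$: functions $\beta:\mathbb{R}_{\ge0}^2\to\mathbb{R}_{\ge0}$ nondecreasing in the first argument, nonincreasing in the second, with $\lim_{r\to0^+}\beta(r,s)=0$ for each $s$ and $\lim_{s\to\infty}\beta(r,s)=0$ for each $r$. SGPAS. A hybrid system depending on parameters $(\varepsilon_1,\dots,\varepsilon_m)$ renders a compact set $\mathcal{A}$ semi-globally practically asymptotically stable (SGPAS) as $(\varepsilon_1,\dots,\varepsilon_m)\to0^+$ if there is $\beta\in\mathcal{KL}$ such that for each $\Delta>\nu>0$ there exists $\varepsilon_1^*>0$ such that for all $\varepsilon_1\in(0,\varepsilon_1^* )$ there exists $\varepsilon_2^*>0$ such that for all $\varepsilon_2\in(0,\varepsilon_2^* )$ $\dots$ there exists $\varepsilon_m^*>0$ such that for all $\varepsilon_m\in(0,\varepsilon_m^*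 )$, every maximal solution with $|x(0,0)|\le\Delta$ satisfies $|x(t,j)|_{\mathcal{A}}\le\beta(|x(0,0)|_{\mathcal{A}},t+j)+\nu$ for all $(t,j)\in\mathrm{dom}(x)$. *)

(* Defs.v *)
From HB Require Import structures.
From mathcomp Require Import all_boot all_order all_algebra.
From mathcomp Require Import all_classical all_reals all_analysis.
Import Order.TTheory GRing.Theory Num.Theory.
Import numFieldNormedType.Exports.

Set Implicit Arguments.
Unset Strict Implicit.
Unset Printing Implicit Defensive.

Local Open Scope classical_set_scope.
Local Open Scope ring_scope.

(** Vectors of R^p are row vectors ['rV[R]_p].  Topology, compactness and
    differentiability are the library's (its norm on matrices is the sup norm,
    with the same topology as the Euclidean one); lengths and distances in the
    stability notions are Euclidean and use [enorm]. *)

Section Euclidean.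
Context {R : realType}.

Definition enorm p (x : 'rV[R]_p) : R := Num.sqrt (\sum_(i < p) x ord0 i ^+ 2).

(** As [inf set0 = 0], this is only meaningful for nonempty [A]. *)
Definition dist p (x : 'rV[R]_p) (A : set 'rV[R]_p) : R :=
  inf [set enorm (x - a) | a in A].

Definition eball p (l : R) : set 'rV[R]_p := [set x | enorm x <= l].

Definition rVprod p q (A : set 'rV[R]_p) (B : set 'rV[R]_q) :
    set 'rV[R]_(p + q) :=
  [set x | A (lsubmx x) /\ B (rsubmx x)].

Definition grad p (f : 'rV[R]_p -> R) (u : 'rV[R]_p) : 'rV[R]_p :=
  \row_(i < p) 'D_(delta_mx ord0 i) f u.

Definition C2 p (f : 'rV[R]_p -> R) : Prop :=
  [/\ forall u, differentiable f u,
      forall u, differentiable (grad f) u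
    & forall v, continuous (fun u => 'D_v (grad f) u)].

Definition argmin_on T (f : T -> R) (U : set T) : set T :=
  [set u | U u /\ forall v, U v -> f u <= f v].

Definition argmax_on T (f : T -> R) (U : set T) : set T :=
  [set u | U u /\ forall v, U v -> f v <= f u].

End Euclidean.

Section SetValuedMaps.
Context {R : realType} {V W : normedModType R}.
Implicit Types (M : V -> set W) (K : set V).

Definition osc_on M K : Prop :=
  forall (z : V^nat) (s : W^nat) (z0 : V) (s0 : W),
    (forall i, K (z i)) -> (forall i, M (z i) (s i)) ->
    z @ \oo --> z0 -> K z0 -> s @ \oo --> s0 -> M z0 s0.

Definition locally_bounded_on M K : Prop :=
  forall z, K z -> exists2 N : set V,
    nbhs z N & bounded_set (\bigcup_(y in N `&` K) M y).

Definition nonempty_valued_on M K : Prop := forall z, K z -> M z !=set0.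

Definition convex_valued_on M K : Prop :=
  forall z, K z -> convex_set (M z : set (convex_lmodType W)).

End SetValuedMaps.

Section HybridSystems.
Context {R : realType}.

Record hybrid_system (p : nat) := HybridSystem {
  flow_set : set 'rV[R]_p;
  flow_map : 'rV[R]_p -> set 'rV[R]_p;
  jump_set : set 'rV[R]_p;
  jump_map : 'rV[R]_p -> set 'rV[R]_p }.

(** [0 < N], so that a time domain contains [(0, 0)]. *)
Definition compact_hybrid_time_domain (E : set (R * nat)) : Prop :=
  exists (N : nat) (tau : nat -> R),
    [/\ (0 < N)%N, tau 0%N = 0,
        forall j, (j < N)%N -> tau j <= tau j.+1
      & E = [set s | (s.2 < N)%N /\ tau s.2 <= s.1 <= tau s.2.+1]].

Definition hybrid_time_domain (E : set (R * nat)) : Prop :=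
  exists K : nat -> set (R * nat),
    [/\ forall i, compact_hybrid_time_domain (K i),
        forall i, K i `<=` K i.+1
      & E = \bigcup_i K i].

Definition slice (E : set (R * nat)) (j : nat) : set R := [set t | E (t, j)].

Definition abs_continuous p (f : R -> 'rV[R]_p) (a b : R) : Prop :=
  forall e, 0 < e -> exists2 d, 0 < d &
    forall (N : nat) (s t : 'I_N -> R),
      (forall k, a <= s k /\ s k <= t k /\ t k <= b) ->
      trivIset [set: 'I_N] (fun k => `]s k, t k[%classic) ->
      \sum_(k < N) (t k - s k) < d ->
      \sum_(k < N) enorm (f (t k) - f (s k)) < e.

Definition loc_abs_continuous p (f : R -> 'rV[R]_p) (I : set R) : Prop :=
  forall a b, a <= b -> `[a, b] `<=` I -> abs_continuous f a b.

(** A hybrid arc is a pair of a domain [E] and a total function [x]; the values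
    of [x] outside [E] are irrelevant, the two-sided derivative in [solution]
    being required only almost everywhere on each interval. *)
Definition hybrid_arc p (E : set (R * nat)) (x : R -> nat -> 'rV[R]_p) : Prop :=
  hybrid_time_domain E /\
  forall j, (slice E j)° !=set0 -> loc_abs_continuous (x^~ j) (slice E j).

Definition solution p (H : hybrid_system p) (E : set (R * nat))
    (x : R -> nat -> 'rV[R]_p) : Prop :=
  [/\ hybrid_arc E x,
      (flow_set H `|` jump_set H) (x 0 0%N),
      forall j, (slice E j)° !=set0 ->
        {ae lebesgue_measure, forall t, slice E j t ->
          [/\ flow_set H (x t j), derivable (x^~ j) t 1
            & flow_map H (x t j) (derive1 (x^~ j) t)]}
    & forall t j, E (t, j) -> E (t, j.+1) ->
        jump_set H (x t j) /\ jump_map H (x t j) (x t j.+1)].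

Definition maximal_solution p (H : hybrid_system p) (E : set (R * nat))
    (x : R -> nat -> 'rV[R]_p) : Prop :=
  solution H E x /\
  forall E' x', solution H E' x' -> E `<=` E' ->
    (forall t j, E (t, j) -> x' t j = x t j) -> E' = E.

Definition class_KL (beta : R -> R -> R) : Prop :=
  [/\ forall r s, 0 <= r -> 0 <= s -> 0 <= beta r s,
      forall r1 r2 s, 0 <= r1 -> r1 <= r2 -> 0 <= s -> beta r1 s <= beta r2 s,
      forall r s1 s2, 0 <= r -> 0 <= s1 -> s1 <= s2 -> beta r s2 <= beta r s1,
      forall s, 0 <= s -> beta r s @[r --> (0 : R)^'+] --> (0 : R)
    & forall r, 0 <= r -> beta r s @[s --> +oo] --> (0 : R)].

(** [R -> ... -> R -> T] with [m] real parameters. *)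
Fixpoint param_family (m : nat) (T : Type) : Type :=
  if m is k.+1 then R -> param_family k T else T.

(** [exists e1* > 0, forall e1 in (0, e1* ), exists e2* > 0, ..., P (H e1 ... em)]. *)
Fixpoint for_small_params (m : nat) (T : Type) (P : T -> Prop) :
    param_family m T -> Prop :=
  match m return param_family m T -> Prop with
  | 0%N => fun H => P H
  | k.+1 => fun H => exists2 estar : R, 0 < estar &
      forall e : R, 0 < e < estar -> @for_small_params k T P (H e)
  end.

Definition SGPAS p (m : nat) (H : param_family m (hybrid_system p))
    (A : set 'rV[R]_p) : Prop :=
  exists2 beta : R -> R -> R, class_KL beta &
    forall Delta nu : R, 0 < nu -> nu < Delta ->
      for_small_params
        (fun Hs : hybrid_system p =>
           forall E x, maximal_solution Hs E x -> enorm (x 0 0%N) <= Delta ->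
             forall t j, E (t, j) ->
               dist (x t j) A <= beta (dist (x 0 0%N) A) (t + j%:R) + nu)
        H.

End HybridSystems.

Arguments param_family R m T : clear implicits.
Arguments SGPAS {R p} m H A.

Section Dither.
Context {R : realType}.

Lemma pair_idx_subproof n (i : 'I_n) (a : 'I_2) : (i.*2 + a < n.*2)%N.
Proof.
rewrite -ltn_half_double; case: a => -[|[|//]] /= _.
  by rewrite addn0 doubleK.
by rewrite addnC (half_bit_double i true).
Qed.

Lemma pair_of_subproof n (k : 'I_n.*2) : (k./2 < n)%N.
Proof. by rewrite ltn_half_double. Qed.

(** Position in R^(2n) of the entry [a] of the [i]-th pair, and conversely. *)
Definition pair_idx n (i : 'I_n) (a : 'I_2) : 'I_n.*2 :=
  Ordinal (pair_idx_subproof i a).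
Definition pair_of n (k : 'I_n.*2) : 'I_n := Ordinal (pair_of_subproof k).
Definition entry_of n (k : 'I_n.*2) : 'I_2 := inord (odd k).

Definition circle : set 'rV[R]_2 := [set v | enorm v = 1].

Definition torus n : set 'rV[R]_n.*2 :=
  [set mu | forall i : 'I_n, circle (\row_(a < 2) mu ord0 (pair_idx i a))].

Definition Rot : 'M[R]_2 := block_mx 0 1%:M (- 1%:M) 0 : 'M[R]_(1 + 1).

Definition Phi n (omega : 'I_n -> R) : 'M[R]_n.*2 :=
  \matrix_(k, l)
    if pair_of k == pair_of l
    then omega (pair_of k) * Rot (entry_of k) (entry_of l) else 0.

Definition Dmx n : 'M[R]_(n, n.*2) :=
  \matrix_(i, k) (k == pair_idx i ord0)%:R.

End Dither.

Section ClosedLoops.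
Context {R : realType} (n r : nat).
Variables (J : 'rV[R]_n -> R) (C D : set 'rV[R]_(n + r)).
Variables (F : R -> 'rV[R]_(n + r) -> 'rV[R]_n -> set 'rV[R]_(n + r)).
Variables (G : R -> 'rV[R]_(n + r) -> set 'rV[R]_(n + r)).

Definition nominal_system (delta : R) : hybrid_system (n + r) :=
  {| flow_set := C;
     flow_map := fun x => F delta x (grad J (lsubmx x));
     jump_set := D;
     jump_map := G delta |}.

(** The state is [row_mx x_uz (row_mx xi mu)].  Since vectors are rows, the
    matrices [Dmx] and [Phi] act on [mu] by right multiplication by their
    transposes. *)
Definition model_free_system (kappa : 'I_n -> rat) (kf lambda : R)
    (delta ef ea ew : R) : hybrid_system ((n + r) + (n + n.*2)) :=
  {| flow_set := rVprod C (rVprod (eball lambda) (@torus R n));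
     flow_map := fun x =>
       let xuz := lsubmx x in
       let u := lsubmx xuz in
       let xi := lsubmx (rsubmx x) in
       let mu := rsubmx (rsubmx x) in
       let Dmu := mu *m (Dmx n)^T in
       let omega i := ratr (kappa i) / ew in
       [set v | [/\ F delta xuz xi (lsubmx v),
           lsubmx (rsubmx v) =
             - (kf / ef) *: (xi - (2 / ea * J (u + ea *: Dmu)) *: Dmu)
         & rsubmx (rsubmx v) = mu *m (Phi omega)^T]];
     jump_set := rVprod D (rVprod (eball lambda) (@torus R n));
     jump_map := fun x =>
       [set y | G delta (lsubmx x) (lsubmx y) /\ rsubmx y = rsubmx x] |}.

End ClosedLoops.

(* Main.v *)
(** As long as the state stays in a ball, [xi] low-pass filters
    [2 / ea * J (u + ea Dmu) Dmu], whose average over the dither is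
    [grad J u + O(ea)] because the frequencies are pairwise distinct.
    Subtracting an explicit corrector of size [ew / ea] reduces the comparison
    to a scalar linear differential inequality, so that
    [|xi - grad J u| <= eta] except on an initial layer of length [eta] after
    each jump.  On a finite horizon the [(u, z)] component is thus an arc of
    the nominal system up to a small perturbation of the input outside short
    layers.  If the nominal KL bound failed for such arcs with [eta] tending to
    [0], an ultralimit would give a nominal solution violating it (outer
    semicontinuity and convexity close the inclusions, solutions extend to
    maximal ones by Zorn's lemma).  The bound keeps the state away from the
    boundary of the ball, which removes the a priori assumption.  For all later
    times the finite-horizon bound is restarted from a point of the solution a
    bounded time in the past, where the distance to the attractor is already
    below [nu]. *)

From HB Require Import structures.
Require Import Defs.
From mathcomp Require Import all_boot all_order all_algebra.
From mathcomp Require Import all_classical all_reals all_analysis.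
From mathcomp Require Import measurable_realfun.
From mathcomp Require Import ring lra.
Import Order.TTheory GRing.Theory Num.Theory.
Import numFieldNormedType.Exports.
Local Open Scope classical_set_scope.
Local Open Scope ring_scope.
Set Implicit Arguments.
Unset Strict Implicit.
Unset Printing Implicit Defensive.

(** * Absolutely continuous functions and the mean value inequality *)

(** Only the distance of the [x_uz] block to [A] needs an estimate: [xi] and [mu] stay in their ball
    and on the torus because the flow and jump sets impose it. A filter state pushed out of its ball
    ends the solution, about which nothing more is claimed. The horizon is bounded because [xi] is
    kept at jumps while [grad J u] may change, so every jump opens a new layer; with boundedly many
    jumps and bounded time the arcs form a compact family, and [eta] may depend on that horizon. The
    comparison function of the conclusion has to be fixed before [Delta] and [nu], which is why the
    loss made in the limit is absorbed by one modification of [beta] valid for all arcs. The limit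
    arcs are a priori only Lipschitz; their differentiability almost everywhere is a separate
    theorem, needed before an inclusion for their derivative makes sense. The first point outside
    the ball may be the result of a jump, hence far from the ball. A second, larger radius accounts
    for it, and the velocity bound and the estimator are tuned to that radius. *)

Section MeanValue.
Context {R : realType}.
Notation mu := (@lebesgue_measure R).

Lemma aeS (P Q : R -> Prop) : (forall t, P t -> Q t) ->
  {ae mu, forall t, P t} -> {ae mu, forall t, Q t}.
Proof. by move=> PQ; apply: filterS; first exact: (ae_filter_ringOfSetsType mu). Qed.

Lemma aeI (P Q : R -> Prop) : {ae mu, forall t, P t} -> {ae mu, forall t, Q t} ->
  {ae mu, forall t, P t /\ Q t}.
Proof. by move=> HP HQ; apply: filterI; first exact: (ae_filter_ringOfSetsType mu). Qed.

(** The supremum [c] of the points reachable from [a] is itself passed by the local hypothesis at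
    [c], so it can only be [b]. This is compactness of the interval in a form suited to additive
    estimates. *)
Lemma cousin (P : R -> R -> Prop) (a b : R) : a <= b ->
  (forall s t u, a <= s -> s <= t -> t <= u -> u <= b ->
    P s t -> P t u -> P s u) ->
  (forall t, a <= t <= b -> exists2 d, 0 < d &
    forall s s', a <= s -> s' <= b -> s <= t <= s' -> t - d < s -> s' < t + d ->
    P s s') ->
  P a b.
Proof.
move=> ab Padd Ploc.
pose A := [set t | a <= t <= b /\ P a t].
have Aa : A a.
  split; first by rewrite lexx.
  have [|d d0 H] := Ploc a; first by rewrite lexx.
  by apply: H; rewrite ?lexx//; lra.
have supA : has_sup A.
  split; first by exists a.
  by exists b => t [/andP[]].
set c := sup A.
have ac : a <= c by apply: ub_le_sup => //; case: supA.
have cb : c <= b by apply: ge_sup => [|t [/andP[]]//]; exists a.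
have [|d d0 H] := Ploc c; first by rewrite ac cb.
have [t At tc] : exists2 t, A t & c - d < t.
  by apply: sup_adherent.
have tlec : t <= c by apply: ub_le_sup => //; case: supA.
case: At => /andP[at_ tb] Pat.
pose s' := Num.min (c + d / 2) b.
have s'1 : s' <= b by rewrite ge_min lexx orbT.
have s'2 : c <= s' by rewrite le_min cb andbT lerDl; lra.
have s'3 : s' < c + d by rewrite gt_min; apply/orP; left; lra.
have Pas' : P a s'.
  apply: (Padd a t s') => //; first lra.
  by apply: H => //; rewrite tlec.
have : s' <= c by apply: ub_le_sup; [case: supA|split => //; lra].
rewrite ge_min => /orP[|bc]; first by move=> ?; exfalso; lra.
by move: Pas'; rewrite /s' min_r//; lra.
Qed.

(** Lists replace the indexed disjoint families of [abs_continuous] so that families on adjacent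
    intervals can be concatenated. *)
Fixpoint chain (a : R) (l : seq (R * R)) (b : R) : Prop :=
  if l is i :: l' then [/\ a <= i.1, i.1 <= i.2 & chain i.2 l' b] else a <= b.

Lemma chain_cat a l1 b l2 c : chain a l1 b -> chain b l2 c ->
  chain a (l1 ++ l2) c.
Proof.
elim: l1 a => [|i l1 IH] a /=.
  move=> ab; case: l2 => [|i l2]/=; first exact: le_trans.
  by move=> [bi ii ?]; split => //; exact: le_trans bi.
by move=> [? ? ?] ?; split => //; exact: IH.
Qed.

Lemma subr3 (V : zmodType) (x y z u v : V) :
  (x - y - u) - (z - y - v) = x - z - (u - v).
Proof.
by rewrite (addrAC x) (addrAC z) [- (_ - y)]opprB subrKA !opprD !opprK addrACA.
Qed.

Section ac.
Variable V : normedModType R.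

Definition ac_on (f : R -> V) (a b : R) := forall e, 0 < e ->
  exists2 d, 0 < d & forall l, chain a l b ->
    \sum_(i <- l) (i.2 - i.1) < d -> \sum_(i <- l) `|f i.2 - f i.1| < e.

Lemma chain_ge0 a l b : chain a l b -> 0 <= \sum_(i <- l) (i.2 - i.1).
Proof.
elim: l a => [|i l IH] a /=; first by rewrite big_nil.
by move=> [_ ii /IH ?]; rewrite big_cons addr_ge0// subr_ge0.
Qed.

Lemma chain_le a l b : chain a l b -> a <= b.
Proof.
by elim: l a => [//|i l IH] a /= [? ii /IH ?]; lra.
Qed.

Lemma chain_lip (f : R -> V) (L a b : R) l :
  (forall s t, a <= s -> s <= t -> t <= b -> `|f t - f s| <= L * (t - s)) ->
  chain a l b ->
  \sum_(i <- l) `|f i.2 - f i.1| <= L * \sum_(i <- l) (i.2 - i.1).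
Proof.
elim: l a => [|i l IH] a /= H; first by rewrite !big_nil mulr0.
move=> [ai ii ch]; rewrite !big_cons mulrDr lerD//.
  by apply: H => //; exact: chain_le ch.
by apply: IH ch => s t ? ? ?; apply: H => //; lra.
Qed.

Lemma lip_ac (f : R -> V) (L a b : R) :
  (forall s t, a <= s -> s <= t -> t <= b -> `|f t - f s| <= L * (t - s)) ->
  ac_on f a b.
Proof.
move=> fL e e0; have L1 : 0 < `|L| + 1 by rewrite ltr_wpDl.
exists (e / (`|L| + 1)); first by rewrite divr_gt0.
move=> l cl; rewrite ltr_pdivlMr// => H.
apply: le_lt_trans (chain_lip fL cl) _; apply: le_lt_trans _ H.
rewrite mulrC ler_wpM2l ?(chain_ge0 cl)//.
by rewrite (le_trans (ler_norm L))// lerDl.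
Qed.

Lemma chain_sub a b s t l : a <= s -> t <= b -> chain s l t -> chain a l b.
Proof.
move=> as_ tb; elim: l a s as_ => [|i l IH] a s as_ /=; first lra.
by move=> [? ? ?]; split; [lra|lra|exact: (IH i.2 i.2)].
Qed.

Lemma ac_sub (f : R -> V) a b s t : a <= s -> t <= b ->
  ac_on f a b -> ac_on f s t.
Proof.
move=> as_ tb H e e0; have [d d0 Hd] := H e e0; exists d => // l cl.
apply: Hd; exact: chain_sub cl.
Qed.

Lemma derivable_expand (f : R -> V) (t e : R) : derivable f t 1 -> 0 < e ->
  exists2 d, 0 < d & forall s, `|s - t| < d ->
    `|f s - f t - (s - t) *: derive1 f t| <= e * `|s - t|.
Proof.
move=> df e0.
have : h^-1 *: (f (h + t) - f t) @[h --> 0^'] --> derive1 f t.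
  have : cvg (h^-1 *: (f (h *: 1 + t) - f t) @[h --> 0^']) := df.
  have -> : (fun h => h^-1 *: (f (h *: 1 + t) - f t)) =
     (fun h => h^-1 *: (f (h + t) - f t)).
    by apply/funext => h; rewrite -[h *: 1]/(h * 1) mulr1.
  by [].
move/cvgrPdist_le => /(_ e e0)[d /= d0 H].
exists d => // s sd.
have [->|st] := eqVneq s t; first by rewrite !subrr scale0r subrr !normr0 mulr0.
have st0 : s - t != 0 by rewrite subr_eq0.
have := H (s - t); rewrite /= sub0r normrN => /(_ sd st0).
rewrite subrK => H1.
have -> : f s - f t - (s - t) *: derive1 f t =
  - ((s - t) *: (derive1 f t - (s - t)^-1 *: (f s - f t))).
  by rewrite scalerBr scalerA divff// scale1r opprB.
by rewrite normrN normrZ mulrC ler_wpM2r.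
Qed.

End ac.

(** Outer regularity of Lebesgue measure. The points [a] and [b] are thrown into the null set so
    that no derivative is ever needed at the ends of the interval. *)
Lemma ae_null (Q : R -> Prop) (d : R) (a b : R) : {ae mu, forall t, Q t} ->
  0 < d ->
  exists U : set R, [/\ open U, U a, U b, (forall t, ~ Q t -> U t)
   & (mu U < d%:E)%E].
Proof.
move=> [N [mN N0 QN]] d0.
pose D := N `|` ([set a] `|` [set b]).
have mD : measurable D.
  by apply: measurableU => //; apply: measurableU; exact: measurable_set1.
have D0 : mu D = 0%E.
  apply/eqP; rewrite eq_le measure_ge0 andbT.
  have mab : measurable ([set a] `|` [set b]).
    by apply: measurableU; exact: measurable_set1.
  apply: le_trans (measureU2 _ _ _) _ => //.
  rewrite [X in (X + _ <= _)%E](N0 : mu N = 0%E) add0e.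
  apply: le_trans (measureU2 _ _ _) _; [exact: measurable_set1..|].
  apply: (@le_trans _ _ (mu [set a] + mu [set b])%E); first exact: lexx.
  by rewrite !lebesgue_measure_set1 adde0.
have Doo : (mu D < +oo)%E by rewrite (D0 : mu D = 0%E).
have [U [oU DU UD]] := lebesgue_regularity_outer mD Doo d0.
exists U; split => //.
- by apply: DU; right; left.
- by apply: DU; right; right.
- by move=> t Qt; apply: DU; left; apply: QN.
- have mU : measurable U by exact: open_measurable.
  have -> : U = (U `\` D) `|` D by rewrite setDKU.
  apply: le_lt_trans (measureU2 _ _ _) _ => //; first exact: measurableD.
  by rewrite [X in (_ + X < _)%E](D0 : mu D = 0%E) adde0.
Qed.

(** * Growth of the measure of a small open set along the line *)

Section distribution.
Variables (U : set R) (d : R) (a : R).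
Hypotheses (oU : open U) (Ud : (mu U < d%:E)%E).
Let m t := fine (mu (U `&` `]a, t]%classic)).

Let mUI (s t : R) : measurable (U `&` `]s, t]).
Proof. by apply: measurableI; [exact: open_measurable|exact: measurable_itv]. Qed.

Let leUI (s t : R) : (mu (U `&` `]s, t]) <= mu U)%E.
Proof.
apply: le_measure; rewrite ?inE; [exact: mUI|exact: open_measurable|].
exact: subIsetl.
Qed.

Let fUI (s t : R) : mu (U `&` `]s, t]) \is a fin_num.
Proof.
rewrite ge0_fin_numE; last exact: measure_ge0.
apply: le_lt_trans (lt_trans Ud (ltry _)).
exact: leUI.
Qed.

Lemma distrB (s t : R) : a <= s -> s <= t ->
  m t - m s = fine (mu (U `&` `]s, t])).
Proof.
move=> as_ st; rewrite /m.
have -> : U `&` `]a, t] = (U `&` `]a, s]) `|` (U `&` `]s, t]).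
  rewrite -setIUr; congr (_ `&` _); apply/seteqP; split=> x /=; rewrite !in_itv/=.
    by move=> /andP[ax xt]; have [|] := leP x s; rewrite ?ax ?xt; [left|right].
  by move=> [] /andP[? ?]; lra.
have dis : U `&` `]a, s] `&` (U `&` `]s, t]) = set0.
  apply/seteqP; split => // x [[_]] /=; rewrite in_itv/= => /andP[_ xs] [_].
  by rewrite in_itv/=; lra.
rewrite (measureU mu (mUI a s) (mUI s t) dis).
by rewrite fineD ?fUI// addrC addKr.
Qed.

Lemma distr_le (b : R) : m b - m a <= d.
Proof.
have [ab|ba] := leP a b.
  rewrite distrB//; rewrite -lee_fin fineK ?fUI//.
  apply: le_trans (ltW Ud).
  exact: leUI.
have E (x : R) : x <= a -> m x = 0.
  move=> xa; rewrite /m (_ : _ `&` _ = set0) ?measure0//.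
  by apply/seteqP; split => // y [_] /=; rewrite in_itv/=; lra.
rewrite !E ?subr0//; last exact: ltW.
rewrite -lee_fin; apply: le_trans (ltW Ud); exact: measure_ge0.
Qed.

Lemma distr_ge0 (s t : R) : a <= s -> s <= t -> 0 <= m t - m s.
Proof. by move=> ? ?; rewrite distrB// fine_ge0// measure_ge0. Qed.

Lemma distr_itv (s t : R) : a <= s -> s <= t ->
  (forall x, s <= x <= t -> U x) -> m t - m s = t - s.
Proof.
move=> as_ st H; rewrite distrB// (_ : U `&` _ = `]s, t]%classic); last first.
  apply/seteqP; split=> x /=; first by case.
  move=> xs; split => //; move: xs; rewrite in_itv/= => ?; apply: H; lra.
rewrite lebesgue_measure_itv/=; case: ifP => //.
rewrite lte_fin => /negbT; rewrite -leNgt => ts.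
by have -> : s = t; [lra|rewrite subrr].
Qed.

End distribution.

(** The exceptional null set is covered by an open set [U] of small measure;
    Cousin's lemma then compares increments of [f] with convex combinations of
    derivatives, up to the growth of the distribution function of [U]. *)
Lemma mean_value_convex (V : normedModType R) (f : R -> V) (a b : R)
  (S : set V) (s0 : V) : a < b -> ac_on f a b ->
  {ae mu, forall t, a < t < b -> derivable f t 1 /\ S (derive1 f t)} ->
  S s0 ->
  (forall x y p, S x -> S y -> 0 <= p <= 1 -> S (p *: x + (1 - p) *: y)) ->
  forall e, 0 < e -> exists2 w, S w & `|f b - f a - (b - a) *: w| <= e.
Proof.
move=> ab acf fS Ss0 cS e e0.
(* One third of [e] goes to each of three errors: the first-order expansions, the use of [s0] in
   place of a derivative inside [U], and the variation of [f] over the intervals inside [U]. *)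
pose e1 := e / (3 * (b - a)).
have e10 : 0 < e1 by rewrite divr_gt0// mulr_gt0// subr_gt0.
have [d d0 Hd] := acf (e / 3) ltac:(lra).
pose K := `|s0|.
pose d' := Num.min (d / 2) (e / 3 / (K + 1)).
have K1 : 0 < K + 1 by rewrite ltr_wpDl// normr_ge0.
have d'0 : 0 < d' by rewrite lt_min !divr_gt0//; lra.
have [U [oU Ua Ub QU Ud]] := ae_null a b fS d'0.
pose m t := fine (mu (U `&` `]a, t]%classic)).
(* The chain [l] records the pieces handled inside [U], whose length is paid for by the growth of
   [m]. Every term of the bound is additive, and [w] is averaged with the interval lengths as
   weights, so [P] passes to adjacent unions. *)
pose P (s t : R) := s < t -> exists w l, [/\ S w, chain s l t,
   \sum_(i <- l) (i.2 - i.1) <= m t - m s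
 & `|f t - f s - (t - s) *: w| <=
    e1 * (t - s) + K * (m t - m s) + \sum_(i <- l) `|f i.2 - f i.1|].
have : P a b.
  apply: cousin; first exact: ltW.
  - move=> s t u as_; rewrite le_eqVlt => /orP[/eqP <-//|st].
    rewrite le_eqVlt => /orP[/eqP <-//|tu] ub.
    move=> /(_ st)[w1 [l1 [Sw1 c1 m1 f1]]] /(_ tu)[w2 [l2 [Sw2 c2 m2 f2]]] su.
    have us : 0 < u - s by lra.
    exists (((t - s) / (u - s)) *: w1 + (1 - (t - s) / (u - s)) *: w2), (l1 ++ l2).
    split.
    + apply: cS => //; rewrite divr_ge0 ?ler_pdivrMr//; lra.
    + exact: chain_cat c1 c2.
    + rewrite big_cat /=; lra.
    + rewrite big_cat /= scalerDr !scalerA.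
      have -> : (u - s) * ((t - s) / (u - s)) = t - s by field; lra.
      have -> : (u - s) * (1 - (t - s) / (u - s)) = u - t by field; lra.
      have -> : f u - f s - ((t - s) *: w1 + (u - t) *: w2) =
         (f t - f s - (t - s) *: w1) + (f u - f t - (u - t) *: w2).
        rewrite opprD [RHS]addrACA; congr (_ + _).
        by rewrite addrC subrKA.
      apply: le_trans (ler_normD _ _) _; lra.
  - move=> t /andP[at_ tb].
    have [Ut|nUt] := pselect (U t).
      have [r /= r0 rU] := (open_nbhs_nbhs (conj oU Ut) : nbhs t U).
      exists r => // s s' as_ s'b /andP[st ts'] ts s't ss'.
      have mE : m s' - m s = s' - s.
        apply: (distr_itv oU Ud) => //; first lra.
        by move=> x xs; apply: rU; rewrite /ball/= ltr_norml; lra.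
      exists s0, [:: (s, s')]; split => //=.
      + by split => //; lra.
      + by rewrite big_seq1 mE.
      + rewrite big_seq1 mE /=.
        apply: le_trans (ler_normB _ _) _.
        rewrite normrZ ger0_norm; last by rewrite subr_ge0 ltW.
        rewrite -/K mulrC.
        have : 0 <= e1 * (s' - s) by rewrite mulr_ge0//; lra.
        lra.
    have /contrapT Qt : ~ ~ (a < t < b -> derivable f t 1 /\ S (derive1 f t)).
      by move=> H; apply: nUt; exact: QU.
    have tab : a < t < b.
      rewrite !lt_neqAle at_ tb !andbT; apply/andP; split; apply/eqP => E.
        by apply: nUt; rewrite -E.
      by apply: nUt; rewrite E.
    have [df Sf] := Qt tab.
    have [r r0 rf] := derivable_expand df e10.
    exists r => // s s' as_ s'b /andP[st ts'] ts s't ss'.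
    exists (derive1 f t), [::]; split => //=; first exact: ltW.
    + rewrite big_nil; exact: (distr_ge0 oU Ud as_ (ltW ss')).
    + rewrite big_nil addr0.
      have H1 := rf s ltac:(rewrite ltr_norml; lra).
      have H2 := rf s' ltac:(rewrite ltr_norml; lra).
      have H3 := distr_ge0 oU Ud as_ (ltW ss').
      have -> : f s' - f s - (s' - s) *: derive1 f t =
         (f s' - f t - (s' - t) *: derive1 f t) - (f s - f t - (s - t) *: derive1 f t).
        have -> : s' - s = (s' - t) - (s - t) by lra.
        by rewrite subr3 scalerBl.
      apply: le_trans (ler_normB _ _) _.
      have : 0 <= K * (m s' - m s) by rewrite mulr_ge0// /K normr_ge0.
      move: H1 H2; rewrite (ler0_norm (_ : s - t <= 0)) ?(ger0_norm (_ : 0 <= s' - t)); lra.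
move=> /(_ ab)[w [l [Sw cl ml fl]]]; exists w => //.
apply: le_trans fl _.
have mab : m b - m a <= d' by exact: (distr_le a oU Ud b).
have mab0 : 0 <= m b - m a by apply: (distr_ge0 oU Ud) => //; exact: ltW.
have H1 : \sum_(i <- l) `|f i.2 - f i.1| < e / 3.
  apply: Hd => //; apply: le_lt_trans ml _; apply: le_lt_trans mab _.
  by rewrite gt_min; apply/orP; left; lra.
have H2 : K * (m b - m a) <= e / 3.
  have H3 : m b - m a <= e / 3 / (K + 1).
    by apply: le_trans mab _; rewrite ge_min lexx orbT.
  rewrite ler_pdivlMr// in H3; lra.
have H3 : e1 * (b - a) = e / 3 by rewrite /e1; field; lra.
lra.
Qed.

Lemma lip_of_derive (V : normedModType R) (f : R -> V) (a b L : R) :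
  a <= b -> 0 <= L -> ac_on f a b ->
  {ae mu, forall t, a < t < b -> derivable f t 1 /\ `|derive1 f t| <= L} ->
  `|f b - f a| <= L * (b - a).
Proof.
rewrite le_eqVlt => /orP[/eqP ->|ab]; first by rewrite !subrr normr0 mulr0.
move=> L0 acf fL; apply/ler_addgt0Pl => e e0.
have [||w wL fw] := @mean_value_convex _ f a b [set v | `|v| <= L] 0 ab acf fL
  _ _ _ e0.
- by rewrite /= normr0.
- move=> x y p /= xL yL /andP[p0 p1]; apply: le_trans (ler_normD _ _) _.
  rewrite !normrZ ger0_norm// ger0_norm ?subr_ge0//.
  have : p * `|x| <= p * L by rewrite ler_wpM2l.
  have : (1 - p) * `|y| <= (1 - p) * L by rewrite ler_wpM2l// subr_ge0.
  lra.
have : `|f b - f a| <= `|f b - f a - (b - a) *: w| + `|(b - a) *: w|.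
  by rewrite -{1}(subrK ((b - a) *: w) (f b - f a)); exact: ler_normD.
rewrite normrZ gtr0_norm ?subr_gt0//.
have : (b - a) * `|w| <= (b - a) * L by rewrite ler_wpM2l// subr_ge0 ltW.
lra.
Qed.

Lemma nonincr_of_derive (f : R -> R) (a b L : R) : a <= b ->
  (forall s t, a <= s -> s <= t -> t <= b -> `|f t - f s| <= L * (t - s)) ->
  {ae mu, forall t, a < t < b -> derivable f t 1 /\ derive1 f t <= 0} ->
  f b <= f a.
Proof.
rewrite le_eqVlt => /orP[/eqP ->//|ab] fL f0.
apply/ler_addgt0Pl => e e0.
have [||w w0 fw] := @mean_value_convex _ f a b [set v | v <= 0] 0 ab
  (lip_ac fL) f0 _ _ _ e0.
- by rewrite /= lexx.
- move=> x y p /= x0 y0 /andP[p0 p1].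
  have : p * x <= 0 by rewrite mulr_ge0_le0.
  have : (1 - p) * y <= 0 by rewrite mulr_ge0_le0// subr_ge0.
  rewrite /GRing.scale/=; lra.
have : (b - a) * w <= 0 by rewrite mulr_ge0_le0// subr_ge0 ltW.
move: fw; rewrite ler_norml /GRing.scale/=; lra.
Qed.

End MeanValue.

(** * Lipschitz functions are almost everywhere differentiable *)

Section LipschitzDifferentiability.
Context {R : realType}.
Notation mu := (@lebesgue_measure R).

(** A normalised nondecreasing Lipschitz function is the distribution function
    of an absolutely continuous probability, so it is the integral of a
    Radon-Nikodym density and Lebesgue differentiation applies. *)
Section cumulative.
Variables (g : R -> R) (a b K : R).
Hypothesis ab : a < b.
Hypothesis g_nd : nondecreasing g.
Hypothesis g_lip : forall s t, s <= t -> g t - g s <= K * (t - s).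
Hypothesis g_left : forall t, t <= a -> g t = 0.
Hypothesis g_right : forall t, b <= t -> g t = 1.

Let g_continuous : continuous g.
Proof.
move=> x; apply/cvgrPdist_lt => e e0.
have K1 : 0 < `|K| + 1 by rewrite ltr_wpDl.
have d0 : 0 < e / (`|K| + 1) by rewrite divr_gt0.
near=> y.
have xy : `|x - y| < e / (`|K| + 1) by near: y; exact: cvgr_dist_lt.
rewrite ltr_pdivlMr// in xy.
have KK : K <= `|K| := ler_norm K.
have H (s t : R) : s <= t -> `|s - t| * (`|K| + 1) < e -> `|g s - g t| < e.
  move=> st ste; have st0 : 0 <= t - s by lra.
  rewrite distrC ger0_norm ?subr_ge0 ?g_nd//.
  apply: le_lt_trans (g_lip st) _; apply: le_lt_trans ste.
  rewrite distrC ger0_norm// mulrC ler_wpM2l//; lra.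
have [xley|yltx] := leP x y; first exact: H.
by rewrite distrC; apply: H; [exact: ltW|rewrite distrC].
Unshelve. all: by end_near. Qed.

HB.instance Definition _ := isCumulative.Build R _ R g g_nd
  (right_continuousW g_continuous).

Let g_cvgNy : g @ -oo --> (0 : R).
Proof.
apply: cvg_near_cst; near=> x; apply: g_left; near: x.
by apply: nbhs_ninfty_le; rewrite num_real.
Unshelve. all: by end_near. Qed.

Let g_cvgy : g @ +oo --> (1 : R).
Proof.
apply: cvg_near_cst; near=> x; apply: g_right; near: x.
by apply: nbhs_pinfty_ge; rewrite num_real.
Unshelve. all: by end_near. Qed.

HB.instance Definition _ := isCumulativeBounded.Build R 0 1 g g_cvgNy g_cvgy.

Let P : {finite_measure set (measurableTypeR R) -> \bar R} :=
  lebesgue_stieltjes_measure g.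

Let PE (s t : R) : s <= t -> P `]s, t]%classic = (g t - g s)%:E.
Proof.
move=> st; rewrite /P/= /lebesgue_stieltjes_measure.
rewrite /measure_extension measurable_mu_extE/=; last exact: is_ocitv.
by rewrite wlength_itv_bnd.
Qed.

Let K0 : 0 <= K.
Proof.
have := g_lip (ltW ab); rewrite (g_left (lexx a)) (g_right (lexx b)) subr0.
move=> H; have : 0 < K * (b - a) by lra.
by rewrite pmulr_lgt0 ?subr_gt0// => /ltW.
Qed.

(** The Lipschitz bound compares the two measures on half-open intervals, and countable covers by
    such intervals carry the comparison to null sets. *)
Let Pmu : P `<< mu.
Proof.
apply/null_content_dominatesP => A mA A0.
apply/eqP; rewrite eq_le measure_ge0 andbT; apply/lee_addgt0Pr => e e0.
rewrite add0e.
have K1 : 0 < K + 1 by rewrite ltr_wpDl.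
have eK : (mu A < (e / (K + 1))%:E)%E.
  by rewrite (A0 : mu A = 0%E) lte_fin divr_gt0.
have [_ [F [mF AF] <-] Fe] := ereal_inf_lt eK.
apply: (@le_trans _ _ (\sum_(k <oo) wlength g (F k))%E).
  by apply: ereal_inf_lbound; exists F.
apply: (@le_trans _ _ (\sum_(k <oo) (K%:E * wlength idfun (F k)))%E).
  apply: lee_nneseries => [k _ _|k _]; first exact: wlength_ge0.
  have /ocitvP[->|[[x y] /= xy ->]] := mF k.
    by rewrite !wlength0 mule0.
  rewrite !wlength_itv_bnd ?(ltW xy)// -EFinM lee_fin; exact/g_lip/ltW.
rewrite nneseriesZl//.
apply: (@le_trans _ _ (K%:E * (e / (K + 1))%:E)%E).
  by rewrite lee_wpmul2l ?lee_fin// ltW.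
rewrite -EFinM lee_fin mulrA ler_pdivrMr// mulrC.
by apply: ler_wpM2l; [exact: ltW|rewrite lerDl].
Qed.

Lemma cumulative_ae_derivable :
  {ae mu, forall t, a < t -> derivable g t 1}.
Proof.
pose phi := Radon_Nikodym_SigmaFinite.f P mu.
have phi_int := Radon_Nikodym_SigmaFinite.f_integrable Pmu.
have phi_fin := Radon_Nikodym_SigmaFinite.f_fin_num Pmu.
have phiE : EFin \o (fine \o phi) = phi.
  by apply/funext => x /=; rewrite fineK// phi_fin.
pose F (x : R) := (\int[mu]_(t in `]a, x]) (fine \o phi) t)%R.
have FE x : a <= x -> F x = g x.
  move=> ax; rewrite /F /Rintegral.
  have -> : (\int[mu]_(t in `]a, x]) ((fine \o phi) t)%:E =
            \int[mu]_(t in `]a, x]) phi t)%E.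
    by apply: eq_integral => t _ /=; rewrite fineK// phi_fin.
  rewrite -(Radon_Nikodym_SigmaFinite.f_integral Pmu)//.
  by rewrite PE//= (g_left (lexx a)) subr0.
have iphi : mu.-integrable setT (EFin \o (fine \o phi)) by rewrite phiE.
have iphi' y : mu.-integrable `]a, y] (EFin \o (fine \o phi)).
  by apply: integrableS iphi => //; exact: measurable_itv.
have locphi : locally_integrable setT (fine \o phi).
  exact: open_integrable_locally openT iphi.
have := @FTC1 R (fine \o phi) (BRight a) iphi' locphi.
apply: aeS => t /= + at_.
rewrite lte_fin => /(_ at_)[dF _].
apply: near_eq_derivable dF; near=> y; apply: FE; near: y.
by apply: filterS (lt_nbhsr at_) => y /ltW.
Unshelve. all: by end_near.
Qed.

End cumulative.

Definition clamp (a b t : R) := Num.max a (Num.min t b).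

Lemma clampP (a b t : R) : a <= b ->
  [\/ t <= a /\ clamp a b t = a, a <= t <= b /\ clamp a b t = t
    | b <= t /\ clamp a b t = b].
Proof.
move=> ab; rewrite /clamp; have [tb|bt] := lerP t b.
  have [ta|at_] := lerP t a; first by constructor 1.
  by constructor 2; rewrite (ltW at_).
by constructor 3; rewrite (max_r ab) (ltW bt).
Qed.

Lemma clamp_itv (a b t : R) : a <= b -> a <= clamp a b t <= b.
Proof. by move=> ab; case: (clampP t ab) => -[? ->]; lra. Qed.

Lemma clamp_id (a b t : R) : a <= t <= b -> clamp a b t = t.
Proof.
by move=> /andP[? ?]; case: (@clampP a b t) => [|[? ->]|[? ->]|[? ->]]; lra.
Qed.

Lemma clamp_le (a b s t : R) : a <= b -> s <= t -> clamp a b s <= clamp a b t.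
Proof.
by move=> ab st; case: (clampP t ab) => -[? ->];
  case: (clampP s ab) => -[? ->]; lra.
Qed.

Lemma clamp_lip (a b s t : R) : a <= b -> s <= t ->
  clamp a b t - clamp a b s <= t - s.
Proof.
by move=> ab st; case: (clampP t ab) => -[? ->];
  case: (clampP s ab) => -[? ->]; lra.
Qed.

(** Adding [2 * L1 * t] makes [f] increasing without changing where it is differentiable. Clamped to
    a bounded interval and rescaled, the result is a cumulative distribution function. Taking
    [L1 = L + 1] rather than [L] keeps the total increase [T] positive for constant [f]. *)
Lemma lipschitz_ae_derivable (f : R -> R) (L : R) :
  (forall s t, `|f s - f t| <= L * `|s - t|) ->
  {ae mu, forall t, derivable f t 1}.
Proof.
move=> fL.
have L0 : 0 <= L.
  have := fL 1 0; rewrite subr0 normr1 mulr1; exact: le_trans.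
pose L1 := L + 1; have L10 : 0 < L1 by rewrite ltr_wpDl.
have fL1 s t : s <= t -> `|f s - f t| <= L1 * (t - s).
  move=> st; apply: le_trans (fL s t) _.
  rewrite distrC ger0_norm ?subr_ge0// ler_wpM2r ?subr_ge0// lerDl//.
suff H (n : nat) : {ae mu, forall t, - n.+1%:R < t < n.+1%:R -> derivable f t 1}.
  have := ae_foralln H.
  apply: aeS => t Ht.
  pose n := Num.bound `|t|; have nt : `|t| < n%:R by exact: archi_boundP.
  apply: (Ht n); rewrite -ltr_norml; apply: lt_le_trans nt _.
  by rewrite ler_nat.
pose a : R := - n.+1%:R; pose b : R := n.+1%:R.
have n0 : 0 < n.+1%:R :> R by rewrite ltr0n.
have ab : a < b by rewrite /a /b; lra.
pose h t := f t + 2 * L1 * t.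
have hB s t : s <= t -> L1 * (t - s) <= h t - h s <= 3 * L1 * (t - s).
  by move=> st; have := fL1 s t st; rewrite /h ler_norml => /andP[? ?]; lra.
pose T := h b - h a.
have T0 : 0 < T.
  have /andP[+ _] := hB a b (ltW ab); apply: lt_le_trans.
  by rewrite mulr_gt0// subr_gt0.
have Tn0 : T != 0 by rewrite gt_eqF.
pose g t := (h (clamp a b t) - h a) / T.
have cl_a t : t <= a -> clamp a b t = a.
  by move=> ta; case: (clampP t (ltW ab)) => -[? ->]; lra.
have cl_b t : b <= t -> clamp a b t = b.
  by move=> bt; case: (clampP t (ltW ab)) => -[? ->]; lra.
have gB s t : g t - g s = (h (clamp a b t) - h (clamp a b s)) / T.
  by rewrite /g; field.
have := @cumulative_ae_derivable g a b (3 * L1 / T) ab _ _ _ _.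
move=> H; apply: aeS (H _ _ _ _).
- move=> t + /andP[at_ tb] => /(_ at_) dg.
  have E : {near t, (fun x => T * g x - (2 * L1 * x) + h a) =1 f}.
    have : \forall x \near t, a < x < b.
      near=> x; apply/andP; split; near: x; [exact: lt_nbhsr|exact: lt_nbhsl].
    apply: filterS => x /andP[ax xb]; rewrite /g clamp_id; last by rewrite !ltW.
    by rewrite /h; field.
  apply: near_eq_derivable E _.
  apply: derivableD; last exact: derivable_cst.
  apply: derivableB.
    by apply: (@derivableM _ _ (cst T) g); [exact: derivable_cst|exact: dg].
  apply: (@derivableM _ _ (cst (2 * L1)) id); first exact: derivable_cst.
  exact: derivable_id.
- move=> s t st; rewrite -subr_ge0 gB divr_ge0//; last exact: ltW.
  have /andP[+ _] := hB _ _ (clamp_le (ltW ab) st); apply: le_trans.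
  by rewrite mulr_ge0 ?(ltW L10)// subr_ge0 clamp_le// ltW.
- move=> s t st; rewrite gB [leRHS]mulrAC ler_pM2r ?invr_gt0//.
  have /andP[_ +] := hB _ _ (clamp_le (ltW ab) st) => /le_trans; apply.
  by apply: ler_wpM2l; [lra|by apply: clamp_lip => //; exact: ltW].
- by move=> t ta; rewrite /g cl_a// subrr mul0r.
- by move=> t tb; rewrite /g cl_b// divff.
Unshelve. all: by end_near. Qed.

Lemma lipschitz_ae_derivable_rV p (f : R -> 'rV[R]_p) (L : R) :
  (forall s t, `|f s - f t| <= L * `|s - t|) ->
  {ae mu, forall t, derivable f t 1}.
Proof.
move=> fL.
have H (i : 'I_p) : {ae mu, forall t, derivable (fun t => f t ord0 i) t 1}.
  apply: (@lipschitz_ae_derivable _ L) => s t; apply: le_trans (fL s t).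
  rewrite [leRHS]/Num.Def.normr/= mx_normrE.
  by apply: le_trans (le_bigmax _ _ (ord0, i)); rewrite !mxE.
have : {ae mu, forall t, forall i : 'I_p, derivable (fun t => f t ord0 i) t 1}.
  exact: filter_forall.
by apply: aeS => t Ht; apply/derivable_mxP => i j; rewrite ord1.
Qed.

End LipschitzDifferentiability.

(** * Hybrid time domains and maximal solutions *)

Section TimeDomains.
Context {R : realType}.
Implicit Types (E : set (R * nat)) (tau : nat -> R).

(** The path in [E] from [(0, 0)] to [(t, j)], encoded by its jump times; values of [tau] beyond
    index [j.+1] are irrelevant. *)
Definition arc_to E (t : R) (j : nat) tau :=
  [/\ tau 0%N = 0, forall i, (i <= j)%N -> tau i <= tau i.+1, tau j.+1 = t
    & forall i s, (i <= j)%N -> tau i <= s <= tau i.+1 -> E (s, i)].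

Definition before (p q : R * nat) := p.1 <= q.1 /\ (p.2 <= q.2)%N.

(** Equivalent to being a hybrid time domain, but visibly stable under unions of
    chains. *)
Definition tree_like E :=
  [/\ exists p, E p,
      forall t j, E (t, j) -> exists tau, arc_to E t j tau
    & forall p q, E p -> E q -> before p q \/ before q p].

Lemma tau_le tau j : (forall i, (i <= j)%N -> tau i <= tau i.+1) ->
  forall a b, (a <= b)%N -> (b <= j.+1)%N -> tau a <= tau b.
Proof.
move=> H a; elim=> [|b IH]; first by rewrite leqn0 => /eqP ->.
rewrite leq_eqVlt => /orP[/eqP ->//|ab] bj.
by apply: le_trans (IH ab (ltnW bj)) (H _ _).
Qed.

Lemma arc_to_sub E E' t j tau : E `<=` E' -> arc_to E t j tau ->
  arc_to E' t j tau.
Proof. by move=> EE' [? ? ? H]; split => // i s ij si; apply/EE'/H. Qed.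

Lemma compact_tree_like E : compact_hybrid_time_domain E -> tree_like E.
Proof.
move=> [N [tau [N0 tau0 tauS ->]]].
have tauS' j : (j < N)%N -> forall i, (i <= j)%N -> tau i <= tau i.+1.
  by move=> jN i ij; apply: tauS; exact: leq_ltn_trans jN.
split.
- by exists (0, 0%N); split => //=; rewrite tau0 lexx -{1}tau0 tauS.
- move=> t j [/= jN /andP[tj jt]].
  exists (fun i => if (i <= j)%N then tau i else t); split.
  + by rewrite tau0.
  + move=> i ij; rewrite ij; case: ltngtP ij => // [ij _|->//].
    by apply: tauS; exact: ltn_trans jN.
  + by rewrite ltnn.
  + move=> i s ij; rewrite ij; case: ltngtP ij => // [ij _|-> _] /andP[s1 s2].
      by split => /=; [exact: ltn_trans jN|rewrite s1 s2].
    by split => //=; rewrite s1 (le_trans s2).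
- have H p q : (p.2 < N)%N /\ tau p.2 <= p.1 <= tau p.2.+1 ->
    (q.2 < N)%N /\ tau q.2 <= q.1 <= tau q.2.+1 -> (p.2 < q.2)%N -> before p q.
    move=> [pN /andP[_ p2]] [qN /andP[q1 _]] pq; split; last exact: ltnW.
    apply: le_trans p2 (le_trans _ q1).
    exact: (tau_le (tauS' _ qN)).
  move=> p q Ep Eq; case: (ltngtP p.2 q.2) => pq.
  + by left; apply: H.
  + by right; apply: H.
  + by rewrite /before pq leqnn; have [|/ltW] := leP p.1 q.1; [left|right].
Qed.

Lemma tree_like_htd E : hybrid_time_domain E -> tree_like E.
Proof.
move=> [K [cK Kn ->]].
have Kle a b : (a <= b)%N -> K a `<=` K b.
  elim: b => [|b IH]; first by rewrite leqn0 => /eqP ->.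
  rewrite leq_eqVlt => /orP[/eqP ->//|/IH ab].
  exact: subset_trans ab (Kn b).
split.
- by have [[p Kp] _ _] := compact_tree_like (cK 0%N); exists p, 0%N.
- move=> t j [i _ Ki]; have [_ /(_ t j Ki)[tau Htau] _] := compact_tree_like (cK i).
  by exists tau; apply: arc_to_sub Htau; exact: bigcup_sup.
- move=> p q [a _ Ka] [b _ Kb].
  have [_ _] := compact_tree_like (cK (maxn a b)).
  by apply; [apply: Kle Ka; exact: leq_maxl|apply: Kle Kb; exact: leq_maxr].
Qed.

(** A point off the path would be incomparable with one of the jump points of the path, against the
    total order on [E]. *)
Lemma tree_like_before E t j tau s i : tree_like E -> arc_to E t j tau ->
  E (s, i) -> before (s, i) (t, j) -> tau i <= s <= tau i.+1.
Proof.
move=> [_ H1 H2] [tau0 tauS taut Etau] Esi [/= st ij].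
have s0 : 0 <= s.
  have [sg [sg0 sgS sgt _]] := H1 _ _ Esi.
  by rewrite -sg0 -sgt; apply: (tau_le sgS).
apply/andP; split.
- case: i ij Esi => [|i] ij Esi; first by rewrite tau0.
  rewrite leNgt; apply/negP => si.
  have Ei : E (tau i.+1, i).
    by apply: Etau; [exact: ltnW|rewrite lexx tauS// ltnW].
  have [[/= _]|[/=]] := H2 _ _ Esi Ei; first by rewrite ltnn.
  by rewrite leNgt si.
- move: ij; rewrite leq_eqVlt => /orP[/eqP ->|ij]; first by rewrite taut.
  rewrite leNgt; apply/negP => si.
  have Ei : E (tau i.+1, i.+1) by apply: Etau => //; rewrite lexx tauS.
  have [[/=]|[/= _]] := H2 _ _ Esi Ei; first by rewrite leNgt si.
  by rewrite ltnn.
Qed.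

(** Without a maximum, a rational number fits between any point of [S] and some later one. Choosing
    a point of [S] above each rational that admits one, and taking running maxima, gives the
    sequence. *)
Lemma cofinal_seq (S : set R) : S !=set0 -> exists s : nat -> R,
  [/\ forall k, S (s k), forall k, s k <= s k.+1
    & forall x, S x -> exists k, x <= s k].
Proof.
move=> [s0 Ss0].
have [[M [SM MS]]|noM] := pselect (exists M, S M /\ forall x, S x -> x <= M).
  by exists (fun=> M); split => // x /MS; exists 0%N.
have up x : S x -> exists2 y, S y & x < y.
  move=> Sx; apply: contrapT => H; apply: noM; exists x; split => // y Sy.
  by rewrite leNgt; apply/negP => xy; apply: H; exists y.
pose q (k : nat) : R := if unpickle k is Some r then ratr (r : rat) else 0.
have /choice[c Hc] : forall k, exists y, S y /\
    ((exists2 x, S x & q k <= x) -> q k <= y).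
  move=> k.
  have [[x Sx qx]|H] := pselect (exists2 x, S x & q k <= x).
    by exists x.
  by exists s0; split => // /H.
pose s := fix s k := if k is k'.+1 then Num.max (s k') (c k) else c 0%N.
have sc k : c k <= s k by case: k => [|k] /=; rewrite ?lexx// le_max lexx orbT.
exists s; split.
- elim=> [|k IH] /=; first by case: (Hc 0%N).
  by rewrite /Num.max; case: ifP => // _; case: (Hc k.+1).
- by move=> k /=; rewrite le_max lexx.
- move=> x Sx; have [y Sy xy] := up x Sx.
  have [r] := rat_in_itvoo xy; rewrite in_itv/= => /andP[xr ry].
  exists (pickle r); apply: le_trans (ltW xr) _.
  apply: le_trans (sc _).
  have qr : q (pickle r) = ratr r by rewrite /q pickleK.
  by rewrite -qr; apply: (Hc _).2; exists y => //; rewrite qr ltW.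
Qed.

(** The real number [t + j] orders [E] faithfully, so a cofinal sequence of its values yields points
    [p k] whose initial segments [K k] exhaust [E]; by [tree_like_before] each segment is the path
    to [p k], hence compact. *)
Lemma htd_tree_like E : tree_like E -> hybrid_time_domain E.
Proof.
move=> tE; have [[p0 Ep0] H1 H2] := tE.
pose phi (p : R * nat) : R := p.1 + p.2%:R.
have phi_before p q : E p -> E q -> phi p <= phi q -> before p q.
  move=> Ep Eq; have [//|[qp1 qp2]] := H2 _ _ Ep Eq.
  rewrite /phi => pq; have : (q.2%:R : R) <= p.2%:R by rewrite ler_nat.
  move=> qp3; split; first lra.
  by rewrite -(ler_nat R); lra.
have [s [sE sS scof]] : exists s : nat -> R,
  [/\ forall k, (phi @` E) (s k), forall k, s k <= s k.+1
    & forall x, (phi @` E) x -> exists k, x <= s k].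
  by apply: cofinal_seq; exists (phi p0), p0.
have /choice[p Hp] : forall k, exists p, E p /\ phi p = s k.
  by move=> k; have [x Ex xs] := sE k; exists x.
have /choice[tau Htau] : forall k, exists tau, arc_to E (p k).1 (p k).2 tau.
  by move=> k; apply: H1; rewrite -surjective_pairing; case: (Hp k).
pose K k := [set u : R * nat | (u.2 < (p k).2.+1)%N /\
  tau k u.2 <= u.1 <= tau k u.2.+1].
have KE k : K k = [set u | E u /\ before u (p k)].
  apply/seteqP; split=> -[u i]; rewrite /K/=.
    move=> [ui uu]; have [_ tS tt tE'] := Htau k.
    split; first exact: tE'.
    split => //=; rewrite -tt; case/andP: uu => _ /le_trans; apply.
    exact: (tau_le tS).
  move=> [Eu bu]; split; first by case: bu.
  by apply: (tree_like_before tE (Htau k)) => //; rewrite -surjective_pairing.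
exists K; split.
- move=> k; exists (p k).2.+1, (tau k); have [t0 tS _ _] := Htau k.
  by split.
- move=> k; rewrite !KE => u [Eu [u1 u2]]; split => //.
  have [v1 v2] : before (p k) (p k.+1).
    by apply: phi_before; [case: (Hp k)|case: (Hp k.+1)|
      rewrite (Hp k).2 (Hp k.+1).2].
  by split; [exact: le_trans v1|exact: leq_trans v2].
- apply/seteqP; split=> [u Eu|u [k _]]; last by rewrite KE => -[].
  have [k uk] : exists k, phi u <= s k by apply: scof; exists u.
  exists k => //; rewrite KE; split => //; apply: phi_before => //.
    by case: (Hp k).
  by rewrite (Hp k).2.
Qed.

Lemma slice_convex E j a b t : tree_like E -> E (a, j) -> E (b, j) ->
  a <= t <= b -> E (t, j).
Proof.
move=> tE Ea Eb /andP[at_ tb].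
have [_ H1 _] := tE; have [tau Htau] := H1 _ _ Eb.
have /andP[ta _] : tau j <= a <= tau j.+1.
  by apply: (tree_like_before tE Htau) => //; split => //=; exact: le_trans tb.
have [_ _ tb' HE] := Htau; apply: HE => //.
by rewrite (le_trans ta)// tb' tb.
Qed.

Lemma htd00 E : tree_like E -> E (0, 0%N).
Proof.
move=> [[[t j] Ep] H1 _]; have [tau [t0 tS _ HE]] := H1 _ _ Ep.
by apply: HE => //; rewrite t0 lexx -{1}t0 tS.
Qed.

End TimeDomains.

(** * Unions of chains of solutions and extension to maximal solutions *)

Section MaximalExtension.
Context {R : realType}.
Notation mu := (@lebesgue_measure R).

Lemma ae_neq (m : R) : {ae mu, forall t, t <> m}.
Proof.
exists [set m]; split; first exact: measurable_set1.
  exact: lebesgue_measure_set1.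
by move=> t /= /contrapT ->.
Qed.

(** The only possible exceptions are a least and a greatest element of [I]. When one of them does
    not exist, [xget] returns [0], and discarding that point does no harm. *)
Lemma ae_interior (I : set R) :
  {ae mu, forall t, I t -> exists a b, [/\ I a, I b & a < t < b]}.
Proof.
pose m1 := xget 0 [set t | I t /\ forall a, I a -> t <= a].
pose m2 := xget 0 [set t | I t /\ forall a, I a -> a <= t].
apply: aeS (aeI (ae_neq m1) (ae_neq m2)) => t [tm1 tm2] It.
have [[a Ia at_]|na] := pselect (exists2 a, I a & a < t); last first.
  have Mt : I t /\ forall a, I a -> t <= a.
    by split => // a Ia; rewrite leNgt; apply/negP => at_; apply: na; exists a.
  exfalso; apply: tm1; rewrite /m1; case: xgetP => [x _ [Ix xI]|/(_ t)//].
  by apply/le_anti; rewrite xI// (Mt.2 _ Ix).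
have [[b Ib tb]|nb] := pselect (exists2 b, I b & t < b); last first.
  have Mt : I t /\ forall a, I a -> a <= t.
    by split => // c Ic; rewrite leNgt; apply/negP => at'; apply: nb; exists c.
  exfalso; apply: tm2; rewrite /m2; case: xgetP => [x _ [Ix xI]|/(_ t)//].
  by apply/le_anti; rewrite xI// (Mt.2 _ Ix).
by exists a, b; rewrite at_ tb.
Qed.

Lemma slice_interior (E : set (R * nat)) j a b t : tree_like E ->
  E (a, j) -> E (b, j) -> a < t < b -> (slice E j)° t.
Proof.
move=> tE Ea Eb /andP[at_ tb]; rewrite /interior.
have : \forall x \near t, a < x < b.
  near=> x; apply/andP; split; near: x; [exact: lt_nbhsr|exact: lt_nbhsl].
apply: filterS => x /andP[ax xb]; apply: (slice_convex tE Ea Eb).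
by rewrite !ltW.
Unshelve. all: by end_near. Qed.

Variables (p : nat) (H : @hybrid_system R p).
Let dat := (set (R * nat) * (R -> nat -> 'rV[R]_p))%type.

Definition extends (s s' : dat) :=
  s.1 `<=` s'.1 /\ forall t j, s.1 (t, j) -> s'.2 t j = s.2 t j.

Section chain.
Variable A : set dat.
Hypothesis A0 : A !=set0.
Hypothesis Asol : forall s, A s -> solution H s.1 s.2.
Hypothesis Atot : forall s s', A s -> A s' -> extends s s' \/ extends s' s.

Let E : set (R * nat) := [set q | exists2 s, A s & s.1 q].
Let x (t : R) (j : nat) : 'rV[R]_p :=
  (xget (point : dat) [set s | A s /\ s.1 (t, j)]).2 t j.

Lemma chain_extends s : A s -> extends s (E, x).
Proof.
move=> As; split => [q sq|t j sq] /=; first by exists s.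
rewrite /x; case: xgetP => [s' _ [As' s'q]|/(_ s)]; last first.
  by move=> /(_ (conj As sq)).
by case: (Atot As As') => -[_ e]; rewrite e.
Qed.

Let xE s t j : A s -> s.1 (t, j) -> x t j = s.2 t j.
Proof. by move=> As; apply: (chain_extends As).2. Qed.

Let Atree s : A s -> tree_like s.1.
Proof. by move=> /Asol[[/tree_like_htd]]. Qed.

Let common q q' : E q -> E q' -> exists2 s, A s & s.1 q /\ s.1 q'.
Proof.
move=> [s As sq] [s' As' sq'].
by case: (Atot As As') => -[e _]; [exists s'|exists s] => //; split => //; exact: e.
Qed.

Lemma chain_tree_like : tree_like E.
Proof.
split.
- have [s As] := A0; have [[q sq] _ _] := Atree As.
  by exists q, s.
- move=> t j [s As sq]; have [_ /(_ _ _ sq)[tau Htau] _] := Atree As.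
  by exists tau; apply: arc_to_sub Htau; case: (chain_extends As).
- move=> q q' Eq Eq'; have [s As [sq sq']] := common Eq Eq'.
  by have [_ _] := Atree As; apply.
Qed.

Lemma abs_continuous_eq (f g : R -> 'rV[R]_p) a b :
  (forall t, a <= t <= b -> f t = g t) ->
  abs_continuous f a b -> abs_continuous g a b.
Proof.
move=> fg fac e /fac[d d0 Hd]; exists d => // N s t Hst tr std.
rewrite (_ : \sum_(k < N) _ = \sum_(k < N) enorm (f (t k) - f (s k))).
  exact: Hd.
by apply: eq_bigr => k _; have [? [? ?]] := Hst k; rewrite !fg//; lra.
Qed.

Lemma chain_solution : solution H E x.
Proof.
have tE := chain_tree_like.
split.
- split; first exact: htd_tree_like.
  move=> j _ a b ab abE.
  (* A compact interval lies in the domain of one member of the chain: two end points suffice,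
     slices being convex. *)
  have [s As [sa sb]] : exists2 s, A s & s.1 (a, j) /\ s.1 (b, j).
    by apply: common; apply: abE; rewrite /= in_itv/= lexx ab.
  move: ab; rewrite le_eqVlt => /orP[/eqP <-|ab].
    move=> e e0; exists 1 => // N u v Huv _ _.
    rewrite big1// => k _.
    have [? [? ?]] := Huv k; have -> : u k = v k by lra.
    rewrite subrr /enorm big1 ?sqrtr0// => i _.
    by rewrite mxE expr0n.
  apply: (@abs_continuous_eq (s.2^~ j)).
    move=> t tab; rewrite (xE As)//.
    exact: (slice_convex (Atree As) sa sb).
  have [[_ +] _ _ _] := Asol As.
  move=> /(_ j); apply.
  + exists ((a + b) / 2); apply: (slice_interior (Atree As) sa sb); lra.
  + exact: ltW.
  + move=> t /=; rewrite in_itv/= => tab.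
    exact: (slice_convex (Atree As) sa sb).
- have [s As] := A0; have s00 := htd00 (Atree As).
  rewrite (xE As)//.
  by have [_ + _ _] := Asol As.
- move=> j _.
  (* The chain may be uncountable, so the null sets of its members cannot simply be united. Each
     interval with rational ends in the slice is covered by a single member, which leaves countably
     many null sets. *)
  pose Q (n : nat) (t : R) := if unpickle n is Some (q1, q2) then
    E (ratr (q1 : rat), j) -> E (ratr (q2 : rat), j) -> ratr q1 < t < ratr q2 ->
    [/\ flow_set H (x t j), derivable (x^~ j) t 1
            & flow_map H (x t j) (derive1 (x^~ j) t)] else True.
  have HQ (n : nat) : {ae mu, forall t, Q n t}.
    rewrite /Q; case: unpickle => [[q1 q2]|]; last exact: aeW.
    have [[E1 E2 q12]|N] := pselect
      [/\ E (ratr q1, j), E (ratr q2, j) & ratr q1 < ratr q2 :> R]; last first.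
      apply: aeW => t E1 E2 /andP[t1 t2]; exfalso; apply: N; split => //.
      exact: lt_trans t2.
    have [s As [s1 s2]] := common E1 E2.
    have [_ _ + _] := Asol As => /(_ j).
    have si t := @slice_interior _ j _ _ t (Atree As) s1 s2.
    have sne : (slice s.1 j)° !=set0.
      by exists ((ratr q1 + ratr q2) / 2); apply: si; lra.
    move=> /(_ sne); apply: aeS => t Ht _ _ tq.
    have st := si _ tq.
    have [F1 F2 F3] := Ht (interior_subset st).
    have ex : {near t, s.2^~ j =1 x^~ j}.
      move: st; rewrite /interior /=; apply: filterS => u su.
      by rewrite (xE As).
    have xt : x t j = s.2 t j.
      by rewrite (xE As)//; exact: interior_subset st.
    have d2 : derivable (x^~ j) t 1 := near_eq_derivable ex F2.
    have e2 : derive1 (x^~ j) t = derive1 (s.2^~ j) t.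
      rewrite !derive1E; apply/esym/near_eq_derive; exact: ex.
    by rewrite xt e2; exact: And3 F1 d2 F3.
  have := aeI (ae_interior (slice E j)) (ae_foralln HQ).
  apply: aeS => t [It Qt] /It[a [b [Ea Eb /andP[at_ tb]]]].
  have [q1] := rat_in_itvoo at_; rewrite in_itv/= => /andP[aq1 q1t].
  have [q2] := rat_in_itvoo tb; rewrite in_itv/= => /andP[tq2 q2b].
  have := Qt (pickle (q1, q2)); rewrite /Q pickleK; apply.
  + apply: (slice_convex tE Ea Eb); lra.
  + apply: (slice_convex tE Ea Eb); lra.
  + by rewrite q1t.
- move=> t j Et Et'; have [s As [s1 s2]] := common Et Et'.
  rewrite !(xE As)//.
  by have [_ _ _] := Asol As; apply.
Qed.

End chain.

Lemma extends_refl s : extends s s. Proof. by split. Qed.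

Lemma extends_trans s1 s2 s3 : extends s1 s2 -> extends s2 s3 -> extends s1 s3.
Proof.
move=> [e1 f1] [e2 f2]; split; first exact: subset_trans e2.
by move=> t j sq; rewrite f2 ?f1//; exact: e1.
Qed.

Lemma maximal_extension E x : solution H E x -> exists E' x',
  [/\ maximal_solution H E' x', E `<=` E'
    & forall t j, E (t, j) -> x' t j = x t j].
Proof.
move=> sol.
pose T := {s : dat | solution H s.1 s.2}.
pose rl (s s' : T) := `[< extends (sval s) (sval s') >].
pose t0 : {s : T | extends (E, x) (sval s)} :=
  exist _ (exist _ (E, x) sol) (extends_refl (E, x)).
pose rl' (s s' : {s : T | extends (E, x) (sval s)}) := rl (sval s) (sval s').
have [|||[[[E' x'] sol'] ext'] smax] := @ZL_preorder _ t0 rl'.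
- by move=> s; apply/asboolP; exact: extends_refl.
- move=> s1 s2 s3 /asboolP e1 /asboolP e2; apply/asboolP.
  exact: extends_trans e1 e2.
- move=> A Atot.
  have [[s0 As0]|A0] := pselect (A !=set0); last first.
    by exists t0 => s As; exfalso; apply: A0; exists s.
  pose B := [set sval (sval s) | s in A].
  have B0 : B !=set0 by exists (sval (sval s0)), s0.
  have Bsol s : B s -> solution H s.1 s.2.
    by move=> [u _ <-]; exact: svalP (sval u).
  have Btot s s' : B s -> B s' -> extends s s' \/ extends s' s.
    by move=> [u Au <-] [u' Au' <-]; have [/asboolP|/asboolP] := Atot _ _ Au Au';
      [left|right].
  have solB := chain_solution B0 Bsol Btot.
  have extB s : B s -> _ := @chain_extends B Btot s.
  have extB0 := extends_trans (svalP s0) (extB _ (imageP _ As0)).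
  exists (exist _ (exist _ (_, _) solB) extB0) => s As.
  by apply/asboolP; apply: extB; exists s.
exists E', x'; split; [|exact: ext'.1|exact: ext'.2].
split => // E'' x'' sol'' EE'' xx''.
have e'' : extends (E', x') (E'', x'') by split.
have /asboolP[/= + _] := smax
  (exist _ (exist _ (E'', x'') sol'') (extends_trans ext' e'')) (asboolT e'').
by move=> ?; apply/seteqP.
Qed.

End MaximalExtension.

(** * Euclidean norm, ultralimits and set-valued maps *)

Section EuclideanNorm.
Context {R : realType}.

Lemma coord_le_norm p (x : 'rV[R]_p) i : `|x ord0 i| <= `|x|.
Proof.
rewrite [leRHS]/Num.Def.normr/= mx_normrE.
exact: le_trans (le_bigmax _ _ (ord0, i)).
Qed.

Lemma norm_le_coord p (x : 'rV[R]_p) (c : R) : 0 <= c ->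
  (forall i, `|x ord0 i| <= c) -> `|x| <= c.
Proof.
move=> c0 H; rewrite [leLHS]/Num.Def.normr/= mx_normrE.
by apply: bigmax_le => // -[i j] _; rewrite ord1.
Qed.

Lemma enorm_ge0 p (x : 'rV[R]_p) : 0 <= enorm x.
Proof. exact: sqrtr_ge0. Qed.

Lemma enorm_sqr p (x : 'rV[R]_p) : enorm x ^+ 2 = \sum_(i < p) x ord0 i ^+ 2.
Proof. by rewrite sqr_sqrtr// sumr_ge0// => i _; exact: sqr_ge0. Qed.

Lemma enormN p (x : 'rV[R]_p) : enorm (- x) = enorm x.
Proof.
by rewrite /enorm; congr Num.sqrt; apply: eq_bigr => i _; rewrite mxE sqrrN.
Qed.

Lemma norm_le_enorm p (x : 'rV[R]_p) : `|x| <= enorm x.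
Proof.
apply: norm_le_coord (enorm_ge0 x) _ => i.
rewrite -[leLHS]ger0_norm// -ler_sqr ?nnegrE// ?enorm_ge0// ?normr_ge0//.
rewrite ger0_norm// enorm_sqr real_normK ?num_real//.
by rewrite (bigD1 i)//= lerDl sumr_ge0// => j _; exact: sqr_ge0.
Qed.

Lemma enorm_le_norm p (x : 'rV[R]_p) : enorm x <= p%:R * `|x|.
Proof.
rewrite -ler_sqr ?nnegrE ?enorm_ge0 ?mulr_ge0//.
rewrite enorm_sqr exprMn.
apply: (@le_trans _ _ (\sum_(i < p) `|x| ^+ 2)).
  apply: ler_sum => i _; rewrite -[leLHS]real_normK ?num_real//.
  by rewrite ler_sqr ?nnegrE// coord_le_norm.
rewrite sumr_const card_ord -[leLHS]mulr_natl ler_wpM2r ?sqr_ge0//.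
by rewrite -natrX ler_nat; case: p {x} => // p; rewrite leq_pmulr.
Qed.

Lemma cauchy_schwarz p (x y : 'rV[R]_p) :
  \sum_(i < p) x ord0 i * y ord0 i <= enorm x * enorm y.
Proof.
set xy := (X in X <= _).
have [xy0|xy0] := leP xy 0.
  by apply: le_trans xy0 _; rewrite mulr_ge0 ?enorm_ge0.
rewrite -ler_sqr ?nnegrE ?mulr_ge0 ?enorm_ge0//; last exact: ltW.
rewrite exprMn !enorm_sqr.
set X := \sum_(i < p) x ord0 i ^+ 2; set Y := \sum_(i < p) y ord0 i ^+ 2.
have X0 : 0 <= X by apply: sumr_ge0 => i _; exact: sqr_ge0.
have : 0 <= \sum_(i < p) (X * y ord0 i - xy * x ord0 i) ^+ 2.
  by apply: sumr_ge0 => i _; exact: sqr_ge0.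
have -> : \sum_(i < p) (X * y ord0 i - xy * x ord0 i) ^+ 2 =
   X * (X * Y - xy ^+ 2).
  under eq_bigr => i _.
    have -> : (X * y ord0 i - xy * x ord0 i) ^+ 2 =
      X ^+ 2 * y ord0 i ^+ 2 - (2 * X * xy) * (x ord0 i * y ord0 i)
      + xy ^+ 2 * x ord0 i ^+ 2 by ring.
    over.
  rewrite big_split big_split/= sumrN -!mulr_sumr -/X -/Y -/xy.
  ring.
have [X00|Xp] := eqVneq X 0.
  move=> _; suff -> : xy = 0 by rewrite expr0n/= mulr_ge0// sumr_ge0// => i _; exact: sqr_ge0.
  have x0 i : x ord0 i = 0.
    apply/eqP; rewrite -sqrf_eq0.
    have /psumr_eq0P := X00 => /(_ (fun i _ => sqr_ge0 _)) /(_ i isT) ->.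
    by rewrite eqxx.
  by rewrite /xy big1// => i _; rewrite x0 mul0r.
by rewrite pmulr_rge0 ?subr_ge0// lt_def Xp.
Qed.

Lemma enormD p (x y : 'rV[R]_p) : enorm (x + y) <= enorm x + enorm y.
Proof.
rewrite -ler_sqr ?nnegrE ?addr_ge0 ?enorm_ge0//.
rewrite sqrrD !enorm_sqr.
have -> : \sum_(i < p) (x + y) ord0 i ^+ 2 = \sum_(i < p) x ord0 i ^+ 2 +
   (\sum_(i < p) x ord0 i * y ord0 i) *+ 2 + \sum_(i < p) y ord0 i ^+ 2.
  rewrite -sumrMnl -!big_split/=; apply: eq_bigr => i _.
  by rewrite mxE sqrrD.
by rewrite lerD2r lerD2l ler_wMn2r// cauchy_schwarz.
Qed.

Lemma enormB p (x y : 'rV[R]_p) : enorm x <= enorm y + enorm (x - y).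
Proof. by rewrite -{1}(subrK y x) addrC; exact: enormD. Qed.

Lemma dist_has_inf p (x : 'rV[R]_p) (A : set 'rV[R]_p) : A !=set0 ->
  has_inf [set enorm (x - a) | a in A].
Proof.
move=> [a Aa]; split; first by exists (enorm (x - a)), a.
by exists 0 => _ [b _ <-]; exact: enorm_ge0.
Qed.

Lemma dist_le p (x a : 'rV[R]_p) (A : set 'rV[R]_p) : A a ->
  dist x A <= enorm (x - a).
Proof.
move=> Aa; apply: ge_inf; last by exists a.
by exists 0 => _ [b _ <-]; exact: enorm_ge0.
Qed.

Lemma le_dist p (x : 'rV[R]_p) (A : set 'rV[R]_p) (c : R) : A !=set0 ->
  (forall a, A a -> c <= enorm (x - a)) -> c <= dist x A.
Proof.
move=> A0 H; apply: lb_le_inf; first by case: (dist_has_inf x A0).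
by move=> _ [a Aa <-]; exact: H.
Qed.

Lemma dist_ge0 p (x : 'rV[R]_p) (A : set 'rV[R]_p) : 0 <= dist x A.
Proof.
have [->|/set0P A0] := eqVneq A set0.
  by rewrite /dist image_set0 inf0.
by apply: le_dist => // a _; exact: enorm_ge0.
Qed.

Lemma dist_lip p (x y : 'rV[R]_p) (A : set 'rV[R]_p) : A !=set0 ->
  dist x A <= dist y A + enorm (x - y).
Proof.
move=> A0; rewrite -lerBlDr; apply: le_dist => // a Aa.
rewrite lerBlDr; apply: le_trans (dist_le _ Aa) _.
have -> : x - a = (y - a) + (x - y) by rewrite [RHS]addrC subrKA.
exact: enormD.
Qed.

End EuclideanNorm.

Section Ultra.

Lemma fmap_ultra (T V : Type) (f : T -> V) (F : set_system T) :
  UltraFilter F -> UltraFilter (f @ F).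
Proof.
move=> UF; split; first exact: fmap_proper_filter.
move=> G PG FG; apply/seteqP; split => // A GA.
have [//|FnA] := in_ultra_setVsetC (f @^-1` A) UF.
have /filter_ex [? []//] : G (A `&` ~` A) by apply: filterI => //; exact: FG.
Qed.

Lemma ultra_oo : exists2 U : set_system nat, UltraFilter U & \oo `<=` U.
Proof. by have [U [? ?]] := ultraFilterLemma eventually_filter; exists U. Qed.

Context {R : realType}.

(** Along one fixed ultrafilter all bounded sequences converge at once, so values at uncountably
    many times have limits without any extraction of subsequences. *)
Lemma ultra_cvg (T : Type) (F : set_system T) p (f : T -> 'rV[R]_p) (B : R) :
  UltraFilter F -> (\forall k \near F, `|f k| <= B) -> cvg (f @ F).
Proof.
move=> UF fB.
have cB : compact [set x : 'rV[R]_p | `|x| <= B].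
  apply: bounded_closed_compact.
    by exists B; split; [exact: num_real|move=> M BM x /= /le_trans -> //; exact: ltW].
  by apply: (@closed_comp _ _ _ [set x : R | x <= B]) => [x _|];
    [exact: norm_continuous|exact: closed_le].
have := cB; rewrite compact_ultra => /(_ _ (fmap_ultra f UF) fB)[l [_ fl]].
by apply/cvg_ex; exists l.
Qed.

Lemma ultra_cvgR (T : Type) (F : set_system T) (f : T -> R) (B : R) :
  UltraFilter F -> (\forall k \near F, `|f k| <= B) -> cvg (f @ F).
Proof.
move=> UF fB.
have : compact `[- B, B]%classic by exact: segment_compact.
rewrite compact_ultra => /(_ _ (fmap_ultra f UF)).
case.
  by near=> x; rewrite /= in_itv/= -ler_norml; near: x.
by move=> l [_ fl]; apply/cvg_ex; exists l.
Unshelve. all: by end_near. Qed.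

End Ultra.

(** * Outer semicontinuity and local boundedness along filters *)

Section SetValuedLimits.
Context {R : realType}.

Lemma cvg_near_dist (V : normedModType R) (T : Type) (F : set_system T)
  {FF : Filter F} (f : T -> V) l e : f @ F --> l -> 0 < e ->
  \forall k \near F, `|l - f k| < e.
Proof. by move=> /cvgrPdist_lt; apply. Qed.

Lemma continuous_at_dist (V W : normedModType R) (f : V -> W) x e :
  {for x, continuous f} -> 0 < e ->
  exists2 d, 0 < d & forall y, `|x - y| < d -> `|f x - f y| < e.
Proof.
move=> /cvgrPdist_lt /[apply] /nbhs_ballP[d /= d0 H]; exists d => // y yd.
by apply: H; rewrite -ball_normE.
Qed.

(** Outer semicontinuity is stated for sequences; one index picked from each event of closeness
    [1 / m.+1] reduces a filter limit to a sequence. *)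
Lemma osc_on_filter (V W : normedModType R) (M : V -> set W) (K : set V)
  (T : Type) (F : set_system T) (z : T -> V) (s : T -> W) z0 s0 :
  ProperFilter F -> osc_on M K ->
  (\forall k \near F, K (z k)) -> (\forall k \near F, M (z k) (s k)) ->
  z @ F --> z0 -> K z0 -> s @ F --> s0 -> M z0 s0.
Proof.
move=> PF oM Kz Ms zz0 Kz0 ss0.
have /choice[k Hk] : forall m : nat, exists k, [/\ K (z k), M (z k) (s k),
    `|z0 - z k| < m.+1%:R^-1 & `|s0 - s k| < m.+1%:R^-1].
  move=> m; have m0 : 0 < m.+1%:R^-1 :> R by rewrite invr_gt0 ltr0n.
  apply: (@filter_ex _ F); near=> k; split; near: k => //.
    exact: cvg_near_dist zz0 m0.
  exact: cvg_near_dist ss0 m0.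
have H (X : normedModType R) (x : T -> X) x0 :
    (forall m, `|x0 - x (k m)| < m.+1%:R^-1) -> (x \o k) @ \oo --> x0.
  move=> Hx; apply/cvgrPdist_lt => e e0; near=> m; apply: lt_trans (Hx m) _.
  by near: m; exact: near_infty_natSinv_lt (PosNum e0).
apply: (oM (z \o k) (s \o k)) => // [i|i||].
- by case: (Hk i).
- by case: (Hk i).
- by apply: H => m; case: (Hk m).
- by apply: H => m; case: (Hk m).
Unshelve. all: by end_near. Qed.

(** A sequence of counterexamples has bounded values near [z0], hence an ultralimit; it belongs to
    [M z0] by outer semicontinuity, although the values stay at distance more than [e] from that
    set. *)
Lemma osc_on_usc (V : normedModType R) p (M : V -> set 'rV[R]_p) (K : set V) z0 e :
  osc_on M K -> locally_bounded_on M K -> K z0 -> 0 < e ->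
  exists2 d, 0 < d & forall z v, K z -> `|z0 - z| < d -> M z v ->
    exists2 w, M z0 w & `|v - w| <= e.
Proof.
move=> oM bM Kz0 e0; apply: contrapT => H.
have /choice[zv Hzv] : forall m : nat, exists zv : V * 'rV[R]_p,
  [/\ K zv.1, `|z0 - zv.1| < m.+1%:R^-1, M zv.1 zv.2
    & forall w, M z0 w -> e < `|zv.2 - w| ].
  move=> m; apply: contrapT => Hm; apply: H; exists m.+1%:R^-1.
    by rewrite invr_gt0 ltr0n.
  move=> z v Kz zd Mv; apply: contrapT => Hw; apply: Hm; exists (z, v).
  split => // w Mw; rewrite ltNge; apply/negP => ?; apply: Hw; by exists w.
have [U UU ooU] := ultra_oo.
have zz0 : fst \o zv @ U --> z0.
  have : fst \o zv @ \oo --> z0.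
    apply/cvgrPdist_lt => d d0; near=> m.
    have [_ + _ _] := Hzv m => /lt_trans; apply.
    by near: m; exact: near_infty_natSinv_lt (PosNum d0).
  by move=> zz A /zz /ooU.
have [N Nz0 [B [_ HB]]] := bM _ Kz0.
have vB : \forall k \near U, `|(zv k).2| <= B + 1.
  have : \forall k \near U, N (zv k).1 by exact: zz0.
  apply: filterS => k Nk; have [Kk _ Mk _] := Hzv k.
  by apply: (HB (B + 1)); [rewrite ltrDl|exists (zv k).1].
have /cvg_ex[v vv] := ultra_cvg UU vB.
have Mv : M z0 v.
  apply: (osc_on_filter _ oM _ _ zz0 Kz0 vv).
    by apply: nearW => k; case: (Hzv k).
  by apply: nearW => k; case: (Hzv k).
have : \forall k \near U, `|v - (zv k).2| < e by exact: cvg_near_dist vv e0.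
move=> /filter_ex[k]; have [_ _ _ /(_ _ Mv)] := Hzv k.
by rewrite distrC; lra.
Unshelve. all: by end_near. Qed.

Lemma locally_bounded_compact (V : normedModType R) p (M : V -> set 'rV[R]_p)
  (K Q : set V) : locally_bounded_on M K -> compact Q -> Q `<=` K ->
  exists2 B, 0 <= B & forall z v, Q z -> M z v -> `|v| <= B.
Proof.
move=> bM cQ QK; apply: contrapT => H.
have /choice[zv Hzv] : forall m : nat, exists zv : V * 'rV[R]_p,
  [/\ Q zv.1, M zv.1 zv.2 & m%:R < `|zv.2| ].
  move=> m; apply: contrapT => Hm; apply: H; exists m%:R => //.
  move=> z v Kz Mv; rewrite leNgt; apply/negP => mv; apply: Hm.
  by exists (z, v).
have [U UU ooU] := ultra_oo.
move: cQ; rewrite compact_ultra => /(_ _ (fmap_ultra (fst \o zv) UU)).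
case; first by apply: nearW => k; case: (Hzv k).
move=> z0 [Qz0 zz0].
have [N Nz0 [B [_ HB]]] := bM _ (QK _ Qz0).
have : \forall k \near U, N (zv k).1 by exact: zz0.
have : \forall k \near U, B + 1 < k%:R.
  by apply: ooU; exact: nbhs_infty_gtr.
move=> h1 h2; have [k [k1 k2]] := @filter_ex _ U _ _ (@filterI _ U _ _ _ h1 h2).
have [Qk Mk kv] := Hzv k.
have : `|(zv k).2| <= B + 1.
  apply: (HB (B + 1)); first by rewrite ltrDl.
  by exists (zv k).1 => //; split => //; exact: QK.
by rewrite leNgt (lt_trans k1 kv).
Qed.

End SetValuedLimits.

Section LipschitzAC.
Context {R : realType}.

Definition lip_on (V : normedModType R) (L : R) (f : R -> V) (a b : R) :=
  forall s t, a <= s -> s <= t -> t <= b -> `|f t - f s| <= L * (t - s).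

Lemma lip_abs_continuous p (L : R) (f : R -> 'rV[R]_p) a b : lip_on L f a b ->
  abs_continuous f a b.
Proof.
move=> fL e e0.
have K0 : 0 < p%:R * `|L| + 1 by rewrite ltr_wpDl// mulr_ge0.
exists (e / (p%:R * `|L| + 1)); first by rewrite divr_gt0.
move=> N s t Hst _; rewrite ltr_pdivlMr//; apply: le_lt_trans.
rewrite mulr_suml; apply: ler_sum => k _; have [sa [sk tb]] := Hst k.
apply: le_trans (enorm_le_norm _) _.
apply: (@le_trans _ _ (p%:R * (`|L| * (t k - s k)))).
  rewrite ler_wpM2l//; apply: le_trans (fL _ _ sa sk tb) _.
  by rewrite ler_wpM2r ?subr_ge0// ler_norm.
rewrite mulrA mulrC ler_wpM2l ?subr_ge0// lerDl//.
Qed.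

End LipschitzAC.

(** * Nominal arcs with perturbed gradient input, and their ultralimits *)

Section NearArcs.
Context {R : realType} (n r : nat).
Notation mu := (@lebesgue_measure R).
Variables (J : 'rV[R]_n -> R) (C D : set 'rV[R]_(n + r)).
Variables (F : R -> 'rV[R]_(n + r) -> 'rV[R]_n -> set 'rV[R]_(n + r)).
Variables (G : R -> 'rV[R]_(n + r) -> set 'rV[R]_(n + r)) (delta : R).
Hypothesis gJ : continuous (grad J).
Hypotheses (cC : closed C) (cD : closed D).
Let K := C `*` [set: 'rV[R]_n].
Let M (z : 'rV[R]_(n + r) * 'rV[R]_n) := F delta z.1 z.2.
Hypotheses (oM : osc_on M K) (bM : locally_bounded_on M K)
  (neM : nonempty_valued_on M K) (cM : convex_valued_on M K).
Hypothesis oG : osc_on (G delta) D.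

(** Arcs of the nominal system in which [grad J] is replaced by an input [xi]
    that is [eta]-close to it outside a layer of length [eta] at the start of
    each flow interval. *)
Definition near_arc (rho L eta : R) (N : nat) (tau : nat -> R)
    (x : nat -> R -> 'rV[R]_(n + r)) (xi : nat -> R -> 'rV[R]_n) :=
  [/\ tau 0%N = 0, forall j, (j <= N)%N -> tau j <= tau j.+1,
      (C `|` D) (x 0%N 0),
      forall j, (j < N)%N -> D (x j (tau j.+1)) /\
        G delta (x j (tau j.+1)) (x j.+1 (tau j.+1))
    & forall j, (j <= N)%N ->
      [/\ forall t, tau j <= t <= tau j.+1 -> `|x j t| <= rho,
          lip_on L (x j) (tau j) (tau j.+1),
          forall t, tau j < t < tau j.+1 -> C (x j t),
          forall t, tau j + eta < t < tau j.+1 ->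
            `|xi j t - grad J (lsubmx (x j t))| <= eta
        & {ae mu, forall t, tau j < t < tau j.+1 ->
            derivable (x j) t 1 /\ F delta (x j t) (xi j t) (derive1 (x j) t)}]].

Lemma M_closed z v : K z ->
  (forall e, 0 < e -> exists2 w, M z w & `|v - w| <= e) -> M z v.
Proof.
move=> Kz H.
have /choice[w Hw] : forall m : nat, exists w, M z w /\ `|v - w| <= m.+1%:R^-1.
  move=> m; have [|w ? ?] := H m.+1%:R^-1; first by rewrite invr_gt0 ltr0n.
  by exists w.
apply: (oM (z := fun=> z) (s := w)) => // [i||].
- by case: (Hw i).
- exact: cvg_cst.
- apply/cvgrPdist_lt => e e0; near=> m; apply: le_lt_trans (Hw m).2 _.
  by near: m; exact: near_infty_natSinv_lt (PosNum e0).
Unshelve. all: by end_near. Qed.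

Section limit.
Variables (rho L T : R) (N : nat).
Hypothesis L0 : 0 <= L.
Variables (tau : nat -> nat -> R) (x : nat -> nat -> R -> 'rV[R]_(n + r)).
Variables (xi : nat -> nat -> R -> 'rV[R]_n).
Hypothesis arcs : forall k,
  near_arc rho L k.+1%:R^-1 N (tau k) (x k) (xi k).
Hypothesis tauT : forall k, tau k N.+1 <= T.
Variable U : set_system nat.
Hypotheses (UU : UltraFilter U) (ooU : \oo `<=` U).

Let near_dist (V : normedModType R) (f : nat -> V) l e : f @ U --> l -> 0 < e ->
  \forall k \near U, `|l - f k| < e.
Proof. exact: cvg_near_dist. Qed.

Let tau_mono k a b : (a <= b)%N -> (b <= N.+1)%N -> tau k a <= tau k b.
Proof. by have [_ H _ _ _] := arcs k; exact: tau_le H a b. Qed.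

Let tau_itv k j : (j <= N.+1)%N -> 0 <= tau k j <= T.
Proof.
move=> jN; have [t0 _ _ _ _] := arcs k.
by rewrite -t0 tau_mono//= (le_trans _ (tauT k))// tau_mono.
Qed.

Definition ltau j := lim (tau k j @[k --> U]).
(** The flow intervals move with [k]. Clamping the time gives functions on the whole line with a
    common Lipschitz constant, so [lx j] is defined and Lipschitz everywhere. *)
Definition lx j t := lim (x k j (clamp (tau k j) (tau k j.+1) t) @[k --> U]).

Lemma ltau_cvg j : (j <= N.+1)%N -> tau k j @[k --> U] --> ltau j.
Proof.
move=> jN; apply: (@ultra_cvgR R _ U _ T UU); apply: nearW => k.
by have /andP[? ?] := tau_itv k jN; rewrite ger0_norm.
Qed.

Lemma tauS k j : (j <= N)%N -> tau k j <= tau k j.+1.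
Proof. by move=> jN; apply: tau_mono. Qed.

Lemma lx_cvg j (t : R) : (j <= N)%N ->
  x k j (clamp (tau k j) (tau k j.+1) t) @[k --> U] --> lx j t.
Proof.
move=> jN; apply: (@ultra_cvg R _ U _ _ rho UU); apply: nearW => k.
have [_ _ _ _ /(_ j jN)[H _ _ _ _]] := arcs k.
exact/H/clamp_itv/tauS.
Qed.

Lemma clamp_dist (a b s t : R) : a <= b ->
  `|clamp a b t - clamp a b s| <= `|t - s|.
Proof.
move=> ab; wlog st : s t / s <= t.
  by move=> H; have [|/ltW] := leP s t => /H//; rewrite distrC (distrC t).
rewrite !ger0_norm ?subr_ge0//; first exact: clamp_lip.
exact: clamp_le.
Qed.

Lemma lip_on_dist (V : normedModType R) (f : R -> V) a b s t : lip_on L f a b ->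
  a <= s <= b -> a <= t <= b -> `|f t - f s| <= L * `|t - s|.
Proof.
move=> Hf /andP[? ?] /andP[? ?]; have [st|ts] := leP s t.
  by rewrite (ger0_norm (_ : 0 <= t - s)) ?subr_ge0//; exact: Hf.
rewrite distrC (distrC t) (ger0_norm (_ : 0 <= s - t)) ?subr_ge0; last exact: ltW.
  by apply: Hf => //; exact: ltW.
Qed.

Lemma x_dist k j s t : (j <= N)%N -> tau k j <= s <= tau k j.+1 ->
  tau k j <= t <= tau k j.+1 -> `|x k j t - x k j s| <= L * `|t - s|.
Proof.
move=> jN; have [_ _ _ _ /(_ j jN)[_ H _ _ _]] := arcs k.
exact: lip_on_dist.
Qed.

(** The common constant [L] makes the limit insensitive to evaluation times that themselves
    converge, in particular the jump times of the approximating arcs. *)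
Lemma lx_cvg_moving j (s : nat -> R) t : (j <= N)%N ->
  (\forall k \near U, tau k j <= s k <= tau k j.+1) -> s @ U --> t ->
  x k j (s k) @[k --> U] --> lx j t.
Proof.
move=> jN sI st; apply/cvgrPdist_lt => e e0.
have L1 : 0 < 2 * (L + 1) by rewrite mulr_gt0// ltr_wpDl.
have d0 : 0 < e / (2 * (L + 1)) by rewrite divr_gt0.
have e2 : 0 < e / 2 by lra.
have H2 := near_dist st d0; have H1 := near_dist (@lx_cvg _ t jN) e2.
near=> k.
have H1' : `|lx j t - x k j (clamp (tau k j) (tau k j.+1) t)| < e / 2 by near: k.
have H2' : `|t - s k| < e / (2 * (L + 1)) by near: k.
have sk : tau k j <= s k <= tau k j.+1 by near: k.
have H3 := x_dist jN sk (clamp_itv t (tauS k jN)).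
have H4 := clamp_dist (s k) t (tauS k jN).
rewrite (clamp_id sk) in H4.
rewrite -(subrKA (x k j (clamp (tau k j) (tau k j.+1) t))).
apply: le_lt_trans (ler_normD _ _) _.
have H5 : L * `|clamp (tau k j) (tau k j.+1) t - s k| <= L * `|t - s k|.
  exact: ler_wpM2l.
have H6 : L * `|t - s k| <= e / 2.
  rewrite ltr_pdivlMr// in H2'.
  have : 0 <= `|t - s k| by [].
  lra.
lra.
Unshelve. all: by end_near. Qed.

Lemma lx_lip j (s t : R) : (j <= N)%N -> `|lx j t - lx j s| <= L * `|t - s|.
Proof.
move=> jN; apply/ler_addgt0Pl => e e0.
have e2 : 0 < e / 2 by lra.
have [k [H1 H2]] := @filter_ex _ U _ _ (@filterI _ U _ _ _
  (near_dist (@lx_cvg _ t jN) e2) (near_dist (@lx_cvg _ s jN) e2)).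
have H3 := x_dist jN (clamp_itv s (tauS k jN)) (clamp_itv t (tauS k jN)).
have H4 : L * `|clamp (tau k j) (tau k j.+1) t - clamp (tau k j) (tau k j.+1) s|
  <= L * `|t - s| by apply: ler_wpM2l => //; apply: clamp_dist; exact: tauS.
set u := x k j _ in H1 H3; set v := x k j _ in H2 H3.
have -> : lx j t - lx j s = (lx j t - u) + (u - v) + (v - lx j s).
  by rewrite !subrKA.
apply: le_trans (ler_normD _ _) _.
have := ler_normD (lx j t - u) (u - v).
rewrite (distrC v); lra.
Qed.

Lemma ltau0 : ltau 0 = 0.
Proof.
have := @ltau_cvg 0%N isT; rewrite (_ : (fun k => tau k 0%N) = cst 0).
  by move=> H; apply: (@cvg_unique _ _ (cst (0:R) @ U)) => //; exact: cvg_cst.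
by apply/funext => k; have [] := arcs k.
Qed.

Lemma ltauS j : (j <= N)%N -> ltau j <= ltau j.+1.
Proof.
move=> jN; apply: (ler_cvg_to (ltau_cvg (leqW jN)) (ltau_cvg (jN : j < N.+1)%N)).
by apply: nearW => k; exact: tauS.
Qed.

Lemma lx_start : (C `|` D) (lx 0 0).
Proof.
have cCD : closed (C `|` D) by exact: closedU.
have := @lx_cvg 0%N 0 isT; apply: closed_cvg => //; apply: nearW => k.
have [t0 _ CD0 _ _] := arcs k; rewrite clamp_id//.
by rewrite t0 lexx -t0 tauS.
Qed.

Lemma lx_end_cvg j : (j <= N)%N ->
  x k j (tau k j.+1) @[k --> U] --> lx j (ltau j.+1).
Proof.
move=> jN; apply: lx_cvg_moving => //; last exact: ltau_cvg.
by apply: nearW => k; rewrite lexx tauS.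
Qed.

Lemma lx_begin_cvg j : (j <= N)%N ->
  x k j (tau k j) @[k --> U] --> lx j (ltau j).
Proof.
move=> jN; apply: lx_cvg_moving => //; last exact/ltau_cvg/leqW.
by apply: nearW => k; rewrite lexx tauS.
Qed.

Lemma lx_jump j : (j < N)%N -> D (lx j (ltau j.+1)) /\
  G delta (lx j (ltau j.+1)) (lx j.+1 (ltau j.+1)).
Proof.
move=> jN; have c1 := lx_end_cvg (ltnW jN); have c2 := lx_begin_cvg jN.
have Dx : D (lx j (ltau j.+1)).
  move: (c1); apply: closed_cvg => //; apply: nearW => k.
  by have [_ _ _ /(_ j jN)[]] := arcs k.
split => //; apply: (osc_on_filter _ oG _ _ c1 Dx c2); apply: nearW => k;
  by have [_ _ _ /(_ j jN)[]] := arcs k.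
Qed.

(** The margin before [t] lets the vanishing initial layer end in time; the margin after [t] leaves
    room for a difference quotient. *)
Lemma near_open_itv j (t : R) : (j <= N)%N -> ltau j < t < ltau j.+1 ->
  exists2 d, 0 < d & \forall k \near U, tau k j + d < t - d /\ t + d < tau k j.+1.
Proof.
move=> jN /andP[jt tj].
pose d := Num.min (t - ltau j) (ltau j.+1 - t) / 4.
have d0 : 0 < d by rewrite divr_gt0// lt_min !subr_gt0 jt tj.
have d1 : 4 * d <= t - ltau j by rewrite /d mulrC divfK// ge_min lexx.
have d2 : 4 * d <= ltau j.+1 - t by rewrite /d mulrC divfK// ge_min lexx orbT.
exists d => //; near=> k.
have : `|ltau j - tau k j| < d.
  by near: k; apply: near_dist d0; exact/ltau_cvg/leqW.
have : `|ltau j.+1 - tau k j.+1| < d.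
  by near: k; apply: near_dist d0; exact/ltau_cvg.
rewrite !ltr_norml => /andP[? ?] /andP[? ?]; split; lra.
Unshelve. all: by end_near. Qed.

Lemma lx_flow_set j (t : R) : (j <= N)%N -> ltau j < t < ltau j.+1 -> C (lx j t).
Proof.
move=> jN tI; have [d d0 Hd] := near_open_itv jN tI.
have c : x k j t @[k --> U] --> lx j t.
  apply: lx_cvg_moving => //; last exact: cvg_cst.
  by apply: filterS Hd => k [? ?]; lra.
move: c; apply: closed_cvg => //; apply: filterS Hd => k [? ?].
have [_ _ _ _ /(_ j jN)[_ _ + _ _]] := arcs k; apply; lra.
Qed.

(** Closure theorem for differential inclusions: on a short interval after [t] the derivatives of
    [x k j] lie in a neighbourhood of the convex set [M z0], so their mean does too, and that mean
    approximates the derivative of the limit. *)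
Lemma lx_flow_map j (t : R) : (j <= N)%N -> ltau j < t < ltau j.+1 ->
  derivable (lx j) t 1 ->
  F delta (lx j t) (grad J (lsubmx (lx j t))) (derive1 (lx j) t).
Proof.
move=> jN tI dx.
pose z0 := (lx j t, grad J (lsubmx (lx j t))).
have Kz0 : K z0 by split => //; exact: lx_flow_set.
apply: (@M_closed z0) => // e e0.
have e4 : 0 < e / 4 by lra.
have [d d0 Hd] := osc_on_usc oM bM Kz0 e4.
have gc : {for lx j t, continuous (grad J \o lsubmx)}.
  apply: continuous_comp; last exact: gJ.
  exact/differentiable_continuous/differentiable_lsubmx.
have d2 : 0 < d / 2 by lra.
have [d1 d10 Hd1] := continuous_at_dist gc d2.
have [d3 d30 Hd3] := near_open_itv jN tI.
have [d4 d40 Hd4] := derivable_expand dx e4.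
have [m [m0 md md1]] : exists m, [/\ 0 < m, m <= d & m <= d1].
  by exists (Num.min d d1); rewrite lt_min d0 d10 !ge_min !lexx orbT.
have [h [h0 h1 h2 h4]] : exists h,
    [/\ 0 < h, h <= d3 / 2, h <= d4 / 2 & L * h <= m / 4].
  have L1 : 0 < 4 * (L + 1) by rewrite mulr_gt0// ltr_wpDl.
  pose h := Num.min (Num.min (d3 / 2) (d4 / 2)) (m / (4 * (L + 1))).
  have h0 : 0 < h by rewrite !lt_min !divr_gt0.
  exists h; split => //; first by rewrite !ge_min lexx.
    by rewrite !ge_min lexx !orbT.
  have : h * (4 * (L + 1)) <= m by rewrite -ler_pdivlMr// !ge_min lexx !orbT.
  lra.
have ed : 0 < m / 4 by lra.
have ct : x k j t @[k --> U] --> lx j t.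
  apply: lx_cvg_moving => //; last exact: cvg_cst.
  by apply: filterS Hd3 => k [? ?]; lra.
have cth : x k j (t + h) @[k --> U] --> lx j (t + h).
  apply: lx_cvg_moving => //; last exact: cvg_cst.
  by apply: filterS Hd3 => k [? ?]; lra.
(* The step [h] is fixed before [k], so the convergence errors at both ends can be made small
   relative to [h]. In units of [e * h] the total is [1/4] for the expansion of [lx j], [2/8] for
   the ends, [1/8] for the mean value and [1/4] for the neighbourhood. *)
have eh : 0 < e / 8 * h by rewrite mulr_gt0//; lra.
have : \forall k \near U, k.+1%:R^-1 < Num.min d3 (d / 2) :> R.
  have d5 : 0 < Num.min d3 (d / 2) by rewrite lt_min d30.
  by apply: ooU; exact: near_infty_natSinv_lt (PosNum d5).
move=> Hk; have [k [[kd [k1 k2]] [xt [xt' xth]]]] := @filter_ex _ U _ _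
  (@filterI _ U _ _ _ (@filterI _ U _ _ _ Hk Hd3)
  (@filterI _ U _ _ _ (near_dist ct ed)
  (@filterI _ U _ _ _ (near_dist ct eh) (near_dist cth eh)))).
move: kd; rewrite lt_min => /andP[].
set c : R := k.+1%:R^-1 => kd3 kd.
have [_ _ _ _ /(_ j jN)[_ xL xC]] := arcs k.
rewrite -/c => xg xF.
have lipI : lip_on L (x k j) t (t + h).
  move=> s1 s2 s1t s12 s2t; apply: xL => //; lra.
pose S := [set v | exists2 w, M z0 w & `|v - w| <= e / 4].
have [w0 Mw0] := neM Kz0.
have Sw0 : S w0 by exists w0 => //; rewrite subrr normr0 ltW.
have cS u v q : S u -> S v -> 0 <= q <= 1 -> S (q *: u + (1 - q) *: v).
  move=> [u' Mu' uu'] [v' Mv' vv'] /andP[q0 q1].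
  exists (q *: u' + (1 - q) *: v').
    have := cM Kz0 (Itv01 q0 q1) (mem_set Mu') (mem_set Mv').
    by rewrite inE.
  rewrite opprD addrACA -!scalerBr; apply: le_trans (ler_normD _ _) _.
  rewrite !normrZ ger0_norm// ger0_norm ?subr_ge0//.
  have : q * `|u - u'| <= q * (e / 4) by rewrite ler_wpM2l.
  have : (1 - q) * `|v - v'| <= (1 - q) * (e / 4) by rewrite ler_wpM2l// subr_ge0.
  lra.
have aeS' : {ae mu, forall s, t < s < t + h ->
    derivable (x k j) s 1 /\ S (derive1 (x k j) s)}.
  apply: aeS xF => s Hs /andP[ts sth].
  have [|ds Fs] := Hs; first lra.
  split => //.
  have xs : `|x k j s - lx j t| < m / 2.
    have -> : x k j s - lx j t = (x k j s - x k j t) + (x k j t - lx j t).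
      by rewrite subrKA.
    apply: le_lt_trans (ler_normD _ _) _.
    have H1 : `|x k j s - x k j t| <= L * (s - t).
      by apply: xL; lra.
    have H2 : L * (s - t) <= L * h by apply: ler_wpM2l => //; lra.
    rewrite distrC in xt; lra.
  apply: (Hd (x k j s, xi k j s)) => //.
    by split => //=; apply: xC; lra.
  apply: (@le_lt_trans _ _ (Num.max `|lx j t - x k j s|
     `|grad J (lsubmx (lx j t)) - xi k j s|)); first by [].
  rewrite gt_max; apply/andP; split; first by rewrite distrC; lra.
  have H1 : `|xi k j s - grad J (lsubmx (x k j s))| <= c.
    by apply: xg; lra.
  have H2 : `|grad J (lsubmx (lx j t)) - grad J (lsubmx (x k j s))| < d / 2.
    by apply: Hd1; rewrite distrC; lra.
  rewrite -(subrKA (grad J (lsubmx (x k j s)))).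
  apply: le_lt_trans (ler_normD _ _) _; rewrite (distrC _ (xi k j s)); lra.
have tth : t < t + h by lra.
have [w [w' Mw' ww'] Hw] := mean_value_convex tth (lip_ac lipI) aeS' Sw0 cS eh.
exists w' => //.
have th : t + h - t = h by lra.
have H1 : `|lx j (t + h) - lx j t - h *: derive1 (lx j) t| <= e / 4 * h.
  have := Hd4 (t + h); rewrite th gtr0_norm//; apply; lra.
rewrite th in Hw.
set D0 := derive1 _ _ in H1 *.
have E0 : h *: (D0 - w') = - (lx j (t + h) - lx j t - h *: D0)
   + ((lx j (t + h) - x k j (t + h)) + (x k j t - lx j t))
   + (x k j (t + h) - x k j t - h *: w) + h *: (w - w').
  by apply/rowP => i; rewrite !mxE; ring.
rewrite -(ler_pM2l h0) -{1}(gtr0_norm h0) -normrZ E0.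
apply: le_trans (ler_normD _ _) _.
have := ler_normD (- (lx j (t + h) - lx j t - h *: D0)
   + ((lx j (t + h) - x k j (t + h)) + (x k j t - lx j t)))
   (x k j (t + h) - x k j t - h *: w).
have := ler_normD (- (lx j (t + h) - lx j t - h *: D0))
   ((lx j (t + h) - x k j (t + h)) + (x k j t - lx j t)).
have := ler_normD (lx j (t + h) - x k j (t + h)) (x k j t - lx j t).
rewrite normrN normrZ (gtr0_norm h0).
have : h * `|w - w'| <= h * (e / 4) by rewrite ler_wpM2l// ltW.
rewrite (distrC (x k j t)).
lra.
Qed.

Definition ltdom : set (R * nat) :=
  [set s | (s.2 < N.+1)%N /\ ltau s.2 <= s.1 <= ltau s.2.+1].

Lemma limit_solution :
  solution (nominal_system J C D F G delta) ltdom (fun t j => lx j t).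
Proof.
have cdom : compact_hybrid_time_domain ltdom.
  exists N.+1, ltau; split => //; first exact: ltau0.
  by move=> j jN; exact: ltauS.
split.
- split.
    exists (fun=> ltdom); split; [by []|by move=> i s|].
    by apply/seteqP; split=> [s Hs|s [_ _]//]; exists 0%N.

  move=> j [t /interior_subset[/= jN _]] a b ab _.
  by apply: (@lip_abs_continuous _ _ L) => // s u _ su _; rewrite -[u - s]ger0_norm ?subr_ge0//; exact: lx_lip.
- exact: lx_start.
- move=> j [t /interior_subset[/= jN _]].
  have dx : {ae mu, forall t, derivable (lx j) t 1}.
    by apply: (@lipschitz_ae_derivable_rV _ _ _ L) => s u; exact: lx_lip.
  apply: aeS (aeI (aeI (ae_neq (ltau j)) (ae_neq (ltau j.+1))) dx).
  move=> s [[/eqP sj /eqP sj'] ds] [_ /= /andP[js sj2]].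
  have sI : ltau j < s < ltau j.+1.
    by rewrite !lt_neqAle js sj2 sj' eq_sym sj.
  split => //; first exact: lx_flow_set.
  exact: lx_flow_map.
- move=> t j [/= jN /andP[tj1 tj2]] [/= jN' /andP[tj3 tj4]].
  have -> : t = ltau j.+1 by apply/le_anti; rewrite tj2 tj3.
  exact: lx_jump.
Qed.

End limit.

Section bound.
Variables (A : set 'rV[R]_(n + r)) (beta : R -> R -> R) (Delta nu : R).
Hypotheses (A0 : A !=set0) (beta_KL : class_KL beta) (nu0 : 0 < nu).
Hypothesis nominal : forall E x,
  maximal_solution (nominal_system J C D F G delta) E x ->
  enorm (x 0 0%N) <= Delta -> forall t j, E (t, j) ->
  dist (x t j) A <= beta (dist (x 0 0%N) A) (t + j%:R) + nu.

(** Passing to the limit perturbs the initial distance and the hybrid time, and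
    [beta] need not be continuous; the factor [2] and the unit delay absorb
    this. *)
Definition slack_KL (b : R -> R -> R) (q s : R) := b (2 * q) (Num.max (s - 1) 0).

(** [class_KL] prescribes only a limit at [0] from the right; monotonicity in the first argument
    transfers it to the value at [0]. *)
Lemma KL0 s : 0 <= s -> beta 0 s = 0.
Proof.
case: beta_KL => b0 bnd _ bcv _ s0; apply/le_anti; rewrite b0// andbT.
apply/ler_addgt0Pl => e e0; rewrite addr0.
have := bcv s s0 => /cvgrPdist_lt /(_ e e0)[d /= d0 H].
have d20 : 0 < d / 2 by rewrite divr_gt0.
have := H (d / 2); rewrite /ball_/= !sub0r !normrN => /(_ _ d20).
rewrite !ger0_norm ?(ltW d20)//; last by apply: b0 => //; exact: ltW.
move=> /(_ ltac:(lra)) /ltW; apply: le_trans.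
by apply: bnd => //; exact: ltW.
Qed.

Lemma near_arc_bound (rho L T : R) (N : nat) : 0 <= L -> exists2 eta, 0 < eta &
  forall tau x xi, near_arc rho L eta N tau x xi -> tau N.+1 <= T ->
    enorm (x 0%N 0) <= Delta ->
    dist (x N (tau N.+1)) A <=
      slack_KL beta (dist (x 0%N 0) A) (tau N.+1 + N%:R) + 2 * nu.
Proof.
move=> L0; apply: contrapT => H.
pose arc := ((nat -> R) * (nat -> R -> 'rV[R]_(n + r)) * (nat -> R -> 'rV[R]_n))%type.
have /choice[a Ha] : forall k : nat, exists a : arc,
    [/\ near_arc rho L k.+1%:R^-1 N a.1.1 a.1.2 a.2, a.1.1 N.+1 <= T,
        enorm (a.1.2 0%N 0) <= Delta &
     slack_KL beta (dist (a.1.2 0%N 0) A) (a.1.1 N.+1 + N%:R) + 2 * nu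
       < dist (a.1.2 N (a.1.1 N.+1)) A].
  move=> k; apply: contrapT => Hk; apply: H; exists k.+1%:R^-1.
    by rewrite invr_gt0 ltr0n.
  move=> tau x xi Hx HT HD; rewrite leNgt; apply/negP => Hlt.
  by apply: Hk; exists (tau, x, xi).
have [U UU ooU] := ultra_oo.
pose tau k := (a k).1.1; pose x k := (a k).1.2; pose xi k := (a k).2.
have arcs k : near_arc rho L k.+1%:R^-1 N (tau k) (x k) (xi k) by case: (Ha k).
have tauT k : tau k N.+1 <= T by case: (Ha k).
pose y := lx tau x U; pose T' := ltau tau U N.+1.
have sol := limit_solution L0 arcs tauT UU ooU.
have [E' [y' [maxy' EE' yy']]] := maximal_extension sol.
have endE : ltdom N tau U (T', N).
  split => //=; rewrite lexx andbT; exact: (ltauS arcs tauT UU (leqnn N)).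
have t0 k : tau k 0%N = 0 by case: (arcs k).
have startE : ltdom N tau U (0, 0%N).
  have l0 := ltau0 arcs tauT UU.
  split => //=; rewrite -{2}l0 l0 lexx -{1}l0.
  exact: (ltauS arcs tauT UU (leq0n N)).
have c0 : x k 0%N 0 @[k --> U] --> y 0%N 0.
  have := lx_begin_cvg L0 arcs tauT UU (leq0n N).
  rewrite (ltau0 arcs tauT UU) (_ : (fun k => x k 0%N (tau k 0%N)) = (fun k => x k 0%N 0))//.
  by apply/funext => k; rewrite t0.
have c1 := lx_end_cvg L0 arcs tauT UU (leqnn N).
have cT := ltau_cvg arcs tauT UU (leqnn N.+1).
have p0 : 0 < (n + r).+1%:R :> R by rewrite ltr0n.
have near_enorm (u : nat -> 'rV[R]_(n + r)) (l : 'rV[R]_(n + r)) e : u @ U --> l -> 0 < e ->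
    \forall k \near U, enorm (l - u k) < e.
  move=> ul e0; have d0 : 0 < e / (n + r).+1%:R by rewrite divr_gt0.
  apply: filterS (cvg_near_dist ul d0) => k.
  rewrite ltr_pdivlMr// => Hk; apply: le_lt_trans (enorm_le_norm _) _.
  apply: le_lt_trans Hk; rewrite mulrC ler_wpM2l// ler_nat//.
have T'0 : 0 <= T'.
  rewrite -(ltau0 arcs tauT UU).
  exact: (tau_le (fun i => ltauS arcs tauT UU (j := i))).
have y0D : enorm (y 0%N 0) <= Delta.
  apply/ler_addgt0Pl => e e0.
  have [k Hk] := filter_ex (near_enorm _ _ _ c0 e0).
  have := enormB (y 0%N 0) (x k 0%N 0).
  have [_ _ + _] := Ha k; rewrite -/(x k); lra.
have bnd : dist (y N T') A <= beta (dist (y 0%N 0) A) (T' + N%:R) + nu.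
  have := nominal maxy' _ (EE' _ endE).
  rewrite !yy'//; exact.
set q := dist (y 0%N 0) A in bnd.
have q0 : 0 <= q by exact: dist_ge0.
have n2 : 0 < nu / 2 by rewrite divr_gt0.
have H1 := near_enorm _ _ _ c1 n2.
have H2 : \forall k \near U, `|T' - tau k N.+1| < 1.
  by apply: cvg_near_dist cT _.
have H3 : \forall k \near U, beta q (T' + N%:R) <=
    slack_KL beta (dist (x k 0%N 0) A) (tau k N.+1 + N%:R).
  have [b0 bnd1 bnd2 _ _] := beta_KL.
  have m0 k : 0 <= Num.max (tau k N.+1 + N%:R - 1) 0 by rewrite le_max lexx orbT.
  (* For [q = 0] the left side vanishes. For [q > 0] the initial distances eventually exceed
     [q / 2], so doubling them dominates [q], and the end times eventually differ from [T'] by less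
     than the unit delay. *)
  have [q00|qn0] := eqVneq q 0.
    apply: nearW => k; rewrite q00 KL0 ?addr_ge0//.
    by apply: b0 => //; rewrite mulr_ge0// dist_ge0.
  have qp : 0 < q / 2 by rewrite divr_gt0// lt_def qn0.
  apply: filterS2 H2 (near_enorm _ _ _ c0 qp) => k Tk xk.
  apply: (@le_trans _ _ (beta (2 * dist (x k 0%N 0) A) (T' + N%:R))).
    apply: bnd1 => //; last by rewrite addr_ge0.
    have := dist_lip (y 0%N 0) (x k 0%N 0) A0; rewrite -/q; lra.
  apply: bnd2 => //; first by rewrite mulr_ge0// dist_ge0.
  rewrite ge_max addr_ge0// andbT; move: Tk; rewrite ltr_norml; lra.
have [k [k1 k3]] := filter_ex (filterI H1 H3).
have [_ _ _] := Ha k; rewrite -/(x k) -/(tau k).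
have := dist_lip (x k N (tau k N.+1)) (y N T') A0.
rewrite -enormN opprB; lra.
Qed.

End bound.
End NearArcs.

(** * The gradient estimator *)

Section SmoothCost.
Context {R : realType} (n : nat).

Lemma derive_coord (f : 'rV[R]_n -> R) (u v : 'rV[R]_n) : differentiable f u ->
  'D_v f u = \sum_(i < n) v ord0 i * 'D_(delta_mx ord0 i) f u.
Proof.
move=> df; rewrite deriveE// {1}(row_sum_delta v) linear_sum/=.
by apply: eq_bigr => i _; rewrite linearZ deriveE.
Qed.

Lemma mean_value_rV (f : 'rV[R]_n -> R) (u h : 'rV[R]_n) :
  (forall x, differentiable f x) ->
  exists c, 0 <= c <= 1 /\
   f (u + h) - f u = \sum_(i < n) h ord0 i * 'D_(delta_mx ord0 i) f (u + c *: h).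
Proof.
move=> df.
pose g (s : R) := f (u + s *: h).
have dg (s : R) : is_derive s (1 : R) g ('D_h f (u + s *: h)).
  have E : (fun k : R => k^-1 *: ((g \o shift s) (k *: (1 : R)) - g s)) =
     (fun k => k^-1 *: ((f \o shift (u + s *: h)) (k *: h) - f (u + s *: h))).
    apply/funext => k; rewrite /g /= /shift/= [k *: 1]mulr1 scalerDl.
    by rewrite addrCA.
  have dfh : derivable f (u + s *: h) h by exact/diff_derivable.
  split; first by rewrite /derivable E.
  by rewrite /derive E.
have cg : {within `[0, 1], continuous g}.
  apply: continuous_subspaceT => s.
  by apply: differentiable_continuous; apply/derivable1_diffP; case: (dg s).
have [c c01 Hc] := @MVT_segment R g _ 0 1 ler01 (fun x _ => dg x) cg.
exists c; split; first by move: c01; rewrite in_itv.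
move: Hc; rewrite /g scale1r scale0r addr0 subr0 mulr1 => ->.
exact: derive_coord.
Qed.

Lemma lipschitz_rV (f : 'rV[R]_n -> R) (rho B : R) :
  (forall x, differentiable f x) ->
  (forall i x, `|x| <= rho -> `|'D_(delta_mx ord0 i) f x| <= B) ->
  forall x y, `|x| <= rho -> `|y| <= rho -> `|f y - f x| <= n%:R * B * `|y - x|.
Proof.
move=> df dB x y xr yr.
have [c [c01 Hc]] := mean_value_rV x (y - x) df.
rewrite subrKC in Hc; rewrite Hc.
apply: le_trans (ler_norm_sum _ _ _) _.
apply: (@le_trans _ _ (\sum_(i < n) B * `|y - x|)).
  apply: ler_sum => i _; rewrite normrM mulrC.
  apply: ler_pM => //; last exact: coord_le_norm.
  apply: dB.
  have -> : x + c *: (y - x) = (1 - c) *: x + c *: y.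
    by apply/rowP => k; rewrite !mxE; ring.
  case/andP: c01 => c0 c1; apply: le_trans (ler_normD _ _) _.
  rewrite !normrZ ger0_norm ?subr_ge0// ger0_norm//.
  have : (1 - c) * `|x| <= (1 - c) * rho by rewrite ler_wpM2l// subr_ge0.
  have : c * `|y| <= c * rho by rewrite ler_wpM2l.
  lra.
by rewrite sumr_const card_ord -[leLHS]mulr_natl mulrA.
Qed.

Lemma continuous_bounded_ball (V : normedModType R) (f : 'rV[R]_n -> V) (rho : R) :
  continuous f -> exists2 B, 0 <= B & forall x, `|x| <= rho -> `|f x| <= B.
Proof.
move=> cf.
have cB : compact [set x : 'rV[R]_n | `|x| <= rho].
  apply: bounded_closed_compact.
    by exists rho; split; [exact: num_real|move=> M BM x /= /le_trans -> //; exact: ltW].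
  by apply: (@closed_comp _ _ _ [set x : R | x <= rho]) => [x _|];
    [exact: norm_continuous|exact: closed_le].
have := @continuous_compact _ _ f _ (continuous_subspaceT cf) cB.
move=> /compact_bounded[M [_ HM]].
exists (`|M| + 1); first by rewrite addr_ge0.
move=> x xr; apply: (HM (`|M| + 1)); last by exists x.
by rewrite (le_lt_trans (ler_norm M))// ltrDl.
Qed.

Variable J : 'rV[R]_n -> R.
Hypothesis JC2 : C2 J.

Lemma grad_coord u i : grad J u ord0 i = 'D_(delta_mx ord0 i) J u.
Proof. by rewrite mxE. Qed.

Lemma diff_grad_coord i u : differentiable (fun u => grad J u ord0 i) u.
Proof.
have [_ dg _] := JC2.
exact: (@differentiable_comp _ _ _ _ (grad J) (fun M : 'rV[R]_n => M ord0 i)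
  u (dg u) (differentiable_coord _ _ _)).
Qed.

(** Compactness of the ball bounds [J] and its derivatives up to order two; of the second
    derivatives only the resulting Lipschitz constant of the gradient is kept. *)
Lemma C2_bounds (rho : R) : exists2 B, 0 <= B &
  [/\ forall u, `|u| <= rho -> `|J u| <= B,
      forall u, `|u| <= rho -> `|grad J u| <= B,
      forall u v, `|u| <= rho -> `|v| <= rho -> `|J v - J u| <= B * `|v - u|
    & forall i u v, `|u| <= rho -> `|v| <= rho ->
       `|grad J v ord0 i - grad J u ord0 i| <= B * `|v - u|].
Proof.
have [dJ dg cg] := JC2.
have [B1 B10 HB1] := @continuous_bounded_ball _ J rho
  (fun u => differentiable_continuous (dJ u)).
have [B2 B20 HB2] := @continuous_bounded_ball _ (grad J) rho
  (fun u => differentiable_continuous (dg u)).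
have /choice[B3 HB3] : forall i : 'I_n, exists B, 0 <= B /\
    forall u, `|u| <= rho -> `|'D_(delta_mx ord0 i) (grad J) u| <= B.
  by move=> i; have [B ? ?] := continuous_bounded_ball rho (cg (delta_mx ord0 i)); exists B.
pose B4 := \sum_(i < n) B3 i.
have B34 i : B3 i <= B4.
  rewrite /B4 (bigD1 i)//= lerDl sumr_ge0// => j _; by case: (HB3 j).
have B40 : 0 <= B4 by apply: sumr_ge0 => j _; case: (HB3 j).
have n0 : 0 <= n%:R :> R by [].
have nB2 : 0 <= n%:R * B2 by rewrite mulr_ge0.
have nB4 : 0 <= n%:R * B4 by rewrite mulr_ge0.
exists (B1 + B2 + n%:R * B2 + n%:R * B4).
  by rewrite !addr_ge0.
split.
- by move=> u /HB1; lra.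
- by move=> u /HB2; lra.
- move=> u v ur vr.
  apply: le_trans (@lipschitz_rV J rho B2 dJ _ u v ur vr) _.
    move=> i x xr; rewrite -grad_coord; apply: le_trans (HB2 _ xr).
    exact: coord_le_norm.
  by rewrite ler_wpM2r//; lra.
- move=> i u v ur vr.
  apply: le_trans (@lipschitz_rV (fun u => grad J u ord0 i) rho B4 _ _ u v ur vr) _.
  + exact: diff_grad_coord.
  + move=> j x xr; apply: le_trans (B34 j); apply: le_trans ((HB3 j).2 x xr).
    rewrite derive_mx; last exact: diff_derivable.
    by apply: le_trans (coord_le_norm _ i); rewrite mxE.
  + by rewrite ler_wpM2r//; lra.
Qed.

Lemma taylor1 (rho B : R) : (forall i u v, `|u| <= rho -> `|v| <= rho ->
    `|grad J v ord0 i - grad J u ord0 i| <= B * `|v - u|) -> 0 <= B ->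
  forall u h, `|u| <= rho -> `|u| + `|h| <= rho ->
  `|J (u + h) - J u - \sum_(i < n) h ord0 i * grad J u ord0 i| <=
    n%:R * B * `|h| ^+ 2.
Proof.
move=> HB B0 u h ur hr; have [dJ _ _] := JC2.
have [c [/andP[c0 c1] ->]] := mean_value_rV u h dJ.
have hc : `|c *: h| <= `|h|.
  by rewrite normrZ ger0_norm// ler_piMl.
rewrite -sumrB; apply: le_trans (ler_norm_sum _ _ _) _.
apply: (@le_trans _ _ (\sum_(i < n) B * `|h| ^+ 2)); last first.
  by rewrite sumr_const card_ord -[leLHS]mulr_natl mulrA.
apply: ler_sum => i _; rewrite -mulrBr normrM expr2 mulrA mulrC.
apply: ler_pM => //; last exact: coord_le_norm.
rewrite -grad_coord; apply: le_trans (HB i u _ ur _) _.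
  by apply: le_trans (ler_normD _ _) _; lra.
by rewrite addrAC subrr add0r ler_wpM2l.
Qed.

End SmoothCost.

(** * A scalar low-pass filter with an oscillating input *)

Section ScalarTracking.
Context {R : realType}.
Notation mu := (@lebesgue_measure R).
Implicit Types (f g : R -> R) (a b : R).

(** The constant is hidden because it may blow up as the small parameters vanish; it serves only to
    justify integrating almost-everywhere inequalities and enters no estimate. *)
Definition is_lip (V : normedModType R) (f : R -> V) a b := exists L, lip_on L f a b.

Lemma is_lip_cst c a b : is_lip (fun=> c : R) a b.
Proof. by exists 0 => s t *; rewrite subrr normr0 mul0r. Qed.

Lemma is_lipD f g a b : is_lip f a b -> is_lip g a b ->
  is_lip (fun t => f t + g t) a b.
Proof.
move=> [L1 H1] [L2 H2]; exists (L1 + L2) => s t as_ st tb.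
have -> : f t + g t - (f s + g s) = (f t - f s) + (g t - g s) by lra.
apply: le_trans (ler_normD _ _) _; rewrite mulrDl.
by apply: lerD; [exact: H1|exact: H2].
Qed.

Lemma is_lipM f g a b : a <= b -> is_lip f a b -> is_lip g a b ->
  is_lip (fun t => f t * g t) a b.
Proof.
move=> ab [L1 H1] [L2 H2].
have bd (h : R -> R) (L : R) : lip_on L h a b -> forall t : R, a <= t <= b ->
    `|h t| <= `|h a| + `|L| * (b - a).
  move=> H t /andP[at_ tb].
  have : `|h t - h a| <= `|L| * (b - a).
    apply: le_trans (H a t (lexx a) at_ tb) _.
    apply: (@le_trans _ _ (`|L| * (t - a))).
      by rewrite ler_wpM2r ?subr_ge0// ler_norm.
    by rewrite ler_wpM2l// lerD2r.
  by rewrite -[in X in _ -> X](subrK (h a) (h t)); have := ler_normD (h t - h a) (h a); lra.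
set Bf := `|f a| + `|L1| * (b - a); set Bg := `|g a| + `|L2| * (b - a).
exists (Bf * L2 + Bg * L1) => s t as_ st tb.
have -> : f t * g t - f s * g s = f t * (g t - g s) + g s * (f t - f s) by ring.
apply: le_trans (ler_normD _ _) _; rewrite !normrM mulrDl -!mulrA.
have f1 : `|f t| <= Bf by apply: (bd f L1 H1); rewrite (le_trans as_).
have g1 : `|g s| <= Bg by apply: (bd g L2 H2); rewrite as_ (le_trans st).
by apply: lerD; apply: ler_pM => //; [exact: H2|exact: H1].
Qed.

Lemma is_lipN f a b : is_lip f a b -> is_lip (fun t => - f t) a b.
Proof.
by move=> [L H]; exists L => s t *; rewrite -opprD normrN; exact: H.
Qed.

Lemma is_lip_sum (I : Type) (r : seq I) (F : I -> R -> R) a b :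
  (forall i, is_lip (F i) a b) -> is_lip (fun t => \sum_(i <- r) F i t) a b.
Proof.
move=> H; elim: r => [|i r IH].
  by under eq_fun do rewrite big_nil; exact: is_lip_cst.
by under eq_fun do rewrite big_cons; exact: is_lipD.
Qed.

Lemma is_lip_expR al a b : 0 <= al -> a <= b ->
  is_lip (fun t => expR (al * (t - a))) a b.
Proof.
move=> al0 ab; exists (expR (al * (b - a)) * al) => s t as_ st tb.
have st' : 0 <= al * (t - s) by rewrite mulr_ge0// subr_ge0.
rewrite ger0_norm; last by rewrite subr_ge0 ler_expR ler_wpM2l// lerD2r.
have -> : expR (al * (s - a)) = expR (al * (t - a)) * expR (- (al * (t - s))).
  by rewrite -expRD; congr expR; ring.
have H : 1 - al * (t - s) <= expR (- (al * (t - s))) by exact: expR_ge1Dx.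
apply: (@le_trans _ _ (expR (al * (t - a)) * (al * (t - s)))).
  rewrite -{1}(mulr1 (expR (al * (t - a)))) -mulrBr ler_wpM2l ?expR_ge0//; lra.
rewrite -mulrA ler_wpM2r// ler_expR ler_wpM2l// lerD2r//.
Qed.

Lemma derivable_is_derive (V : normedModType R) (f : R -> V) (t : R) :
  derivable f t 1 -> is_derive t (1 : R) f (derive1 f t).
Proof. by move=> df; rewrite derive1E; exact/derivableP. Qed.

Lemma is_derive_derive1 (V : normedModType R) (f : R -> V) (t : R) d :
  is_derive t (1 : R) f d -> derive1 f t = d.
Proof. by move=> df; rewrite derive1E; case: df. Qed.

Lemma lip_derive_le (V : normedModType R) (f : R -> V) K a b t : lip_on K f a b ->
  a < t < b -> derivable f t 1 -> `|derive1 f t| <= K.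
Proof.
move=> fL /andP[at_ tb] df; apply/ler_addgt0Pl => e e0.
have [d d0 Hd] := derivable_expand df e0.
pose h := Num.min (d / 2) (b - t).
have h0 : 0 < h by rewrite lt_min subr_gt0 tb divr_gt0.
have hd : h < d by rewrite gt_min; apply/orP; left; lra.
have hb : h <= b - t by rewrite ge_min lexx orbT.
have th : t + h - t = h by lra.
have := Hd (t + h); rewrite th gtr0_norm// => /(_ hd) H1.
have H2 : `|f (t + h) - f t| <= K * (t + h - t) by apply: fL; lra.
rewrite th in H2.
rewrite -(ler_pM2l h0) -{1}(gtr0_norm h0) -normrZ.
have -> : h *: derive1 f t = (f (t + h) - f t) -
  (f (t + h) - f t - h *: derive1 f t) by rewrite subKr.
apply: le_trans (ler_normB _ _) _; lra.
Qed.

Lemma scalar_decay f al th a b t : 0 <= al -> is_lip f a b ->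
  {ae mu, forall t, a < t < b ->
    derivable f t 1 /\ derive1 f t <= - (al * f t) + al * th} ->
  a <= t <= b -> f t <= th + expR (- (al * (t - a))) * (f a - th).
Proof.
move=> al0 fl fd /andP[at_ tb].
(* Integrating factor: the differential inequality says exactly that [g] has nonpositive
   derivative. *)
pose g s := expR (al * (s - a)) * (f s - th).
have [L Lg] : is_lip g a b.
  apply: is_lipM; [exact: le_trans tb|apply: is_lip_expR => //; exact: le_trans tb|].
  by apply: is_lipD => //; exact: is_lip_cst.
have gt : g t <= g a.
  apply: (@nonincr_of_derive _ g a t L) => //.
    by move=> s u ? ? ?; apply: Lg => //; exact: le_trans tb.
  apply: aeS fd => s H /andP[as_ st].
  have [|ds Hs] := H; first by rewrite as_ (lt_le_trans st tb).
  have de : is_derive s (1 : R) (fun s => expR (al * (s - a)))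
      (al * expR (al * (s - a))).
    have da : is_derive s (1 : R) (fun s => al * (s - a)) al.
      have -> : (fun s => al * (s - a)) = (al *: (id : R -> R)) - cst (al * a).
        by apply/funext => x; exact: mulrBr.
      by apply: is_derive_eq; rewrite subr0; exact: mulr1.
    have dE : is_derive (al * (s - a)) (1 : R) expR (expR (al * (s - a))).
      exact: is_derive_expR.
    have := @is_derive1_comp R expR (fun s => al * (s - a)) s _ _ dE da.
    by rewrite mulrC.
  have df : is_derive s (1 : R) (fun s => f s - th) (derive1 f s).
    by have := is_deriveB (derivable_is_derive ds) (is_derive_cst th s 1); rewrite subr0.
  have dg : is_derive s (1 : R) g (expR (al * (s - a)) *: derive1 f s +
      (f s - th) *: (al * expR (al * (s - a)))) by exact: is_deriveM.
  split; first exact: ex_derive.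
  rewrite (is_derive_derive1 dg).
  rewrite /GRing.scale/=.
  have e0 : 0 <= expR (al * (s - a)) by exact: expR_ge0.
  have : expR (al * (s - a)) * (derive1 f s + al * (f s - th)) <= 0.
    by rewrite mulr_ge0_le0//; lra.
  lra.
rewrite -lerBlDl expRN mulrC ler_pdivlMr ?expR_gt0//.
move: gt; rewrite /g subrr mulr0 expR0 mul1r mulrC//.
Qed.

Lemma scalar_decay_norm f al th a b t : 0 <= al -> 0 <= th -> is_lip f a b ->
  {ae mu, forall t, a < t < b ->
    derivable f t 1 /\ `|derive1 f t + al * f t| <= al * th} ->
  a <= t <= b -> `|f t| <= th + expR (- (al * (t - a))) * `|f a|.
Proof.
move=> al0 th0 fl fd tab.
have e0 : 0 <= expR (- (al * (t - a))) by exact: expR_ge0.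
have e1 x : expR (- (al * (t - a))) * (x - th) <=
    expR (- (al * (t - a))) * `|x|.
  by rewrite ler_wpM2l//; have := ler_norm x; lra.
rewrite ler_norml; apply/andP; split; last first.
  have fd' : {ae mu, forall t, a < t < b ->
      derivable f t 1 /\ derive1 f t <= - (al * f t) + al * th}.
    apply: aeS fd => s H /H[ds]; rewrite ler_norml => /andP[_ ?]; split => //; lra.
  by apply: le_trans (scalar_decay al0 fl fd' tab) _; rewrite lerD2l.
have := @scalar_decay (fun s => - f s) al th a b t al0 (is_lipN fl) _ tab.
have fd' : {ae mu, forall t, a < t < b -> derivable (fun s => - f s) t 1 /\
    derive1 (fun s => - f s) t <= - (al * - f t) + al * th}.
  apply: aeS fd => s H /H[ds]; rewrite ler_norml => /andP[? _].
  have dN := is_deriveN (derivable_is_derive ds).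
  split; first by case: dN.
  rewrite (is_derive_derive1 dN); lra.
move=> /(_ fd'); have := e1 (- f a); rewrite normrN; lra.
Qed.

(** The filter is driven by [G] plus [ew * W'], where [W] is bounded but [ew * W'] need not be
    small. Subtracting the corrector [al * ew * W] from [xi - G] cancels that term and leaves a
    multiple of [W] itself. The factor [2] in the bound counts the corrector once in the inequality
    for [z] and once when returning from [z] to [xi - G]. *)
Lemma scalar_tracking (xi G W : R -> R) al ew w e1 LG a b t :
  0 < al -> 0 <= ew -> 0 <= e1 -> 0 <= LG -> 0 <= w ->
  is_lip xi a b -> is_lip G a b -> is_lip W a b ->
  (forall t, a <= t <= b -> `|W t| <= w) ->
  {ae mu, forall t, a < t < b -> [/\ derivable xi t 1, derivable G t 1,
     derivable W t 1, `|derive1 G t| <= LG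
   & `|derive1 xi t + al * (xi t - G t - ew * derive1 W t)| <= al * e1]} ->
  a <= t <= b ->
  `|xi t - G t| <= 2 * (al * ew * w) + e1 + LG / al +
     expR (- (al * (t - a))) * (`|xi a| + `|G a| + al * ew * w).
Proof.
move=> al0 ew0 e10 LG0 w0 lxi lG lW Ww H tab.
pose z s := xi s - G s - al * ew * W s.
pose th := e1 + LG / al + al * ew * w.
have aw0 : 0 <= al * ew * w by rewrite !mulr_ge0// ltW.
have ab : a <= b by case/andP: tab => ? ?; lra.
have th0 : 0 <= th by rewrite !addr_ge0// divr_ge0// ltW.
have lz : is_lip z a b.
  apply: is_lipD; first by apply: is_lipD => //; exact: is_lipN.
  by apply: is_lipN; apply: is_lipM => //; exact: is_lip_cst.
have awW s : a <= s <= b -> `|al * ew * W s| <= al * ew * w.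
  move=> sab; rewrite normrM ger0_norm ?mulr_ge0 ?(ltW al0)//.
  by rewrite ler_wpM2l ?mulr_ge0 ?(ltW al0)// Ww.
have : `|z t| <= th + expR (- (al * (t - a))) * `|z a|.
  apply: (scalar_decay_norm (ltW al0) th0 lz _ tab).
  apply: aeS H => s Hs sab; have [dxi dG dW HG Hxi] := Hs sab.
  have [dz ->] : derivable z s 1 /\
      derive1 z s = derive1 xi s - derive1 G s - al * ew * derive1 W s.
    have zE : z = xi - G - (al * ew) *: W by [].
    have := is_deriveB (is_deriveB (derivable_is_derive dxi)
      (derivable_is_derive dG)) (is_deriveZ (al * ew) (derivable_is_derive dW)).
    by rewrite -zE => dz; split; [case: dz|rewrite (is_derive_derive1 dz)].
  split; first exact: dz.
  have -> : derive1 xi s - derive1 G s - al * ew * derive1 W s + al * z s =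
    (derive1 xi s + al * (xi s - G s - ew * derive1 W s)) - derive1 G s
    - al * (al * ew * W s) by rewrite /z; ring.
  apply: le_trans (ler_normB _ _) _.
  have := ler_normB (derive1 xi s + al * (xi s - G s - ew * derive1 W s)) (derive1 G s).
  have : `|al * (al * ew * W s)| <= al * (al * ew * w).
    rewrite normrM gtr0_norm// ler_wpM2l ?(ltW al0)// awW//.
    by case/andP: sab => ? ?; rewrite !ltW.
  have -> : al * th = al * e1 + LG + al * (al * ew * w).
    by rewrite /th; field; rewrite gt_eqF.
  lra.
have : `|z a| <= `|xi a| + `|G a| + al * ew * w.
  apply: le_trans (ler_normB _ _) _; apply: lerD; first exact: ler_normB.
  by apply: awW; rewrite lexx.
move=> /(ler_wpM2l (expR_ge0 (- (al * (t - a))))) H1 H2.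
have : `|xi t - G t| <= `|z t| + al * ew * w.
  have -> : xi t - G t = z t + al * ew * W t by rewrite /z; ring.
  apply: le_trans (ler_normD _ _) _; rewrite lerD2l; exact: awW.
rewrite /th in H2; lra.
Qed.

End ScalarTracking.

(** * Coordinates of the dither state and its rotation field *)

Section DitherAlgebra.
Context {R : realType} (n : nat).
Implicit Types (m : 'rV[R]_n.*2) (i l : 'I_n).

Lemma pair_of_idx i a : pair_of (pair_idx i a) = i.
Proof.
apply/val_inj => /=; case: a => -[|[|//]] /= _.
  by rewrite addn0 doubleK.
by rewrite addnC (half_bit_double i true).
Qed.

Lemma entry_of_idx i a : entry_of (pair_idx i a) = a.
Proof.
apply/val_inj; rewrite /entry_of val_insubd /= oddD odd_double addFb.
by case: a => -[|[|//]].
Qed.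

Lemma pair_idx_of (k : 'I_n.*2) : pair_idx (pair_of k) (entry_of k) = k.
Proof.
apply/val_inj => /=; rewrite /entry_of val_insubd.
have -> : (odd k < 2)%N by case: odd.
by rewrite addnC odd_double_half.
Qed.

Lemma ord2P (a : 'I_2) : a = ord0 \/ a = ord_max.
Proof. by case: a => -[|[|//]] h; [left|right]; apply/val_inj. Qed.

Lemma Rot_entries : [/\ Rot ord0 ord0 = 0 :> R, Rot ord0 ord_max = 1 :> R,
  Rot ord_max ord0 = -1 :> R & Rot ord_max ord_max = 0 :> R].
Proof.
have e0 : ord0 = lshift 1 (ord0 : 'I_1) by apply/val_inj.
have e1 : ord_max = rshift 1 (ord0 : 'I_1) by apply/val_inj.
rewrite /Rot e0 e1; split.
- by apply: (etrans (block_mxEul _ _ _ _ _ _)); rewrite mxE.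
- by apply: (etrans (block_mxEur _ _ _ _ _ _)); rewrite mxE eqxx.
- by apply: (etrans (block_mxEdl _ _ _ _ _ _)); rewrite !mxE eqxx.
- by apply: (etrans (block_mxEdr _ _ _ _ _ _)); rewrite mxE.
Qed.

Lemma Dmx_coord m i : (m *m (Dmx n)^T) ord0 i = m ord0 (pair_idx i ord0).
Proof.
rewrite mxE (bigD1 (pair_idx i ord0))//= !mxE eqxx mulr1 big1 ?addr0// => k ki.
by rewrite !mxE (negPf ki) mulr0.
Qed.

Lemma Phi_coord m (om : 'I_n -> R) i a :
  (m *m (Phi om)^T) ord0 (pair_idx i a) =
  om i * (m ord0 (pair_idx i ord0) * Rot a ord0 +
          m ord0 (pair_idx i ord_max) * Rot a ord_max).
Proof.
have ne : pair_idx i ord_max != pair_idx i ord0.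
  by apply/eqP => /(congr1 (@entry_of n)); rewrite !entry_of_idx.
rewrite mxE (bigD1 (pair_idx i ord0))//= (bigD1 (pair_idx i ord_max))//=.
rewrite big1 => [|k /andP[k0 k1]].
  rewrite !mxE !pair_of_idx eqxx !entry_of_idx; ring.
rewrite !mxE pair_of_idx; case: eqP => [ik|_]; last by rewrite mulr0.
exfalso; move: k0 k1; rewrite -(pair_idx_of k) -ik.
by have [->|->] := ord2P (entry_of k); rewrite eqxx.
Qed.

Lemma torus_coord m i : torus m ->
  m ord0 (pair_idx i ord0) ^+ 2 + m ord0 (pair_idx i ord_max) ^+ 2 = 1.
Proof.
move=> /(_ i); rewrite /circle/= => E.
have := enorm_sqr (\row_(a < 2) m ord0 (pair_idx i a)).
rewrite E expr1n big_ord_recl big_ord1 !mxE => ->.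
by congr (_ + m ord0 (pair_idx i _) ^+ 2); apply/val_inj.
Qed.

Lemma torus_le1 m i : torus m -> `|m ord0 (pair_idx i ord0)| <= 1 /\
  `|m ord0 (pair_idx i ord_max)| <= 1.
Proof.
move=> /(torus_coord i) H.
have sq (x y : R) : x ^+ 2 + y ^+ 2 = 1 -> `|x| <= 1.
  move=> E; rewrite -(@ler_sqr _ `|x| 1) ?nnegrE// expr1n real_normK ?num_real//.
  by rewrite -E lerDl sqr_ge0.
by split; [exact: sq H|apply: (sq _ (m ord0 (pair_idx i ord0))); rewrite addrC].
Qed.

End DitherAlgebra.

(** * Averaging of the dither and the gradient tracking estimate *)

Section Tracking.
Context {R : realType} (n : nat).
Notation mu := (@lebesgue_measure R).
Variables (J : 'rV[R]_n -> R) (kap : 'I_n -> R).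
Hypotheses (JC2 : C2 J) (kap_gt0 : forall i, 0 < kap i) (kapI : injective kap).

Lemma derivable_coord p (f : R -> 'rV[R]_p) (t : R) i : derivable f t 1 ->
  is_derive t (1 : R) (fun s => f s ord0 i) (derive1 f t ord0 i).
Proof.
move=> df; have dfi : derivable (fun s => f s ord0 i) t 1.
  by have /derivable_mxP := df; apply.
have := derivable_is_derive dfi; congr is_derive.
by rewrite !derive1E derive_mx// mxE.
Qed.

Lemma is_lip_coord p (f : R -> 'rV[R]_p) a b i : is_lip f a b ->
  is_lip (fun s => f s ord0 i) a b.
Proof.
move=> [L H]; exists L => s t as_ st tb; apply: le_trans (H s t as_ st tb).
by apply: le_trans (coord_le_norm _ i); rewrite !mxE.
Qed.

(** A common bound for the antiderivatives [A] and [E l] below, for every coordinate. The summand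
    [l = i] has denominator [0] and is therefore [0]. *)
Definition dither_weight : R :=
  \sum_(i < n) ((kap i)^-1 +
    \sum_(l < n) 2 * (kap l + kap i) / `|kap i ^+ 2 - kap l ^+ 2|).

Lemma dither_weight_ge i l : (kap i)^-1 <= dither_weight /\
  2 * (kap l + kap i) / `|kap i ^+ 2 - kap l ^+ 2| <= dither_weight.
Proof.
have k0 := kap_gt0.
have q0 i' l' : 0 <= 2 * (kap l' + kap i') / `|kap i' ^+ 2 - kap l' ^+ 2|.
  by rewrite divr_ge0// mulr_ge0// addr_ge0// ltW.
have s0 i' : 0 <= \sum_(l < n) 2 * (kap l + kap i') / `|kap i' ^+ 2 - kap l ^+ 2|.
  by apply: sumr_ge0.
have i0 i' : 0 <= (kap i')^-1 by rewrite invr_ge0 ltW.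
have H : (kap i)^-1 + \sum_(l < n) 2 * (kap l + kap i) / `|kap i ^+ 2 - kap l ^+ 2|
    <= dither_weight.
  rewrite /dither_weight [leRHS](bigD1 i)//= lerDl sumr_ge0// => j _.
  by rewrite addr_ge0.
split; first by apply: le_trans H; rewrite lerDl.
apply: le_trans H; rewrite ler_wpDl// (bigD1 l)//= lerDl sumr_ge0//.
Qed.

Definition dither_flow (kf ef ea ew rho L lam a b : R) (u xi : R -> 'rV[R]_n)
    (m : R -> 'rV[R]_n.*2) :=
  [/\ lip_on L u a b, is_lip xi a b, is_lip m a b,
      forall t, a <= t <= b -> [/\ `|u t| <= rho, `|xi t| <= lam & torus (m t)]
    & {ae mu, forall t, a < t < b -> [/\ derivable u t 1, derivable xi t 1,
        derivable m t 1,
        derive1 xi t = - (kf / ef) *: (xi t -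
          (2 / ea * J (u t + ea *: (m t *m (Dmx n)^T))) *: (m t *m (Dmx n)^T))
        & derive1 m t = m t *m (Phi (fun i => kap i / ew))^T]}].

Section coordinate.
Variables (kf ef ea ew rho L lam a b B : R) (u xi : R -> 'rV[R]_n).
Variables (m : R -> 'rV[R]_n.*2) (i : 'I_n).
Hypotheses (kf0 : 0 < kf) (ef0 : 0 < ef) (ea0 : 0 < ea) (ea1 : ea <= 1)
  (ew0 : 0 < ew) (L0 : 0 <= L) (B0 : 0 <= B) (ab : a < b).
Hypothesis fl : dither_flow kf ef ea ew rho L lam a b u xi m.
Hypothesis JB : forall v, `|v| <= rho + 1 -> `|J v| <= B.
Hypothesis gB : forall v, `|v| <= rho + 1 -> `|grad J v| <= B.
Hypothesis Jlip : forall v w, `|v| <= rho + 1 -> `|w| <= rho + 1 ->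
  `|J w - J v| <= B * `|w - v|.
Hypothesis glip : forall j v w, `|v| <= rho + 1 -> `|w| <= rho + 1 ->
  `|grad J w ord0 j - grad J v ord0 j| <= B * `|w - v|.

Let cK := dither_weight.
Let P l (t : R) : R := m t ord0 (pair_idx l ord0).
Let Q l (t : R) : R := m t ord0 (pair_idx l ord_max).
Let g l (t : R) : R := grad J (u t) ord0 l.
(* [A] and [E l] are antiderivatives, up to the factor [ew], of [P i] and of
   [2 P_l P_i - (l == i)]; together they integrate the oscillating part of
   [2 / ea * J (u + ea P) * P_i = 2 / ea * J u * P_i + 2 sum_l g_l P_l P_i + O(ea)]. *)
Let A (t : R) : R := - (kap i)^-1 * Q i t.
Let E l (t : R) : R := if l == i then - (kap i)^-1 * (P i t * Q i t) else
  2 / (kap i ^+ 2 - kap l ^+ 2) *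
  (kap l * (P i t * Q l t) - kap i * (Q i t * P l t)).
Let W (t : R) : R := 2 / ea * (J (u t) * A t) + \sum_(l < n) g l t * E l t.
Let al := kf / ef.
Let w := 2 / ea * (B * cK) + n%:R * (B * cK).
(** The first summand is the second-order Taylor remainder times [2 / ea]; the rest comes from
    differentiating the slow coefficients [J u] and [g l] inside [W]. *)
Let e1 := 2 * n%:R * B * ea +
   ew * (2 / ea * (B * L * cK) + n%:R * (B * L * cK)).

Let in_ball t : a <= t <= b -> `|u t| <= rho + 1.
Proof. by move=> tab; have [_ _ _ /(_ t tab)[? _ _] _] := fl; rewrite ler_wpDr. Qed.

Let cK0 : 0 <= cK.
Proof.
by have [+ _] := dither_weight_ge i i; apply: le_trans; rewrite invr_ge0 ltW.
Qed.

Let PQ l t : a <= t <= b -> `|P l t| <= 1 /\ `|Q l t| <= 1.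
Proof.
by move=> tab; have [_ _ _ /(_ t tab)[_ _ mt] _] := fl; exact: torus_le1.
Qed.

Let kapV_norm : `|- (kap i)^-1| = (kap i)^-1.
Proof. by rewrite normrN gtr0_norm// invr_gt0. Qed.

Let A_le t : a <= t <= b -> `|A t| <= cK.
Proof.
move=> /(PQ i)[_ Q1]; rewrite /A normrM kapV_norm.
apply: le_trans (dither_weight_ge i i).1.
by rewrite ler_piMr// invr_ge0 ltW.
Qed.

Let E_le l t : a <= t <= b -> `|E l t| <= cK.
Proof.
move=> tab; have [Pi Qi] := PQ i tab; have [Pl Ql] := PQ l tab.
have le1 (x y : R) : `|x| <= 1 -> `|y| <= 1 -> `|x * y| <= 1.
  by move=> x1 y1; rewrite normrM mulr_ile1.
rewrite /E; case: eqP => [_|/eqP li].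
  rewrite normrM kapV_norm.
  apply: le_trans (dither_weight_ge i i).1.
  by rewrite ler_piMr ?le1// invr_ge0 ltW.
apply: le_trans (dither_weight_ge i l).2.
rewrite normrM normf_div [`|2|]ger0_norm// -!mulrA ler_wpM2l// mulrC.
rewrite ler_wpM2r ?invr_ge0//.
apply: le_trans (ler_normB _ _) _; apply: lerD.
  by rewrite normrM (gtr0_norm (kap_gt0 l)) ler_piMr ?le1// ltW.
by rewrite normrM (gtr0_norm (kap_gt0 i)) ler_piMr ?le1// ltW.
Qed.

Let J_lip : lip_on (B * L) (fun t => J (u t)) a b.
Proof.
have [ul _ _ _ _] := fl; move=> s t as_ st tb.
apply: le_trans (Jlip _ _) _; [apply: in_ball; lra|apply: in_ball; lra|].
by rewrite -mulrA ler_wpM2l// ul.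
Qed.

Let g_lip l : lip_on (B * L) (g l) a b.
Proof.
have [ul _ _ _ _] := fl; move=> s t as_ st tb.
apply: le_trans (glip _ _ _) _; [apply: in_ball; lra|apply: in_ball; lra|].
by rewrite -mulrA ler_wpM2l// ul.
Qed.

Let P_lip l : is_lip (P l) a b.
Proof. by apply: is_lip_coord; case: fl. Qed.

Let Q_lip l : is_lip (Q l) a b.
Proof. by apply: is_lip_coord; case: fl. Qed.

Let scale_lip (c : R) (f : R -> R) : is_lip f a b -> is_lip (fun t => c * f t) a b.
Proof. by move=> ?; apply: is_lipM => //; [exact: ltW|exact: is_lip_cst]. Qed.

Let W_lip : is_lip W a b.
Proof.
have ab' := ltW ab; apply: is_lipD.
  apply: scale_lip; apply: is_lipM => //; first by exists (B * L).
  exact: scale_lip.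
apply: is_lip_sum => l; apply: is_lipM => //; first by exists (B * L).
rewrite /E; case: eqP => _; first exact/scale_lip/is_lipM.
apply: scale_lip; apply: is_lipD; first exact/scale_lip/is_lipM.
exact/is_lipN/scale_lip/is_lipM.
Qed.

Let w0 : 0 <= w.
Proof. by rewrite /w addr_ge0 ?mulr_ge0 ?invr_ge0// ltW. Qed.

Let W_le t : a <= t <= b -> `|W t| <= w.
Proof.
move=> tab; have ea' : 0 <= 2 / ea by rewrite divr_ge0// ltW.
apply: le_trans (ler_normD _ _) _; apply: lerD.
  rewrite normrM ger0_norm// ler_wpM2l// normrM.
  by apply: ler_pM => //; [exact/JB/in_ball|exact: A_le].
apply: le_trans (ler_norm_sum _ _ _) _.
apply: (@le_trans _ _ (\sum_(l < n) B * cK)); last first.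
  by rewrite sumr_const card_ord -[leLHS]mulr_natl.
apply: ler_sum => l _; rewrite normrM.
apply: ler_pM => //; last exact: E_le.
by apply: le_trans (coord_le_norm _ _) _; exact/gB/in_ball.
Qed.

Let dP l t : derivable m t 1 ->
  derive1 m t = m t *m (Phi (fun i => kap i / ew))^T ->
  is_derive t (1 : R) (P l) (kap l / ew * Q l t).
Proof.
move=> dm Em; have [R1 R2 R3 R4] := @Rot_entries R.
have := derivable_coord (pair_idx l ord0) dm.
by rewrite Em Phi_coord R1 R2 mulr0 mulr1 add0r.
Qed.

Let dQ l t : derivable m t 1 ->
  derive1 m t = m t *m (Phi (fun i => kap i / ew))^T ->
  is_derive t (1 : R) (Q l) (- (kap l / ew * P l t)).
Proof.
move=> dm Em; have [R1 R2 R3 R4] := @Rot_entries R.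
have := derivable_coord (pair_idx l ord_max) dm.
by rewrite Em Phi_coord R3 R4 mulr0 mulrN1 addr0 mulrN.
Qed.

Let dA t : derivable m t 1 ->
  derive1 m t = m t *m (Phi (fun i => kap i / ew))^T ->
  is_derive t (1 : R) A (ew^-1 * P i t).
Proof.
move=> dm Em; have := is_deriveZ (- (kap i)^-1) (dQ i dm Em).
congr is_derive; rewrite /GRing.scale/=; field.
by rewrite !gt_eqF.
Qed.

(** On the diagonal, the relation [P^2 + Q^2 = 1] turns [P^2 - Q^2] into [2 P^2 - 1]. Off the
    diagonal, the products [Q_i Q_l] cancel between the two terms and leave the factor
    [kap i ^+ 2 - kap l ^+ 2], nonzero because the frequencies are positive and distinct. *)
Let dE l t : torus (m t) -> derivable m t 1 ->
  derive1 m t = m t *m (Phi (fun i => kap i / ew))^T ->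
  is_derive t (1 : R) (E l) (ew^-1 * (2 * P i t * P l t - (l == i)%:R)).
Proof.
move=> tm dm Em; have e0 : ew != 0 by rewrite gt_eqF.
have k0 : kap i != 0 by rewrite gt_eqF.
have [lE|li] := eqVneq l i.
  have -> : E l = - (kap i)^-1 *: (P i * Q i).
    by apply/funext => s; rewrite /E lE eqxx.
  have := is_deriveZ (- (kap i)^-1) (is_deriveM (dP i dm Em) (dQ i dm Em)).
  congr is_derive; rewrite /GRing.scale/= lE.
  have := torus_coord i tm; rewrite -/(P i t) -/(Q i t) => PQ1.
  have Q2 : Q i t * Q i t = 1 - P i t * P i t by rewrite -!expr2; lra.
  transitivity (ew^-1 * (Q i t * Q i t * -1 + P i t * P i t)).
    by field; rewrite e0 k0.
  by rewrite Q2; ring.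
have kl : kap i ^+ 2 - kap l ^+ 2 != 0.
  rewrite subr_sqr mulf_neq0//; last by rewrite gt_eqF// addr_gt0.
  by rewrite subr_eq0; apply: contra_neq li => /kapI ->.
have -> : E l = (2 / (kap i ^+ 2 - kap l ^+ 2)) *:
    (kap l *: (P i * Q l) - kap i *: (Q i * P l)).
  by apply/funext => s; rewrite /E (negPf li).
have := is_deriveZ (2 / (kap i ^+ 2 - kap l ^+ 2)) (is_deriveB
  (is_deriveZ (kap l) (is_deriveM (dP i dm Em) (dQ l dm Em)))
  (is_deriveZ (kap i) (is_deriveM (dQ i dm Em) (dP l dm Em)))).
congr is_derive; rewrite /GRing.scale/=; field.
by rewrite e0.
Qed.

Let differentiable_comp1 (h : 'rV[R]_n -> R) t : (forall v, differentiable h v) ->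
  derivable u t 1 -> derivable (fun s => h (u s)) t 1.
Proof.
move=> dh du; apply/derivable1_diffP.
by apply: differentiable_comp; [exact/derivable1_diffP|exact: dh].
Qed.

Lemma coordinate_tracking t : a <= t <= b ->
  `|xi t ord0 i - grad J (u t) ord0 i| <=
  2 * (al * ew * w) + e1 + B * L / al +
    expR (- (al * (t - a))) * (lam + B + al * ew * w).
Proof.
move=> tab; have al0 : 0 < al by rewrite divr_gt0.
have BL0 : 0 <= B * L by rewrite mulr_ge0.
have ea' : 0 <= 2 / ea by rewrite divr_ge0// ltW.
have e10 : 0 <= e1.
  have BLc : 0 <= B * L * cK by rewrite mulr_ge0.
  apply: addr_ge0; first by rewrite !mulr_ge0// ltW.
  apply: mulr_ge0; first exact: ltW.
  by apply: addr_ge0; exact: mulr_ge0.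
have [ul xil ml fb fd] := fl.
apply: (@le_trans _ _ (2 * (al * ew * w) + e1 + B * L / al +
    expR (- (al * (t - a))) *
    (`|xi a ord0 i| + `|grad J (u a) ord0 i| + al * ew * w))); last first.
  rewrite lerD2l ler_wpM2l ?expR_ge0// lerD2r.
  have aab : a <= a <= b by rewrite lexx ltW.
  apply: lerD; first by apply: le_trans (coord_le_norm _ _) _; case: (fb a aab).
  by apply: le_trans (coord_le_norm _ _) _; exact/gB/in_ball.
apply: (@scalar_tracking _ (fun s => xi s ord0 i) (g i) W al ew w e1 (B * L) a b)
  => //.
- exact: ltW.
- exact: is_lip_coord.
- by exists (B * L).
apply: aeS fd => s Hs sab; have [du dxi dm Exi Em] := Hs sab.
have sab' : a <= s <= b by case/andP: sab => ? ?; rewrite !ltW.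
have [us xis tm] := fb s sab'.
have [dJ _ _] := JC2.
have dJu : derivable (fun s => J (u s)) s 1 by exact: differentiable_comp1.
have dgu l : derivable (g l) s 1.
  apply: (@differentiable_comp1 (fun v => grad J v ord0 l)) => // v.
  exact: diff_grad_coord.
set j' := derive1 (fun s => J (u s)) s.
have dW : is_derive s (1 : R) W (2 / ea * (J (u s) * (ew^-1 * P i s) + A s * j') +
   \sum_(l < n) (g l s * (ew^-1 * (2 * P i s * P l s - (l == i)%:R)) +
      E l s * derive1 (g l) s)).
  have -> : W = (2 / ea) *: ((fun s => J (u s)) * A) + \sum_(l < n) (g l * E l).
    by apply/funext => v; rewrite /W fctE fct_sumE.
  apply: is_deriveD; last first.
    by apply: is_derive_sum => l; apply: is_deriveM (derivable_is_derive (dgu l))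
      (dE l tm dm Em).
  by apply: is_deriveZ; apply: is_deriveM (derivable_is_derive dJu) (dA dm Em).
have dxii := derivable_coord i dxi.
split; [by case: dxii|exact: dgu|by case: dW| |].
  exact: lip_derive_le (g_lip i) sab (dgu i).
rewrite (is_derive_derive1 dW) (is_derive_derive1 dxii) Exi.
set p := m s *m (Dmx n)^T.
have pE l : p ord0 l = P l s by rewrite /p Dmx_coord.
have p1 : `|p| <= 1.
  by apply: norm_le_coord => // l; rewrite pE; case: (PQ l sab').
have [Pi Qi] := PQ i sab'.
have T1 : `|J (u s + ea *: p) - J (u s) - ea * \sum_(l < n) P l s * g l s| <=
    n%:R * B * ea ^+ 2.
  have eap : `|ea *: p| <= ea.
    by rewrite normrZ gtr0_norm// ler_piMr// ltW.
  have := @taylor1 _ _ J JC2 (rho + 1) B glip B0 (u s) (ea *: p).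
  have -> : \sum_(l < n) (ea *: p) ord0 l * grad J (u s) ord0 l =
      ea * \sum_(l < n) P l s * g l s.
    by rewrite mulr_sumr; apply: eq_bigr => l _; rewrite mxE pE mulrA.
  move=> H; apply: le_trans (H _ _) _; first exact: in_ball.
    by apply: lerD => //; exact: le_trans ea1.
  rewrite ler_wpM2l ?mulr_ge0// ler_sqr ?nnegrE//; exact: ltW.
set dif := J (u s + ea *: p) - J (u s) - _ in T1.
have sumE : \sum_(l < n) (g l s * (ew^-1 * (2 * P i s * P l s - (l == i)%:R)) +
      E l s * derive1 (g l) s) =
   ew^-1 * (2 * P i s * \sum_(l < n) P l s * g l s - g i s) +
   \sum_(l < n) E l s * derive1 (g l) s.
  rewrite big_split/=; congr (_ + _).
  under eq_bigr => l _ do rewrite [g l s * _]mulrCA mulrBr.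
  rewrite -mulr_sumr sumrB; congr (_ * (_ - _)).
    by rewrite mulr_sumr; apply: eq_bigr => l _; ring.
  rewrite (bigD1 i)//= eqxx mulr1 big1 ?addr0// => l li.
  by rewrite (negPf li) mulr0.
have cE (c d : R) (x y : 'rV[R]_n) :
    (c *: (x - d *: y)) ord0 i = c * (x ord0 i - d * y ord0 i).
  by rewrite !mxE.
rewrite sumE cE pE -/(g i s).
set S1 := \sum_(l < n) P l s * g l s in dif T1 *.
set S2 := \sum_(l < n) E l s * derive1 (g l) s.
(* Everything oscillating at order one cancels against [ew * W']; what survives is the Taylor
   remainder [dif] and the slow derivatives. *)
have -> : - (kf / ef) * (xi s ord0 i - 2 / ea * J (u s + ea *: p) * P i s) +
    al * (xi s ord0 i - g i s -
     ew * (2 / ea * (J (u s) * (ew^-1 * P i s) + A s * j') +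
      (ew^-1 * (2 * P i s * S1 - g i s) + S2))) =
   al * (2 / ea * P i s * dif - ew * (2 / ea * (A s * j') + S2)).
  by rewrite /dif -/al; field; rewrite !gt_eqF.
rewrite normrM gtr0_norm// ler_wpM2l ?(ltW al0)//.
apply: le_trans (ler_normB _ _) _; apply: lerD.
  rewrite normrM (normrM (2 / ea)) (ger0_norm ea').
  apply: (@le_trans _ _ (2 / ea * 1 * (n%:R * B * ea ^+ 2))).
    by apply: ler_pM => //; [exact: mulr_ge0|exact: ler_wpM2l].
  rewrite le_eqVlt; apply/orP; left; apply/eqP; field; by rewrite gt_eqF.
rewrite normrM gtr0_norm// ler_wpM2l ?(ltW ew0)//.
apply: le_trans (ler_normD _ _) _; apply: lerD.
  rewrite normrM ger0_norm// ler_wpM2l// normrM mulrC.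
  by apply: ler_pM => //; [exact: lip_derive_le J_lip sab dJu|exact: A_le].
apply: le_trans (ler_norm_sum _ _ _) _.
apply: (@le_trans _ _ (\sum_(l < n) B * L * cK)); last first.
  by rewrite sumr_const card_ord -[leLHS]mulr_natl.
apply: ler_sum => l _; rewrite normrM mulrC.
by apply: ler_pM => //; [exact: lip_derive_le (g_lip l) sab (dgu l)|exact: E_le].
Qed.

End coordinate.

(** The thresholds follow the dependence of the error terms: [ef] makes the gain [al] large enough
    for the drift of the gradient and for the transient to fade within time [eta]; [ea] makes the
    Taylor remainder small; [ew], chosen last, beats the factors [al] and [1 / ea]. The shares of
    [eta] are [1/4], [1/4], [1/8], [1/8] and [1/4], the last for the doubled corrector. *)
Lemma tracking (kf rho L lam eta : R) :
  0 < kf -> 0 <= L -> 0 <= lam -> 0 < eta ->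
  exists2 efs, 0 < efs & forall ef, 0 < ef < efs ->
  exists2 eas, 0 < eas & forall ea, 0 < ea < eas ->
  exists2 ews, 0 < ews & forall ew, 0 < ew < ews ->
  forall a b u xi m, a < b -> dither_flow kf ef ea ew rho L lam a b u xi m ->
  forall t, a + eta <= t <= b -> `|xi t - grad J (u t)| <= eta.
Proof.
move=> kf0 L0 lam0 eta0.
have [B B0 [JB gB Jl gl]] := C2_bounds JC2 (rho + 1).
pose cK := dither_weight.
have cK0 : 0 <= cK.
  apply: sumr_ge0 => i _; rewrite addr_ge0 ?invr_ge0 ?(ltW (kap_gt0 i))//.
  apply: sumr_ge0 => l _; rewrite divr_ge0// mulr_ge0//.
  by rewrite addr_ge0// ltW.
pose M0 := lam + B + 1.
have M00 : 0 < M0 by rewrite /M0; lra.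
have BL0 : 0 <= B * L by rewrite mulr_ge0.
have BL1 : 0 < 4 * (B * L + 1) by lra.
exists (Num.min (kf * eta / (4 * (B * L + 1))) (kf * eta ^+ 2 / (4 * M0))).
  rewrite lt_min !divr_gt0 ?mulr_gt0// ?exprn_gt0//; lra.
move=> ef /andP[ef0]; rewrite lt_min => /andP[ef1 ef2].
pose al := kf / ef; have al0 : 0 < al by rewrite divr_gt0.
have H1 : B * L / al <= eta / 4.
  rewrite ltr_pdivlMr// in ef1.
  rewrite /al invf_div mulrA ler_pdivrMr//.
  have : 0 <= B * L * ef by rewrite mulr_ge0// ltW.
  lra.
have H2 s : eta <= s -> expR (- (al * s)) * M0 <= eta / 4.
  move=> es; have als : 0 < al * eta by rewrite mulr_gt0.
  have h1 : expR (- (al * s)) <= (al * eta)^-1.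
    rewrite expRN lef_pV2 ?posrE ?expR_gt0//.
    apply: (@le_trans _ _ (al * s)); first by rewrite ler_pM2l.
    by apply: le_trans (expR_ge1Dx _); rewrite lerDr.
  apply: (@le_trans _ _ ((al * eta)^-1 * M0)); first by rewrite ler_wpM2r// ltW.
  rewrite mulrC ler_pdivrMr// /al mulrA [leRHS](_ : _ = kf * eta ^+ 2 / 4 / ef); last first.
    by field; rewrite gt_eqF.
  rewrite ler_pdivlMr//.
  rewrite ltr_pdivlMr ?mulr_gt0// in ef2; lra.
have nB0 : 0 <= n%:R * B by rewrite mulr_ge0.
have nB1 : 0 < 8 * (2 * n%:R * B + 1) by lra.
exists (Num.min 1 (eta / (8 * (2 * n%:R * B + 1)))).
  by rewrite lt_min ltr01 divr_gt0.
move=> ea /andP[ea0]; rewrite lt_min => /andP[ea1 ea2].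
have H3 : 2 * n%:R * B * ea <= eta / 8.
  rewrite ltr_pdivlMr// in ea2; lra.
pose w := 2 / ea * (B * cK) + n%:R * (B * cK).
pose c := 2 / ea * (B * L * cK) + n%:R * (B * L * cK).
have ea' : 0 <= 2 / ea by rewrite divr_ge0// ltW.
have w0 : 0 <= w by rewrite addr_ge0 ?(mulr_ge0 ea') ?mulr_ge0.
have c0 : 0 <= c by rewrite addr_ge0 ?(mulr_ge0 ea') ?mulr_ge0.
have c1 : 0 < 8 * (c + 1) by lra.
have aw0 : 0 <= al * w by rewrite mulr_ge0// ltW.
have aw1 : 0 < al * w + 1 by lra.
have m0 : 0 < Num.min (eta / 8) 1 by rewrite lt_min ltr01 divr_gt0.
exists (Num.min (eta / (8 * (c + 1))) (Num.min (eta / 8) 1 / (al * w + 1))).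
  by rewrite lt_min !divr_gt0.
move=> ew /andP[ew0]; rewrite lt_min => /andP[ew1 ew2].
have H4 : ew * c <= eta / 8.
  rewrite ltr_pdivlMr// in ew1; lra.
have H5 : al * ew * w <= Num.min (eta / 8) 1.
  rewrite ltr_pdivlMr// in ew2; lra.
have H6 : al * ew * w <= eta / 8 by apply: le_trans H5 _; rewrite ge_min lexx.
have H7 : al * ew * w <= 1 by apply: le_trans H5 _; rewrite ge_min lexx orbT.
move=> a b u xi m ab fl t /andP[at_ tb].
apply: norm_le_coord => [|i]; first exact: ltW.
rewrite !mxE -/(grad J (u t)).
have tab : a <= t <= b by rewrite tb andbT; lra.
have := @coordinate_tracking kf ef ea ew rho L lam a b B u xi m i
  kf0 ef0 ea0 (ltW ea1) ew0 L0 B0 ab fl JB gB Jl gl t tab.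
rewrite -/cK -/al -/w -/c grad_coord.
move/le_trans; apply.
have ta : eta <= t - a by rewrite lerBrDl.
have H8 : expR (- (al * (t - a))) * (lam + B + al * ew * w) <= eta / 4.
  apply: le_trans (H2 _ ta).
  by rewrite ler_wpM2l ?expR_ge0// /M0 lerD2l.
lra.
Qed.

End Tracking.

(** * Closed-loop arcs on a finite horizon *)

Section Shift.
Context {R : realType}.
Notation mu := (@lebesgue_measure R).

(** Translation invariance: the image of Lebesgue measure under a shift agrees with it on half-open
    intervals, hence everywhere by uniqueness of the extension. *)
Lemma ae_shift (P : R -> Prop) (c : R) : {ae mu, forall t, P t} ->
  {ae mu, forall t, P (t + c)}.
Proof.
move=> [N [mN N0 PN]].
pose f (t : measurableTypeR R) : measurableTypeR R := t + c.
have mf : measurable_fun setT f.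
  by apply: measurable_funD; [exact: measurable_id|exact: measurable_cst].
pose nu : {measure set (measurableTypeR R) -> \bar R} := pushforward mu f.
have E A : measurable A -> mu A = nu mf A.
  apply: lebesgue_stieltjes_measure_unique => X /ocitvP[->|[[x y] /= xy ->]].
    by rewrite !measure0.
  rewrite /nu/= /pushforward.
  have -> : f @^-1` `]x, y]%classic = `]x - c, y - c]%classic.
    by apply/seteqP; split=> t /=; rewrite /f !in_itv/=; lra.
  rewrite -/(lebesgue_measure _) !lebesgue_measure_itv/= !lte_fin ltrD2r xy.
  by rewrite -!EFinB; congr EFin; lra.
exists (f @^-1` N); split.
- by rewrite -[X in measurable X]setTI; apply: (mf measurableT).
- by have := E N mN; rewrite N0 => /esym.
- by move=> t /= Pt; apply: PN.
Qed.

Lemma ae_witness (P : R -> Prop) (c d : R) : {ae mu, forall t, P t} -> c < d ->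
  exists2 t, c < t < d & P t.
Proof.
move=> [N [mN N0 PN]] cd; apply: contrapT => H.
have sub : `]c, d[%classic `<=` N.
  move=> t /=; rewrite in_itv/= => tcd; apply: PN => /= Pt; apply: H; by exists t.
have : (mu `]c, d[%classic <= mu N)%E.
  by apply: le_measure; rewrite ?inE//; exact: measurable_itv.
rewrite N0 lebesgue_measure_itv/= lte_fin cd -EFinB lee_fin; lra.
Qed.

End Shift.

Section AbsContinuous.
Context {R : realType}.
Notation mu := (@lebesgue_measure R).

Lemma chain_nth (s b : R) (l : seq (R * R)) : chain s l b ->
  (forall k, (k < size l)%N -> [/\ s <= (nth (0, 0) l k).1,
     (nth (0, 0) l k).1 <= (nth (0, 0) l k).2 & (nth (0, 0) l k).2 <= b]) /\
  (forall k k', (k < k')%N -> (k' < size l)%N ->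
     (nth (0, 0) l k).2 <= (nth (0, 0) l k').1).
Proof.
elim: l s => [|i l IH] s //= [si ii ch].
have [H1 H2] := IH _ ch; have cl := chain_le ch; split.
  move=> [|k] /= kl; first by split.
  by have [? ? ?] := H1 k kl; split => //; lra.
move=> [|k] [|k'] //= kk' kl; last exact: H2.
by have [? ? ?] := H1 k' kl.
Qed.

(** The nonexpansive map [h] lets one statement serve for the whole state and for each of its
    blocks. *)
Lemma abs_continuous_ac p q (f : R -> 'rV[R]_p) (h : 'rV[R]_p -> 'rV[R]_q) a b :
  (forall u v, `|h u - h v| <= `|u - v|) ->
  abs_continuous f a b -> ac_on (h \o f) a b.
Proof.
move=> hl fac e /fac[d d0 Hd]; exists d => // l cl ld.
have [H1 H2] := chain_nth cl.
apply: le_lt_trans (Hd (size l) (fun k => (nth (0, 0) l k).1)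
  (fun k => (nth (0, 0) l k).2) _ _ _).
- rewrite (big_nth (0, 0)) big_mkord; apply: ler_sum => k _ /=.
  by apply: le_trans (hl _ _) _; exact: norm_le_enorm.
- by move=> k; have [? ? ?] := H1 k (ltn_ord k).
- move=> i j _ _ [x []] /=; rewrite !in_itv/= => /andP[x1 x2] /andP[x3 x4].
  apply/val_inj; case: (ltngtP i j) => // ij.
    by have := lt_trans (lt_le_trans x2 (H2 _ _ ij (ltn_ord j))) x3; rewrite ltxx.
  by have := lt_trans (lt_le_trans x4 (H2 _ _ ij (ltn_ord i))) x1; rewrite ltxx.
- by move: ld; rewrite (big_nth (0, 0)) big_mkord.
Qed.

Lemma abs_continuous_sub p (f : R -> 'rV[R]_p) a b s t : a <= s -> t <= b ->
  abs_continuous f a b -> abs_continuous f s t.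
Proof.
move=> as_ tb fac e /fac[d d0 Hd]; exists d => // N u v Huv; apply: Hd => k.
by have [? [? ?]] := Huv k; lra.
Qed.

Lemma abs_continuous_shift p (f : R -> 'rV[R]_p) a b c :
  abs_continuous f (a + c) (b + c) -> abs_continuous (fun t => f (t + c)) a b.
Proof.
move=> fac e /fac[d d0 Hd]; exists d => // N u v Huv tr ud.
apply: (Hd N (fun k => u k + c) (fun k => v k + c)).
- by move=> k; have [? [? ?]] := Huv k; lra.
- move=> i j _ _ [x [/= x1 x2]]; apply: tr => //; exists (x - c).
  move: x1 x2; rewrite !in_itv/= => /andP[? ?] /andP[? ?].
  by split => /=; rewrite in_itv/=; apply/andP; split; lra.
- apply: le_lt_trans ud; apply: ler_sum => k _; lra.
Qed.

Lemma ac_dist (V : normedModType R) (f : R -> V) a b e : ac_on f a b -> 0 < e ->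
  exists2 d, 0 < d & forall s t, a <= s <= b -> a <= t <= b -> `|s - t| < d ->
    `|f s - f t| < e.
Proof.
move=> /[apply] -[d d0 Hd]; exists d => //.
have H s t : a <= s -> s <= t -> t <= b -> t - s < d -> `|f t - f s| < e.
  move=> as_ st tb std; have := Hd [:: (s, t)]; rewrite !big_seq1/=; exact.
move=> s t /andP[? ?] /andP[? ?]; have [st|ts] := leP s t.
  by rewrite (distrC s) (distrC (f s)) ger0_norm ?subr_ge0// => ?; exact: H.
rewrite gtr0_norm ?subr_gt0// => ?; apply: H => //; exact: ltW.
Qed.

(** Solutions satisfy the flow constraint only almost everywhere. Every neighbourhood of a time
    contains a good time, so continuity and closedness give the constraint at all times, both ends
    included. *)
Lemma ac_closed_ae (V : normedModType R) (f : R -> V) a b (S : set V) : a < b ->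
  ac_on f a b -> closed S -> {ae mu, forall t, a < t < b -> S (f t)} ->
  forall t, a <= t <= b -> S (f t).
Proof.
move=> ab acf cS aS t tab; apply: contrapT => nS.
have oS : open (~` S) by exact: closed_openC.
have := open_nbhs_nbhs (conj oS nS : open_nbhs (f t) (~` S)).
move=> /nbhs_ballP[e /= e0 He].
have [d d0 Hd] := ac_dist acf e0.
pose c1 := Num.max a (t - d); pose c2 := Num.min b (t + d).
have c12 : c1 < c2 by rewrite /c1 /c2 gt_max !lt_min; case/andP: tab => ? ?; lra.
have [s /andP[cs sc] Ss] := ae_witness aS c12.
move: cs sc; rewrite gt_max lt_min => /andP[as_ ts] /andP[sb st].
apply: (He (f s)); last by apply: Ss; rewrite as_.
rewrite -ball_normE /ball_/=; apply: Hd => //; first by rewrite !ltW.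
by rewrite ltr_norml; lra.
Qed.

End AbsContinuous.

Section Selections.
Context {R : realType}.

Lemma lip_continuous (V W : normedModType R) (h : V -> W) K :
  (forall u v, `|h u - h v| <= K * `|u - v|) -> continuous h.
Proof.
move=> hK u; apply/cvgrPdist_lt => e e0.
have K0 : 0 < `|K| + 1 by rewrite ltr_wpDl.
near=> v.
have uv : `|u - v| < e / (`|K| + 1).
  by near: v; apply: cvgr_dist_lt; rewrite ?divr_gt0.
rewrite ltr_pdivlMr// mulrC in uv; apply: le_lt_trans (hK _ _) _.
by apply: le_lt_trans uv; rewrite ler_wpM2r// (le_trans (ler_norm K))// lerDl.
Unshelve. all: by end_near. Qed.

Section selection.
Variables (p q : nat) (s : 'I_q -> 'I_p) (h : 'rV[R]_p -> 'rV[R]_q).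
Hypothesis hE : forall u i, h u ord0 i = u ord0 (s i).

Lemma selection_le u v : `|h u - h v| <= `|u - v|.
Proof.
apply: norm_le_coord => // i; rewrite !mxE !hE.
by apply: le_trans (coord_le_norm _ (s i)); rewrite !mxE.
Qed.

Lemma selection_norm u : `|h u| <= `|u|.
Proof. by apply: norm_le_coord => // i; rewrite hE coord_le_norm. Qed.

Lemma selection_continuous : continuous h.
Proof. by apply: (@lip_continuous _ _ h 1) => u v; rewrite mul1r selection_le. Qed.

Lemma selection_derive (f : R -> 'rV[R]_p) t : derivable f t 1 ->
  derivable (h \o f) t 1 /\ derive1 (h \o f) t = h (derive1 f t).
Proof.
move=> df; have dhf : derivable (h \o f) t 1.
  apply/derivable_mxP => i j; rewrite ord1.
  have -> : (fun x => (h \o f) x ord0 j) = (fun x => f x ord0 (s j)).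
    by apply/funext => x; rewrite /= hE.
  by move/derivable_mxP: df; exact.
split => //; rewrite !derive1E derive_mx//; apply/rowP => j.
rewrite mxE hE derive_mx// mxE; congr ('D_1 _ t).
by apply/funext => x; rewrite /= hE.
Qed.

End selection.

Lemma enorm_continuous p : continuous (@enorm R p).
Proof.
apply: (@lip_continuous _ _ (@enorm R p) p%:R) => u v.
apply: le_trans (enorm_le_norm _).
have H1 := enormB u v; have H2 := enormB v u.
rewrite -(enormN (v - u)) opprB in H2.
rewrite ler_norml; lra.
Qed.

Lemma closed_eball p (l : R) : closed (@eball R p l).
Proof.
apply: (@closed_comp _ _ _ [set x : R | x <= l]) => [x _|].
  exact: enorm_continuous.
exact: closed_le.
Qed.

Lemma closed_torus n : closed (@torus R n).
Proof.
have -> : @torus R n = \bigcap_(i in [set: 'I_n])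
    [set m | enorm (\row_(a < 2) m ord0 (pair_idx i a)) = 1].
  by apply/seteqP; split=> [m Hm i _|m Hm i]; [exact: Hm|exact: (Hm i I)].
apply: closed_bigI => i _.
apply: (@closed_comp _ _ (fun m : 'rV[R]_n.*2 =>
  enorm (\row_(a < 2) m ord0 (pair_idx i a))) [set 1]) => [m _|].
  apply: (@continuous_comp _ _ _ (fun m : 'rV[R]_n.*2 =>
    \row_(a < 2) m ord0 (pair_idx i a))); last exact: enorm_continuous.
  by apply: (@selection_continuous _ _ (pair_idx i)) => u a; rewrite mxE.
exact: closed_eq.
Qed.

Lemma closed_rVprod p q (A : set 'rV[R]_p) (B : set 'rV[R]_q) :
  closed A -> closed B -> closed (rVprod A B).
Proof.
move=> cA cB; apply: closedI.
  apply: (@closed_comp _ _ (fun x : 'rV[R]_(p + q) => lsubmx x) A) => // x _.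
  by apply: (@selection_continuous _ _ (lshift q)) => u i; rewrite mxE.
apply: (@closed_comp _ _ (fun x : 'rV[R]_(p + q) => rsubmx x) B) => // x _.
by apply: (@selection_continuous _ _ (@rshift p q)) => u i; rewrite mxE.
Qed.

End Selections.

(** * From closed-loop arcs in a ball to perturbed nominal arcs *)

Section ModelArcs.
Context {R : realType} (n r : nat).
Notation mu := (@lebesgue_measure R).
Variables (J : 'rV[R]_n -> R) (C D : set 'rV[R]_(n + r)).
Variables (F : R -> 'rV[R]_(n + r) -> 'rV[R]_n -> set 'rV[R]_(n + r)).
Variables (G : R -> 'rV[R]_(n + r) -> set 'rV[R]_(n + r)).
Variables (kappa : 'I_n -> rat) (kf lam delta ef ea ew : R).
Hypotheses (JC2 : C2 J) (cC : closed C) (kappa_gt0 : forall i, 0 < kappa i).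
Hypotheses (kf0 : 0 < kf) (lam0 : 0 < lam) (ef0 : 0 < ef) (ea0 : 0 < ea)
  (ew0 : 0 < ew).
Let H := model_free_system J C D F G kappa kf lam delta ef ea ew.
Notation state := ('rV[R]_((n + r) + (n + n.*2))).
Let kap i : R := ratr (kappa i).

(** A solution of the closed loop on one compact hybrid time domain, translated
    to start at time [0], with the jump counter as first argument of [y]. *)
Definition model_arc (N : nat) (tau : nat -> R) (y : nat -> R -> state) :=
  [/\ tau 0%N = 0, forall j, (j <= N)%N -> tau j <= tau j.+1,
      (C `|` D) (lsubmx (y 0%N 0)),
      forall j, (j < N)%N -> jump_set H (y j (tau j.+1)) /\
        jump_map H (y j (tau j.+1)) (y j.+1 (tau j.+1))
    & forall j, (j <= N)%N -> tau j < tau j.+1 ->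
      abs_continuous (y j) (tau j) (tau j.+1) /\
      {ae mu, forall t, tau j < t < tau j.+1 ->
        [/\ flow_set H (y j t), derivable (y j) t 1
          & flow_map H (y j t) (derive1 (y j) t)]}].

Lemma closed_flow_set : closed (flow_set H).
Proof.
apply: closed_rVprod => //; apply: closed_rVprod; first exact: closed_eball.
exact: closed_torus.
Qed.

Lemma lip_on_of_derive (V : normedModType R) (f : R -> V) (L a b : R) :
  0 <= L -> ac_on f a b ->
  {ae mu, forall t, a < t < b -> derivable f t 1 /\ `|derive1 f t| <= L} ->
  lip_on L f a b.
Proof.
move=> L0 acf fL s t as_ st tb; apply: lip_of_derive => //.
  exact: ac_sub acf.
apply: aeS fL => u Hu /andP[su ut]; apply: Hu.
by rewrite (le_lt_trans as_ su) (lt_le_trans ut tb).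
Qed.

Let selX (u : state) i : lsubmx u ord0 i = u ord0 (lshift (n + n.*2) i).
Proof. by rewrite mxE. Qed.
Let selU (u : state) i :
  lsubmx (lsubmx u) ord0 i = u ord0 (lshift (n + n.*2) (lshift r i)).
Proof. by rewrite !mxE. Qed.
Let selXi (u : state) i :
  lsubmx (rsubmx u) ord0 i = u ord0 (rshift (n + r) (lshift n.*2 i)).
Proof. by rewrite !mxE. Qed.
Let selM (u : state) i :
  rsubmx (rsubmx u) ord0 i = u ord0 (rshift (n + r) (rshift n i)).
Proof. by rewrite !mxE. Qed.

Let phase_speed : R := \sum_(i < n) kap i / ew * 2.

Let kap0 i : 0 < kap i. Proof. by rewrite ltr0q. Qed.

Lemma Phi_bound (m : 'rV[R]_n.*2) : torus m ->
  `|m *m (Phi (fun i => kap i / ew))^T| <= phase_speed.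
Proof.
move=> tm; have ps0 i : 0 <= kap i / ew * 2.
  by rewrite mulr_ge0// divr_ge0// ltW.
apply: norm_le_coord => [|k]; first by apply: sumr_ge0.
rewrite -(pair_idx_of k) Phi_coord; set i := pair_of k; set a := entry_of k.
apply: (@le_trans _ _ (kap i / ew * 2)); last first.
  by rewrite /phase_speed (bigD1 i)//= lerDl sumr_ge0.
have [P1 Q1] := torus_le1 i tm; have [R1 R2 R3 R4] := @Rot_entries R.
have ke : 0 < kap i / ew by rewrite divr_gt0.
rewrite normrM (gtr0_norm ke) ler_wpM2l ?(ltW ke)//.
apply: le_trans (ler_normD _ _) _.
have [->|->] := ord2P a; rewrite ?R1 ?R2 ?R3 ?R4 !mulr0 ?mulr1 ?mulrN1 ?normrN
  normr0; lra.
Qed.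

Section near.
Variables (rho L eta : R).
Hypotheses (L0 : 0 <= L) (eta0 : 0 < eta).
Hypothesis FL : forall x xi v, C x -> `|x| <= rho -> `|xi| <= lam ->
  F delta x xi v -> `|v| <= L.
Hypothesis trackH : forall a b u xi m, a < b ->
  dither_flow J kap kf ef ea ew rho L lam a b u xi m ->
  forall t, a + eta <= t <= b -> `|xi t - grad J (u t)| <= eta.

(** The a priori ball bounds the velocity of [x_uz] by [L], which makes [u] slow and so meets the
    hypotheses of the tracking estimate on each nondegenerate flow interval. *)
Lemma model_arc_near N tau y : model_arc N tau y ->
  (forall j t, (j <= N)%N -> tau j <= t <= tau j.+1 -> `|lsubmx (y j t)| <= rho) ->
  near_arc J C D F G delta rho L eta N tau (fun j t => lsubmx (y j t))
    (fun j t => lsubmx (rsubmx (y j t))).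
Proof.
move=> [t0 tS CD0 jmp flw] ball; split => //.
  by move=> j /jmp[[Dy _] [Gy _]].
move=> j jN; have := tS j jN; rewrite le_eqVlt => /orP[/eqP tE|tlt].
  split.
  - by move=> t; exact: ball.
  - move=> s t s1 st t1; have -> : s = t by lra.
    by rewrite !subrr normr0 mulr0.
  - by move=> t; rewrite tE; lra.
  - move=> t; rewrite -tE => /andP[? ?].
    have e0 := eta0; lra.
  - by apply: aeW => t; rewrite tE; lra.
have [acy fly] := flw j jN tlt.
have acid : ac_on (y j) (tau j) (tau j.+1).
  by have := abs_continuous_ac (h := id) (fun u v => lexx _) acy.
have acX : ac_on (fun t => lsubmx (y j t)) (tau j) (tau j.+1).
  exact: (abs_continuous_ac (selection_le selX) acy).
have acXi : ac_on (fun t => lsubmx (rsubmx (y j t))) (tau j) (tau j.+1).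
  exact: (abs_continuous_ac (h := fun u => lsubmx (rsubmx u)) (selection_le selXi) acy).
have acM : ac_on (fun t => rsubmx (rsubmx (y j t))) (tau j) (tau j.+1).
  exact: (abs_continuous_ac (h := fun u => rsubmx (rsubmx u)) (selection_le selM) acy).
have inflow t : tau j <= t <= tau j.+1 -> flow_set H (y j t).
  apply: (ac_closed_ae tlt acid closed_flow_set).
  by apply: aeS fly => s Hs /Hs[].
have xlip : lip_on L (fun t => lsubmx (y j t)) (tau j) (tau j.+1).
  apply: lip_on_of_derive => //; apply: aeS fly => t Ht tI.
  have [[Cx [xil _]] dy [Fy _ _]] := Ht tI.
  have [dX ->] := selection_derive selX dy; split => //.
  apply: FL Fy => //; first by apply: ball => //; case/andP: tI => ? ?; rewrite !ltW.
  exact: le_trans (norm_le_enorm _) xil.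
split => //.
- by move=> t; exact: ball.
- by move=> t tI; have [] := inflow t; first by case/andP: tI => ? ?; rewrite !ltW.
- move=> t /andP[t1 t2].
  have [BJ BJ0 HBJ] := continuous_bounded_ball (rho + ea)
    (fun u => differentiable_continuous ((let: And3 d _ _ := JC2 in d) u)).
  apply: (@trackH _ _ (fun t => lsubmx (lsubmx (y j t)))
    (fun t => lsubmx (rsubmx (y j t))) (fun t => rsubmx (rsubmx (y j t))) tlt);
    last by rewrite !ltW.
  have fast t' : tau j <= t' <= tau j.+1 ->
      [/\ `|lsubmx (lsubmx (y j t'))| <= rho, `|lsubmx (rsubmx (y j t'))| <= lam
        & torus (rsubmx (rsubmx (y j t')))].
    move=> tI; have [_ [xil mt]] := inflow t' tI; split => //.
      apply: le_trans (ball j t' jN tI).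
      by apply: (@selection_norm _ _ _ (lshift r)) => u i; rewrite mxE.
    exact: le_trans (norm_le_enorm _) xil.
  have p1 t' : tau j <= t' <= tau j.+1 ->
      `|rsubmx (rsubmx (y j t')) *m (Dmx n)^T| <= 1.
    move=> /fast[_ _ mt]; apply: norm_le_coord => // i; rewrite Dmx_coord.
    by case: (torus_le1 i mt).
  split.
  + move=> s u s1 su u1; apply: le_trans (xlip s u s1 su u1).
    by apply: (@selection_le _ _ _ (lshift r)) => v i; rewrite mxE.
  + exists (kf / ef * (lam + 2 / ea * BJ)).
    have a0 : 0 <= kf / ef by rewrite divr_ge0// ltW.
    have b0 : 0 <= 2 / ea by rewrite divr_ge0// ltW.
    apply: lip_on_of_derive => //.
      by rewrite mulr_ge0// addr_ge0 ?(ltW lam0)// mulr_ge0.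
    apply: aeS fly => s Hs sI; have [_ dy [_ Exi _]] := Hs sI.
    have sI' : tau j <= s <= tau j.+1 by case/andP: sI => ? ?; rewrite !ltW.
    have [us xis ms] := fast s sI'.
    have [dXi ->] := selection_derive (h := fun u => lsubmx (rsubmx u)) selXi dy.
    split => //; rewrite Exi normrZ normrN ger0_norm// ler_wpM2l//.
    apply: le_trans (ler_normB _ _) _; apply: lerD => //.
    rewrite normrZ; apply: (@le_trans _ _ (2 / ea * BJ * 1)); last by rewrite mulr1.
    apply: ler_pM => //; last exact: p1.
    rewrite normrM ger0_norm// ler_wpM2l//; apply: HBJ.
    apply: le_trans (ler_normD _ _) _; apply: lerD => //.
    by rewrite normrZ gtr0_norm// ler_piMr ?p1// ltW.
  + exists phase_speed; apply: lip_on_of_derive => //.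
      apply: sumr_ge0 => i _; rewrite mulr_ge0// divr_ge0// ltW//.
    apply: aeS fly => s Hs sI; have [_ dy [_ _ Em]] := Hs sI.
    have sI' : tau j <= s <= tau j.+1 by case/andP: sI => ? ?; rewrite !ltW.
    have [us xis ms] := fast s sI'.
    have [dM ->] := selection_derive (h := fun u => rsubmx (rsubmx u)) selM dy.
    by split => //; rewrite Em; exact: Phi_bound.
  + exact: fast.
  + apply: aeS fly => s Hs sI; have [_ dy [_ Exi Em]] := Hs sI.
    have [dU _] := selection_derive (h := fun u => lsubmx (lsubmx u)) selU dy.
    have [dXi EXi] := selection_derive (h := fun u => lsubmx (rsubmx u)) selXi dy.
    have [dM EM] := selection_derive (h := fun u => rsubmx (rsubmx u)) selM dy.
    split; [exact: dU|exact: dXi|exact: dM|exact: etrans EXi Exi|].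
    exact: etrans EM Em.
- apply: aeS fly => t Ht /Ht[_ dy [Fy _ _]].
  by have [dX ->] := selection_derive selX dy.
Qed.

End near.
End ModelArcs.

Section FirstExit.
Context {R : realType}.

(** Continuity is assumed only for [a < b], since arcs carry no regularity on degenerate intervals;
    there the single point is the answer. *)
Lemma first_exit (V : normedModType R) (f : R -> V) (a b rho t0 : R) :
  (a < b -> ac_on f a b) -> a <= t0 <= b -> rho <= `|f t0| ->
  exists s, [/\ a <= s <= b, rho <= `|f s| & forall t, a <= t < s -> `|f t| < rho].
Proof.
move=> acf t0ab ft0.
have [ab|ba] := ltP a b; last first.
  by exists t0; split => // t tt; lra.
pose S := [set t | a <= t <= b /\ rho <= `|f t|].
have St0 : S t0 by [].
have S0 : S !=set0 by exists t0.
have Slb : has_lbound S by exists a => t [/andP[]].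
have s1 : a <= inf S by apply: lb_le_inf => // t [/andP[]].
have s2 : inf S <= t0 by exact: ge_inf.
have sab : a <= inf S <= b by lra.
exists (inf S); split => //; last first.
  move=> t /andP[at_ ts]; rewrite ltNge; apply/negP => rt.
  have : inf S <= t by apply: ge_inf => //; split => //; lra.
  by rewrite leNgt ts.
rewrite leNgt; apply/negP => fs.
have e0 : 0 < rho - `|f (inf S)| by rewrite subr_gt0.
have [d d0 Hd] := ac_dist (acf ab) e0.
have [u [uab fu] us] : exists2 u, S u & u < inf S + d.
  by apply: inf_adherent.
have su : inf S <= u by exact: ge_inf.
have := Hd _ _ uab sab; rewrite ger0_norm ?subr_ge0// => /(_ ltac:(lra)).
have : `|f u| <= `|f u - f (inf S)| + `|f (inf S)|.
  by rewrite -{1}(subrK (f (inf S)) (f u)) ler_normD.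
lra.
Qed.

Lemma norm_le_left_limit (V : normedModType R) (f : R -> V) (a b rho : R) :
  a < b -> ac_on f a b -> (forall t, a <= t < b -> `|f t| <= rho) -> `|f b| <= rho.
Proof.
move=> ab acf H; rewrite leNgt; apply/negP => fb.
have e0 : 0 < `|f b| - rho by rewrite subr_gt0.
have [d d0 Hd] := ac_dist acf e0.
pose s := Num.max a (b - d / 2).
have [sa sb] : a <= s < b /\ b - d < s.
  by split; rewrite /s ?le_max ?gt_max ?lt_max; lra.
have sb' : a <= s <= b by lra.
have bb : a <= b <= b by lra.
have := Hd _ _ bb sb'; rewrite ger0_norm; last lra.
move=> /(_ ltac:(lra)).
have : `|f b| <= `|f b - f s| + `|f s|.
  by rewrite -{1}(subrK (f s) (f b)) ler_normD.
have := H s sa; lra.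
Qed.

End FirstExit.

(** * Removal of the a priori ball on a finite horizon *)

Section FiniteHorizon.
Context {R : realType} (n r : nat).
Notation mu := (@lebesgue_measure R).
Variables (J : 'rV[R]_n -> R) (C D : set 'rV[R]_(n + r)).
Variables (F : R -> 'rV[R]_(n + r) -> 'rV[R]_n -> set 'rV[R]_(n + r)).
Variables (G : R -> 'rV[R]_(n + r) -> set 'rV[R]_(n + r)).
Variables (kappa : 'I_n -> rat) (kf lam delta : R).
Notation model_arc ef ea ew :=
  (model_arc J C D F G kappa kf lam delta ef ea ew).
Notation state := ('rV[R]_((n + r) + (n + n.*2))).

Lemma lsubmx_ac (y : R -> state) a b : abs_continuous y a b ->
  ac_on (fun t => lsubmx (y t)) a b.
Proof.
apply: (abs_continuous_ac (h := fun u : state => lsubmx u)).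
by apply: (@selection_le _ _ _ (lshift (n + n.*2))) => u i; rewrite mxE.
Qed.

(** The first exit in hybrid time is found in two stages: the least jump index at which an exit
    occurs, then the first exit time on that flow interval. *)
Lemma model_arc_truncate ef ea ew N tau (y : nat -> R -> state) rho :
  model_arc ef ea ew N tau y ->
  (exists j t, [/\ (j <= N)%N, tau j <= t <= tau j.+1 & rho <= `|lsubmx (y j t)|]) ->
  exists N' tau', [/\ model_arc ef ea ew N' tau' y, (N' <= N)%N,
    tau' N'.+1 <= tau N.+1, rho <= `|lsubmx (y N' (tau' N'.+1))|
    & forall j t, (j <= N')%N -> tau' j <= t <= tau' j.+1 ->
        (j < N')%N || (t < tau' N'.+1) -> `|lsubmx (y j t)| < rho].
Proof.
move=> arc [j0 [t0 [j0N t0I ft0]]]; have [tau0 tauS CD0 jmp flw] := arc.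
pose P j := `[< (j <= N)%N /\ exists2 t, tau j <= t <= tau j.+1 &
  rho <= `|lsubmx (y j t)| >].
have exP : exists j, P j by exists j0; apply/asboolP; split => //; exists t0.
case: (ex_minnP exP) => k /asboolP[kN [t tI ft]] kmin.
have acy : tau k < tau k.+1 -> ac_on (fun t => lsubmx (y k t)) (tau k) (tau k.+1).
  by move=> /(flw k kN)[acy _]; exact: lsubmx_ac.
have [s [sI fs sfirst]] := first_exit acy tI ft.
have tl := tau_le tauS.
exists k, (fun i => if (i <= k)%N then tau i else s); rewrite ltnn.
have sle : s <= tau N.+1 by case/andP: sI => _ /le_trans; apply; exact: tl.
split => //.
- split => //.
  + move=> j jk; rewrite jk ltn_neqAle; case: eqVneq => [->|jk'] /=.
      by case/andP: sI.
    by rewrite jk; apply: tauS; exact: leq_trans kN.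
  + by move=> j jk; rewrite jk; apply: jmp; exact: leq_trans kN.
  + move=> j jk; have jN := leq_trans jk kN.
    rewrite jk ltn_neqAle; case: eqVneq => [->|jk'] /=; last first.
      by rewrite jk; exact: flw.
    case/andP: sI => s1 s2 tks; have [acyk fly] := flw k kN (lt_le_trans tks s2).
    split; first exact: abs_continuous_sub acyk.
    by apply: aeS fly => u Hu /andP[u1 u2]; apply: Hu; rewrite u1 (lt_le_trans u2).
- move=> j u jk; rewrite jk; case: ltngtP jk => // [jk _|-> _] uI /= ulast.
    rewrite ltNge; apply/negP => fu.
    have : P j.
      by apply/asboolP; split; [exact: leq_trans (ltnW jk) kN|exists u].
    by move=> /kmin; rewrite leqNgt jk.
  by apply: sfirst; case/andP: uI => ->.
Qed.

(** The end point is reached by flowing, and then continuity keeps it within [rho]; or it is the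
    initial point; or it is the result of a jump from inside the ball. The three cases give the
    three terms of the maximum. *)
Lemma model_arc_end_bound ef ea ew N tau (y : nat -> R -> state) rho B0 BG :
  model_arc ef ea ew N tau y ->
  (forall j t, (j <= N)%N -> tau j <= t <= tau j.+1 ->
    (j < N)%N || (t < tau N.+1) -> `|lsubmx (y j t)| < rho) ->
  `|lsubmx (y 0%N 0)| <= B0 ->
  (forall x v, D x -> `|x| <= rho -> G delta x v -> `|v| <= BG) ->
  `|lsubmx (y N (tau N.+1))| <= Num.max rho (Num.max B0 BG).
Proof.
move=> [tau0 tauS CD0 jmp flw] ball y0 GB; rewrite !le_max.
have := tauS N (leqnn N); rewrite le_eqVlt => /orP[/eqP tE|tlt]; last first.
  rewrite (@norm_le_left_limit _ _ (fun t => lsubmx (y N t)) (tau N))//.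
    by apply: lsubmx_ac; case: (flw N (leqnn N) tlt).
  move=> t /andP[t1 t2]; apply/ltW/ball => //; first by rewrite t1 ltW.
  by rewrite t2 orbT.
case: N tauS jmp flw ball tE => [|k] tauS jmp flw ball tE.
  by rewrite -tE tau0 y0 orbT.
have [[/= Dy _] [/= Gy _]] := jmp k (ltnSn k).
rewrite -tE (GB _ _ Dy _ Gy) ?orbT//; apply/ltW/ball => //.
  by rewrite lexx andbT; exact: tauS.
by rewrite ltnSn.
Qed.

Lemma near_arc_weaken rho L eta eta' N tau x xi : eta <= eta' ->
  near_arc J C D F G delta rho L eta N tau x xi ->
  near_arc J C D F G delta rho L eta' N tau x xi.
Proof.
move=> ee [tau0 tauS CD0 jmp flw]; split => // j jN.
have [? ? ? Hxi ?] := flw j jN; split => // t /andP[t1 t2].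
apply: le_trans (ee); apply: Hxi; rewrite t2 andbT; apply: le_lt_trans t1; lra.
Qed.

Hypotheses (JC2 : C2 J) (cC : closed C) (cD : closed D).
Let K := C `*` [set: 'rV[R]_n].
Let M (z : 'rV[R]_(n + r) * 'rV[R]_n) := F delta z.1 z.2.
Hypotheses (oM : osc_on M K) (bM : locally_bounded_on M K)
  (neM : nonempty_valued_on M K) (cM : convex_valued_on M K).
Hypotheses (oG : osc_on (G delta) D) (bG : locally_bounded_on (G delta) D).
Hypotheses (kappa_gt0 : forall i, 0 < kappa i) (kappaI : injective kappa).
Hypotheses (kf0 : 0 < kf) (lam0 : 0 < lam).
Variables (A : set 'rV[R]_(n + r)) (beta : R -> R -> R) (Delta nu MA : R).
Hypotheses (A0 : A !=set0) (beta_KL : class_KL beta) (nu0 : 0 < nu).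
Hypothesis AM : forall a, A a -> enorm a <= MA.
Hypothesis nominal : forall E x,
  maximal_solution (nominal_system J C D F G delta) E x ->
  enorm (x 0 0%N) <= Delta -> forall t j, E (t, j) ->
  dist (x t j) A <= beta (dist (x 0 0%N) A) (t + j%:R) + nu.

Let closed_normball p (rho : R) : closed [set x : 'rV[R]_p | `|x| <= rho].
Proof.
by apply: (@closed_comp _ _ _ [set x : R | x <= rho]) => [x _|];
  [exact: norm_continuous|exact: closed_le].
Qed.

Let compact_normball p (rho : R) : compact [set x : 'rV[R]_p | `|x| <= rho].
Proof.
apply: bounded_closed_compact; last exact: closed_normball.
by exists rho; split; [exact: num_real|move=> B rB x /= /le_trans -> //; exact: ltW].
Qed.

Lemma enorm_le_dist x : enorm x <= dist x A + MA.
Proof.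
rewrite -lerBlDr; apply: le_dist => // a Aa.
have := AM Aa; have := enormB x a; lra.
Qed.

Lemma dist_le_enorm x : dist x A <= enorm x + MA.
Proof.
have [a Aa] := A0; apply: le_trans (dist_le x Aa) _.
by have := enormD x (- a); rewrite enormN; have := AM Aa; lra.
Qed.

Lemma finite_horizon (Tn : nat) :
  exists2 efs, 0 < efs & forall ef, 0 < ef < efs ->
  exists2 eas, 0 < eas & forall ea, 0 < ea < eas ->
  exists2 ews, 0 < ews & forall ew, 0 < ew < ews ->
  forall N tau y, model_arc ef ea ew N tau y -> tau N.+1 + N%:R <= Tn%:R ->
    enorm (lsubmx (y 0%N 0)) <= Delta ->
    dist (lsubmx (y N (tau N.+1))) A <=
      slack_KL beta (dist (lsubmx (y 0%N 0)) A) (tau N.+1 + N%:R) + 2 * nu.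
Proof.
(* [b0] bounds [slack_KL beta] for every admissible start. The last [1] in [rho] makes an exit
   contradictory: at the exit point the norm is at most the distance to [A] plus [MA], so at most
   [b0 + 2 * nu + MA]. *)
pose b0 := beta (2 * (Delta + MA)) 0.
pose rho := b0 + 2 * nu + MA + 1.
have [BG BG0 GB] : exists2 B, 0 <= B & forall x v, D x -> `|x| <= rho ->
    G delta x v -> `|v| <= B.
  have cQ : compact (D `&` [set x | `|x| <= rho]).
    apply: (subclosed_compact _ (@compact_normball _ rho)); last exact: subIsetr.
    by apply: closedI => //; exact: closed_normball.
  have [B B0 HB] := locally_bounded_compact bG cQ (@subIsetl _ _ _).
  by exists B => // x v Dx xr; apply: HB.
pose rho' := Num.max rho (Num.max Delta BG).
have [L L0 FL] : exists2 L, 0 <= L & forall x xi v, C x -> `|x| <= rho' ->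
    `|xi| <= lam -> F delta x xi v -> `|v| <= L.
  have cQ : compact ((C `&` [set x | `|x| <= rho']) `*` [set x : 'rV[R]_n | `|x| <= lam]).
    apply: compact_setX; last exact: compact_normball.
    apply: (subclosed_compact _ (@compact_normball _ rho')); last exact: subIsetr.
    by apply: closedI => //; exact: closed_normball.
  have [|B B0 HB] := locally_bounded_compact bM cQ.
    by move=> [x xi] [[? _] _].
  by exists B => // x xi v Cx xr xil; apply: (HB (x, xi)).
have gJ : continuous (grad J).
  by case: JC2 => _ dg _ u; exact: differentiable_continuous.
have Hnear N := near_arc_bound gJ cC cD oM bM neM cM oG A0 beta_KL nu0 nominal
  rho' Tn%:R N L0.
(* The compactness argument fixes the number of jumps; on a bounded horizon finitely many values of
   [N] occur, and the least [eta] serves them all. *)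
have [eta eta0 Heta] : exists2 eta, 0 < eta & forall N, (N <= Tn)%N ->
    forall tau x xi,
    near_arc J C D F G delta rho' L eta N tau x xi -> tau N.+1 <= Tn%:R ->
    enorm (x 0%N 0) <= Delta -> dist (x N (tau N.+1)) A <=
      slack_KL beta (dist (x 0%N 0) A) (tau N.+1 + N%:R) + 2 * nu.
  elim: {-2}Tn => [|k [eta eta0 IH]].
    have [eta eta0 H] := Hnear 0%N.
    by exists eta => // N; rewrite leqn0 => /eqP ->; exact: H.
  have [eta' eta'0 H] := Hnear k.+1.
  exists (Num.min eta eta'); first by rewrite lt_min eta0.
  move=> N; rewrite leq_eqVlt => /orP[/eqP ->|Nk] tau x xi narc.
    by apply: H; apply: near_arc_weaken narc; rewrite ge_min lexx orbT.
  by apply: (IH N); last (apply: near_arc_weaken narc; rewrite ge_min lexx).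
have kap0 i : 0 < ratr (kappa i) :> R by rewrite ltr0q.
have kapI : injective (fun i => ratr (kappa i) : R).
  by move=> i j /fmorph_inj/kappaI.
have [efs efs0 Hef] := tracking JC2 kap0 kapI rho' kf0 L0 (ltW lam0) eta0.
exists efs => // ef efI; have [eas eas0 Hea] := Hef ef efI.
exists eas => // ea eaI; have [ews ews0 Hew] := Hea ea eaI.
exists ews => // ew ewI N tau y arc tauT y0.
have [[ef0 _] [ea0 _] [ew0 _]] : [/\ 0 < ef /\ True, 0 < ea /\ True & 0 < ew /\ True].
  by case/andP: efI; case/andP: eaI; case/andP: ewI.
have claim N' tau' : model_arc ef ea ew N' tau' y -> tau' N'.+1 + N'%:R <= Tn%:R ->
    (forall j t, (j <= N')%N -> tau' j <= t <= tau' j.+1 ->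
      `|lsubmx (y j t)| <= rho') ->
    dist (lsubmx (y N' (tau' N'.+1))) A <=
      slack_KL beta (dist (lsubmx (y 0%N 0)) A) (tau' N'.+1 + N'%:R) + 2 * nu.
  move=> arc' tT ball'.
  have near' := model_arc_near JC2 cC kappa_gt0 kf0 lam0 ef0 ea0 ew0 L0 eta0 FL
    (Hew ew ewI) arc' ball'.
  have [tau0 tauS _ _ _] := arc'.
  have t0 : 0 <= tau' N'.+1 by rewrite -tau0; exact: tau_le tauS _ _ _ _.
  apply: (Heta N' _ _ _ _ near') => //; last by rewrite (le_trans _ tT)// lerDl.
  by rewrite -(ler_nat R) (le_trans _ tT)// lerDr.
have [big|small] := pselect (exists j t,
    [/\ (j <= N)%N, tau j <= t <= tau j.+1 & rho <= `|lsubmx (y j t)|]).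
  have [N' [tau' [arc' N'N tau'N exit ball']]] := model_arc_truncate arc big.
  have rr : rho <= rho' by rewrite le_max lexx.
  have y0' : `|lsubmx (y 0%N 0)| <= Delta := le_trans (norm_le_enorm _) y0.
  have yend := model_arc_end_bound arc' ball' y0' GB.
  have tT' : tau' N'.+1 + N'%:R <= Tn%:R.
    by apply: le_trans tauT; apply: lerD => //; rewrite ler_nat.
  have ball'' j t : (j <= N')%N -> tau' j <= t <= tau' j.+1 -> `|lsubmx (y j t)| <= rho'.
    move=> jN tI; have [jt|] := boolP ((j < N')%N || (t < tau' N'.+1)).
      by apply: le_trans rr; apply/ltW/ball'.
    rewrite negb_or -leqNgt -leNgt => /andP[Nj tt].
    have jE : j = N' by apply/eqP; rewrite eqn_leq jN.
    rewrite jE in tI *.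
    have -> : t = tau' N'.+1 by apply/le_anti; rewrite tt; case/andP: tI => _ ->.
    exact: yend.
  have dend := claim N' tau' arc' tT' ball''.
  have d0 : dist (lsubmx (y 0%N 0)) A <= Delta + MA.
    by apply: le_trans (dist_le_enorm _) _; rewrite lerD2r.
  have : slack_KL beta (dist (lsubmx (y 0%N 0)) A) (tau' N'.+1 + N'%:R) <= b0.
    have [_ bmono banti _ _] := beta_KL; have dge0 := dist_ge0 (lsubmx (y 0%N 0)) A.
    have m0 : 0 <= Num.max (tau' N'.+1 + N'%:R - 1) 0 by rewrite le_max lexx orbT.
    apply: (@le_trans _ _ (beta (2 * dist (lsubmx (y 0%N 0)) A) 0)).
      by apply: banti => //; rewrite mulr_ge0.
    by apply: bmono => //; [rewrite mulr_ge0|rewrite ler_pM2l].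
  have := enorm_le_dist (lsubmx (y N' (tau' N'.+1))).
  have := norm_le_enorm (lsubmx (y N' (tau' N'.+1))).
  by move: exit dend; rewrite /rho; lra.
apply: claim => // j t jN tI; rewrite /rho' le_max.
have [//|/ltW H] := leP `|lsubmx (y j t)| rho.
by exfalso; apply: small; exists j, t.
Qed.
End FiniteHorizon.

(** * Solutions on unbounded time domains *)

Section Restart.
Context {R : realType}.
Notation mu := (@lebesgue_measure R).

(** A jump raises [t + j] by one, so the value [v] may be skipped, but never by more than one. The
    index [i] is the first whose flow interval reaches [v - 1]. *)
Lemma tree_like_pred (E : set (R * nat)) t j v : tree_like E -> E (t, j) ->
  0 <= v <= t + j%:R ->
  exists t' j', [/\ E (t', j'), before (t', j') (t, j) &
    v - 1 <= t' + j'%:R <= v].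
Proof.
move=> tE Etj /andP[v0 vt]; have [_ H1 _] := tE.
have [tau [tau0 tauS taut Etau]] := H1 _ _ Etj.
pose P i := v <= tau i.+1 + i%:R + 1.
have exP : exists i, P i by exists j; rewrite /P taut; lra.
case: (ex_minnP exP) => i Pi imin.
have ij : (i <= j)%N by apply: imin; rewrite /P taut; lra.
have ti : tau i + i%:R <= v.
  case: i {Pi ij} imin => [|i] imin; first by rewrite tau0 add0r.
  rewrite leNgt; apply/negP => vi; rewrite -natr1 in vi; have : P i by rewrite /P; lra.
  by move=> /imin; rewrite ltnn.
have tii := tauS i ij.
have tit : tau i.+1 <= t by rewrite -taut; exact: tau_le tauS _ _ _ _.
exists (Num.min (v - i%:R) (tau i.+1)), i; split.
- by apply: Etau => //; rewrite le_min ge_min lexx orbT andbT tii andbT; lra.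
- by split => //=; rewrite ge_min tit orbT.
- move: Pi; rewrite /P; have [?|?] := leP (v - i%:R) (tau i.+1); lra.
Qed.

Lemma derivable_shift (V : normedModType R) (f : R -> V) (t c : R) :
  derivable f (t + c) 1 -> derivable (fun s => f (s + c)) t 1 /\
  derive1 (fun s => f (s + c)) t = derive1 f (t + c).
Proof.
have E : (fun h : R => h^-1 *: ((fun s => f (s + c)) (h *: 1 + t) - f (t + c))) =
    (fun h : R => h^-1 *: (f (h *: 1 + (t + c)) - f (t + c))).
  by apply/funext => h /=; rewrite addrA.
by rewrite !derive1E /derivable /derive /= => df; rewrite E.
Qed.

End Restart.

Section SolutionArcs.
Context {R : realType} (n r : nat).
Notation mu := (@lebesgue_measure R).
Variables (J : 'rV[R]_n -> R) (C D : set 'rV[R]_(n + r)).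
Variables (F : R -> 'rV[R]_(n + r) -> 'rV[R]_n -> set 'rV[R]_(n + r)).
Variables (G : R -> 'rV[R]_(n + r) -> set 'rV[R]_(n + r)).
Variables (kappa : 'I_n -> rat) (kf lam delta ef ea ew : R).
Let H := model_free_system J C D F G kappa kf lam delta ef ea ew.
Notation state := ('rV[R]_((n + r) + (n + n.*2))).
Notation model_arc := (model_arc J C D F G kappa kf lam delta ef ea ew).

Lemma model_arc_invariant N tau (y : nat -> R -> state) : closed C ->
  model_arc N tau y -> rVprod (eball lam) (@torus R n) (rsubmx (y 0%N 0)) ->
  rVprod (eball lam) (@torus R n) (rsubmx (y N (tau N.+1))).
Proof.
move=> cC [tau0 tauS _ jmp flw] y0.
have := tauS N (leqnn N); rewrite le_eqVlt => /orP[/eqP tE|tlt]; last first.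
  have [acy fly] := flw N (leqnn N) tlt.
  have acid : ac_on (y N) (tau N) (tau N.+1).
    by have := abs_continuous_ac (h := id) (fun u v => lexx _) acy.
  suff [] : flow_set H (y N (tau N.+1)) by [].
  apply: (ac_closed_ae tlt acid); first exact: closed_flow_set.
    by apply: aeS fly => s Hs /Hs[].
  by rewrite lexx andbT ltW.
case: N tauS jmp flw tE => [|k] tauS jmp flw tE; first by rewrite -tE tau0.
have [[_ Sy] [_ Gy]] := jmp k (ltnSn k).
by rewrite -tE Gy.
Qed.

Variables (E : set (R * nat)) (z : R -> nat -> state).
Hypothesis sol : solution H E z.

Let tE : tree_like E. Proof. by case: sol => -[] /tree_like_htd. Qed.

Lemma solution_flow a b j : a < b -> (forall s, a <= s <= b -> E (s, j)) ->
  abs_continuous (z^~ j) a b /\ {ae mu, forall t, a < t < b ->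
    [/\ flow_set H (z t j), derivable (z^~ j) t 1
      & flow_map H (z t j) (derive1 (z^~ j) t)]}.
Proof.
move=> ab abE; have [[_ locac] _ flw _] := sol.
have aa : a <= a <= b by lra.
have bb : a <= b <= b by lra.
have int0 : (slice E j)° !=set0.
  exists ((a + b) / 2); apply: (slice_interior tE (abE _ aa) (abE _ bb)); lra.
split.
  by apply: locac => //; exact: ltW.
apply: aeS (flw j int0) => t Ht /andP[? ?]; apply: Ht; apply: abE; lra.
Qed.

(** A restart point has to satisfy the initial condition of a solution. Before the end of the domain
    the solution either flows on, and closedness of [C] applies, or jumps, and the point is in
    [D]. *)
Lemma solution_live t' j' t j : closed C -> E (t', j') -> E (t, j) ->
  before (t', j') (t, j) -> (t', j') <> (t, j) ->
  (C `|` D) (lsubmx (z t' j')).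
Proof.
move=> cC E' Etj bef ne; have [_ H1 _] := tE; have [tau arc] := H1 _ _ Etj.
have := tree_like_before tE arc E' bef.
have [tau0 tauS taut Etau] := arc; case: bef => /= tt' jj'.
move=> /andP[t1]; rewrite le_eqVlt => /orP[/eqP tE'|t2].
  move: jj'; rewrite leq_eqVlt => /orP[/eqP jE|jlt].
    by exfalso; apply: ne; rewrite tE' jE taut.
  right; have [_ _ _ jmp] := sol.
  have [|[]//] := jmp t' j' E'.
  by apply: Etau => //; rewrite tE' lexx tauS.
left.
have [|acz flz] := @solution_flow t' (tau j'.+1) j' t2.
  move=> s /andP[s1 s2]; apply: Etau => //; rewrite s2 andbT; exact: le_trans s1.
have acid : ac_on (z^~ j') t' (tau j'.+1).
  by have := abs_continuous_ac (h := id) (fun u v => lexx _) acz.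
suff [] : flow_set H (z t' j') by [].
apply: (ac_closed_ae t2 acid); first exact: closed_flow_set.
  by apply: aeS flz => s Hs /Hs[].
by rewrite lexx ltW.
Qed.

Lemma solution_arc t' j' t j : E (t', j') -> E (t, j) ->
  before (t', j') (t, j) -> (C `|` D) (lsubmx (z t' j')) ->
  exists2 tau, model_arc (j - j') tau (fun i s => z (s + t') (i + j')%N) &
    tau (j - j').+1 = t - t'.
Proof.
move=> E' Etj bef CD'; have [_ H1 _] := tE; have [tau arc] := H1 _ _ Etj.
have /andP[t1 t2] := tree_like_before tE arc E' bef.
have [tau0 tauS taut Etau] := arc; case: bef => /= tt' jj'.
have ijN i : (i <= j - j')%N -> (i + j' <= j)%N by rewrite leq_subRL// addnC.
(* The restart may fall inside a flow interval, whose remainder after [t'] becomes the first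
   interval. *)
pose tau' i := if i is i'.+1 then tau (i + j')%N - t' else 0.
have tauS' i : (i <= j - j')%N ->
    tau (i + j')%N <= tau' i + t' /\ tau' i <= tau' i.+1.
  case: i => [|i] iN; first by split; rewrite /= ?add0r // subr_ge0.
  by split; [rewrite /tau' subrK|rewrite /tau' lerD2r; exact: tauS (ijN _ iN)].
exists tau'; last by rewrite /tau' addSn subnK ?taut.
split => //.
- by move=> i /tauS'[].
- by rewrite add0r.
- move=> i iN; rewrite /tau' subrK addSn; have [_ _ _ jmp] := sol.
  have iN' := ijN _ iN; apply: jmp.
    by apply: Etau; [exact: ltnW|rewrite lexx andbT; apply: tauS; exact: ltnW].
  by apply: Etau => //; rewrite lexx; exact: tauS.
- move=> i iN lt; have [ti _] := tauS' i iN.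
  have lt' : tau' i + t' < tau' i.+1 + t' by rewrite ltrD2r.
  have [|acz flz] := @solution_flow _ _ (i + j')%N lt'.
    move=> s /andP[s1 s2]; apply: Etau; first exact: ijN.
    by rewrite (le_trans ti s1) (le_trans s2)// /tau' subrK addSn.
  split; first exact: abs_continuous_shift acz.
  apply: aeS (ae_shift t' flz) => s Hs /andP[s1 s2].
  have [|Cs ds fs] := Hs; first by rewrite !ltrD2r s1.
  by have [? ->] := derivable_shift ds.
Qed.

Lemma solution_invariant t j : closed C ->
  (flow_set H `|` jump_set H) (z 0 0%N) -> E (t, j) ->
  rVprod (eball lam) (@torus R n) (rsubmx (z t j)).
Proof.
move=> cC init Etj; have E00 := htd00 tE.
have bef : before (0, 0%N) (t, j).
  split => //=; have [_ H1 _] := tE; have [tau [tau0 tauS <- _]] := H1 _ _ Etj.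
  by rewrite -tau0; exact: tau_le tauS _ _ _ _.
have CD0 : (C `|` D) (lsubmx (z 0 0%N)) by case: init => -[CDz _]; [left|right].
have S0 : rVprod (eball lam) (@torus R n) (rsubmx (z (0 + 0) (0 + 0)%N)).
  by rewrite addr0; case: init => -[].
have [tau arc tauE] := solution_arc E00 Etj bef CD0.
have inv := model_arc_invariant cC arc S0.
by rewrite tauE subr0 subn0 addr0 addn0 in inv.
Qed.

End SolutionArcs.

(** * Restarting the finite-horizon bound *)

Section AllTimes.
Context {R : realType} (n r : nat).
Variables (J : 'rV[R]_n -> R) (C D : set 'rV[R]_(n + r)).
Variables (F : R -> 'rV[R]_(n + r) -> 'rV[R]_n -> set 'rV[R]_(n + r)).
Variables (G : R -> 'rV[R]_(n + r) -> set 'rV[R]_(n + r)).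
Variables (kappa : 'I_n -> rat) (kf lam delta ef ea ew : R).
Let H := model_free_system J C D F G kappa kf lam delta ef ea ew.
Notation state := ('rV[R]_((n + r) + (n + n.*2))).
Hypothesis cC : closed C.
Variables (A : set 'rV[R]_(n + r)) (beta : R -> R -> R) (Delta nu MA : R) (m : nat).
Hypotheses (A0 : A !=set0) (beta_KL : class_KL beta) (nu0 : 0 < nu).
Hypothesis AM : forall a, A a -> enorm a <= MA.
Hypotheses (m1 : (1 <= m)%N) (nuD : nu + MA <= Delta).
Hypothesis betam : beta (Delta + MA) m%:R <= nu / 2.
Hypothesis horizon : forall N tau (y : nat -> R -> state),
  model_arc J C D F G kappa kf lam delta ef ea ew N tau y ->
  tau N.+1 + N%:R <= (2 * m + 1)%:R -> enorm (lsubmx (y 0%N 0)) <= Delta ->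
  dist (lsubmx (y N (tau N.+1))) A <=
    beta (dist (lsubmx (y 0%N 0)) A) (tau N.+1 + N%:R) + nu / 2.

Lemma restart_bound E (z : R -> nat -> state) :
  solution H E z -> enorm (lsubmx (z 0 0%N)) <= Delta ->
  forall t j, E (t, j) -> dist (lsubmx (z t j)) A <=
    beta (dist (lsubmx (z 0 0%N)) A) (t + j%:R) + nu.
Proof.
move=> sol z0 t j Etj; have nu0' := nu0; have nuD' := nuD; have [bge0 bmono banti _ _] := beta_KL.
have tE : tree_like E by case: sol => -[] /tree_like_htd.
have m1' : 1 <= m%:R :> R by rewrite (ler_nat R 1).
have E00 := htd00 tE.
have bef0 t' j' : E (t', j') -> before (0, 0%N) (t', j').
  move=> E'; split => //=; have [_ H1 _] := tE; have [tau [tau0 tauS <- _]] := H1 _ _ E'.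
  by rewrite -tau0; exact: tau_le tauS _ _ _ _.
have pos t' j' : E (t', j') -> 0 <= t' + j'%:R.
  by move=> /bef0[/= ? _]; rewrite addr_ge0.
have CD0 : (C `|` D) (lsubmx (z 0 0%N)).
  by have [_ init _ _] := sol; case: init => -[CDz _]; [left|right].
have step t1 j1 t2 j2 : E (t1, j1) -> E (t2, j2) -> before (t1, j1) (t2, j2) ->
    (C `|` D) (lsubmx (z t1 j1)) -> enorm (lsubmx (z t1 j1)) <= Delta ->
    (t2 + j2%:R) - (t1 + j1%:R) <= 2 * m%:R + 1 ->
    dist (lsubmx (z t2 j2)) A <= beta (dist (lsubmx (z t1 j1)) A)
      ((t2 + j2%:R) - (t1 + j1%:R)) + nu / 2.
  move=> E1 E2 bef CD1 z1 le; have [tau arc tauE] := solution_arc sol E1 E2 bef CD1.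
  have := horizon arc; rewrite tauE add0r subrK.
  case: bef => /= t12 j12; rewrite (subnK j12) (natrB _ j12).
  have -> : t2 - t1 + (j2%:R - j1%:R) = t2 + j2%:R - (t1 + j1%:R) by ring.
  by apply => //; rewrite natrD natrM.
have small d s : 0 <= d -> d <= Delta + MA -> m%:R <= s -> beta d s <= nu / 2.
  move=> d0 dD ms; apply: le_trans betam.
  apply: le_trans (bmono _ _ _ d0 dD _) _; first exact: le_trans ms.
  by apply: banti => //; exact: le_trans dD.
have dD x : enorm x <= Delta -> dist x A <= Delta + MA.
  by move=> xD; apply: le_trans (dist_le_enorm A0 AM _) _; rewrite lerD2r.
(* Up to hybrid time [2 * m + 1] the bound is taken from the origin. Later, a restart between [m]
   and [m + 1] units in the past still has hybrid time at least [m], so the induction hypothesis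
   applies to it; [1 <= m] makes the induction progress. The restart point has norm at most
   [nu + MA <= Delta], and after at least [m] more units the term in [beta] is at most [nu / 2]. *)
have main k : forall t' j', E (t', j') -> m%:R <= t' + j'%:R <= m%:R + k%:R ->
    dist (lsubmx (z t' j')) A <= nu.
  elim: k => [|k IH] t' j' E' /andP[le1 le2];
    (have [short|long] := leP (t' + j'%:R) (2 * m%:R + 1);
     first by have := step _ _ _ _ E00 E' (bef0 _ _ E') CD0 z0;
       rewrite addr0 subr0 => /(_ short);
       have := small _ _ (dist_ge0 _ A) (dD _ z0) le1; lra).
    by exfalso; move: le2 long; lra.
  rewrite -natr1 in le2.
  have [|t1 [j1 [E1 bef1 /andP[v1 v2]]]] := @tree_like_pred _ E t' j' (t' + j'%:R - m%:R) tE E'.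
    by apply/andP; split; lra.
  have d1 : dist (lsubmx (z t1 j1)) A <= nu by apply: IH => //; apply/andP; split; lra.
  have z1 : enorm (lsubmx (z t1 j1)) <= Delta.
    by apply: le_trans (enorm_le_dist A0 AM _) _; lra.
  have ne : (t1, j1) <> (t', j') by move=> [t1E j1E]; move: v2; rewrite t1E j1E; lra.
  have CD1 := solution_live sol cC E1 E' bef1 ne.
  have := step _ _ _ _ E1 E' bef1 CD1 z1.
  have le3 : m%:R <= t' + j'%:R - (t1 + j1%:R) by lra.
  have := small _ _ (dist_ge0 _ A) (dD _ z1) le3; lra.
have bpos : 0 <= beta (dist (lsubmx (z 0 0%N)) A) (t + j%:R).
  by apply: bge0; [exact: dist_ge0|exact: pos].
have [le1|lt1] := leP (t + j%:R) m%:R.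
  have := step _ _ _ _ E00 Etj (bef0 _ _ Etj) CD0 z0.
  by rewrite addr0 subr0; lra.
have := main (Num.bound (t + j%:R)) t j Etj.
rewrite (ltW lt1)/= => mainH; apply: (@le_trans _ _ nu); last by rewrite lerDr.
apply: mainH; rewrite ler_wpDl//; apply/ltW/archi_boundP; exact: pos.
Qed.

End AllTimes.

(** * Comparison functions and distances to product sets *)

Section ClosingEstimates.
Context {R : realType}.

Lemma slack_KL_class (beta : R -> R -> R) : class_KL beta -> class_KL (slack_KL beta).
Proof.
move=> bKL; have [b0 bmono banti blim0 blimy] := bKL.
have m0 s : 0 <= Num.max (s - 1) 0 :> R by rewrite le_max lexx orbT.
split.
- by move=> r s r0 s0; apply: b0 => //; rewrite mulr_ge0.
- by move=> r1 r2 s r0 r12 s0; apply: bmono => //; rewrite ?mulr_ge0 ?ler_pM2l.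
- move=> r s1 s2 r0 s0 s12; apply: banti => //; first by rewrite mulr_ge0.
  by rewrite ge_max !le_max lerD2r s12 lexx orbT.
- move=> s s0; apply/cvgrPdist_lt => e e0.
  have /cvgrPdist_lt /(_ e e0)[d /= d0 Hd] := blim0 (Num.max (s - 1) 0) (m0 s).
  have d20 : 0 < d / 2 by rewrite divr_gt0.
  exists (d / 2) => //= x; rewrite /ball_/= sub0r normrN => xd x0.
  by apply: Hd; rewrite /ball_/= ?sub0r ?normrN ?mulr_gt0// normrM gtr0_norm//; lra.
- move=> r r0; apply/cvgrPdist_lt => e e0.
  have /cvgrPdist_lt /(_ e e0)[M [_ HM]] := blimy (2 * r) (mulr_ge0 (ler0n _ 2) r0).
  exists (M + 1); split; first exact: num_real.
  by move=> s Ms; apply: HM; rewrite lt_max ltrBrDr Ms.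
Qed.

Lemma enorm_row_mx p q (u : 'rV[R]_p) (v : 'rV[R]_q) :
  enorm (row_mx u v) ^+ 2 = enorm u ^+ 2 + enorm v ^+ 2.
Proof.
rewrite !enorm_sqr big_split_ord/=; congr (_ + _); apply: eq_bigr => i _.
  by rewrite row_mxEl.
by rewrite row_mxEr.
Qed.

Lemma enorm_lsubmx p q (x : 'rV[R]_(p + q)) : enorm (lsubmx x) <= enorm x.
Proof.
rewrite -ler_sqr ?nnegrE ?enorm_ge0// -{2}(hsubmxK x) enorm_row_mx.
by rewrite lerDl sqr_ge0.
Qed.

Lemma dist_rVprod_le p q (A : set 'rV[R]_p) (B : set 'rV[R]_q) x : A !=set0 ->
  B (rsubmx x) -> dist x (rVprod A B) <= dist (lsubmx x) A.
Proof.
move=> A0 Bx; apply: le_dist => // a Aa.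
have AB : rVprod A B (row_mx a (rsubmx x)) by split; rewrite ?row_mxKl ?row_mxKr.
apply: le_trans (dist_le x AB) _.
rewrite -{1}(hsubmxK x) opp_row_mx add_row_mx subrr.
rewrite -ler_sqr ?nnegrE ?enorm_ge0// enorm_row_mx enorm_sqr [X in _ + X]enorm_sqr.
by rewrite [X in _ + X]big1 ?addr0// => i _; rewrite mxE expr0n.
Qed.

Lemma dist_lsubmx_le p q (A : set 'rV[R]_p) (B : set 'rV[R]_q) x :
  rVprod A B !=set0 -> dist (lsubmx x) A <= dist x (rVprod A B).
Proof.
move=> AB0; apply: le_dist => // a [Aa _]; apply: le_trans (dist_le _ Aa) _.
by rewrite -linearB; exact: enorm_lsubmx.
Qed.

Lemma bounded_rVprod p q (A : set 'rV[R]_p) (B : set 'rV[R]_q) :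
  compact A -> compact B ->
  exists2 M, 0 <= M & forall x, rVprod A B x -> enorm x <= M.
Proof.
move=> /compact_bounded[MA [_ HA]] /compact_bounded[MB [_ HB]].
exists ((p + q)%:R * (`|MA| + `|MB| + 1)).
  by rewrite mulr_ge0// addr_ge0// addr_ge0.
move=> x [Ax Bx]; apply: le_trans (enorm_le_norm x) _; rewrite ler_wpM2l//.
have nA := ler_norm MA; have nB := ler_norm MB.
have gA := normr_ge0 MA; have gB := normr_ge0 MB.
apply: norm_le_coord => [|i]; first by rewrite addr_ge0// addr_ge0.
rewrite -(hsubmxK x) -(splitK i); case: (fintype.split i) => k /=.
  rewrite row_mxEl; apply: le_trans (coord_le_norm _ k) _.
  by apply: HA Ax; lra.
rewrite row_mxEr; apply: le_trans (coord_le_norm _ k) _.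
by apply: HB Bx; lra.
Qed.

Lemma KL_eventually_le (beta : R -> R -> R) q e : class_KL beta -> 0 <= q -> 0 < e ->
  exists2 m : nat, (1 <= m)%N & beta q m%:R <= e.
Proof.
move=> [b0 _ _ _ blimy] q0 e0.
have /cvgrPdist_lt /(_ e e0)[M [_ HM]] := blimy q q0.
exists (Num.bound `|M|).+1 => //.
have : `|0 - beta q (Num.bound `|M|).+1%:R| < e.
  apply: HM; apply: le_lt_trans (ler_norm M) _.
  by apply: lt_trans (archi_boundP (normr_ge0 M)) _; rewrite ltr_nat.
by rewrite sub0r normrN ger0_norm ?b0// => /ltW.
Qed.

End ClosingEstimates.

Unset Implicit Arguments.
Set Strict Implicit.

Theorem theorem3 (R : realType) (n r : nat) (n_gt0 : (0 < n)%N)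
  (J : 'rV[R]_n -> R) (J_C2 : C2 J)
  (Uhat : set 'rV[R]_n) (Oset : set 'rV[R]_n)
  (Oset_opt : Oset = argmin_on J Uhat \/ Oset = argmax_on J Uhat)
  (Oset_neq0 : Oset !=set0) (Oset_compact : compact Oset)
  (C D : set 'rV[R]_(n + r))
  (F : R -> 'rV[R]_(n + r) -> 'rV[R]_n -> set 'rV[R]_(n + r))
  (G : R -> 'rV[R]_(n + r) -> set 'rV[R]_(n + r))
  (basic_conditions : exists2 delta_star : R, 0 < delta_star &
    forall delta : R, 0 < delta <= delta_star ->
      [/\ [/\ closed C, closed D,
              forall x, C x -> Uhat (lsubmx x)
            & forall x, D x -> Uhat (lsubmx x)],
          (let K := C `*` [set: 'rV[R]_n] in
           let M (z : 'rV[R]_(n + r) * 'rV[R]_n) := F delta z.1 z.2 in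
           [/\ osc_on M K, locally_bounded_on M K,
               nonempty_valued_on M K & convex_valued_on M K])
        & [/\ osc_on (G delta) D, locally_bounded_on (G delta) D
            & nonempty_valued_on (G delta) D]])
  (Psi : set 'rV[R]_r) (Psi_compact : compact Psi)
  (nominal_SGPAS : SGPAS 1 (nominal_system J C D F G) (rVprod Oset Psi))
  (kf : R) (kf_gt0 : 0 < kf) (lambda : R) (lambda_gt0 : 0 < lambda)
  (kappa : 'I_n -> rat) (kappa_gt0 : forall i, 0 < kappa i)
  (kappa_inj : injective kappa) :
  SGPAS 4 (model_free_system J C D F G kappa kf lambda)
    (rVprod (rVprod Oset Psi) (rVprod (eball lambda) (@torus R n))).

Proof.
have [ds ds0 basic] := basic_conditions; have [beta bKL nom] := nominal_SGPAS.
set A := rVprod Oset Psi; set S := rVprod (eball lambda) _.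
have sKL := slack_KL_class bKL; exists (slack_KL beta) => // Delta nu nu0 nuD.
(* [Psi] may be empty. Distances to the empty set are [0] by the convention on [inf], so the bound
   holds by positivity. *)
have [A0|A0] := eqVneq A set0.
  have AS0 : rVprod A S = set0.
    by rewrite A0; apply/seteqP; split => // x [].
  exists 1 => // d _; exists 1 => // ef _; exists 1 => // ea _; exists 1 => // ew _.
  move=> E x [[[htE _] _ _ _] _] _ t j Etj; rewrite AS0 /dist !image_set0 inf0.
  have [_ H1 _] := tree_like_htd htE; have [tau [tau0 tauS tauE _]] := H1 _ _ Etj.
  rewrite addr_ge0 ?(ltW nu0)//; have [b0 _ _ _ _] := sKL; apply: b0 => //.
  by rewrite addr_ge0// -tauE -tau0; exact: tau_le tauS _ _ _ _.
move/set0P : A0 => A0.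
have [MA MA0 AM] := bounded_rVprod Oset_compact Psi_compact.
(* Enlarged so that restart points, known only to be within [nu] of [A], are again admissible
   initial states. *)
pose Delta1 := Delta + MA + nu.
have D10 : 0 <= Delta1 + MA by rewrite /Delta1; lra.
have nu20 : 0 < nu / 2 by rewrite divr_gt0.
have [m m1 bm] := KL_eventually_le sKL D10 nu20.
(* The passage to the finite horizon doubles the tolerance to [nu / 2]; the other half is left for
   the restarts. *)
have nu40 : 0 < nu / 4 by rewrite divr_gt0.
have nu4D : nu / 4 < Delta1 by rewrite /Delta1; lra.
have [es es0 nomD] := nom Delta1 (nu / 4) nu40 nu4D.
exists (Num.min es ds); first by rewrite lt_min es0.
move=> d /andP[d0]; rewrite lt_min => /andP[des dds].
have [|[cC cD _ _] [oM bM neM cM] [oG bG _]] := basic d; first by rewrite d0 ltW.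
have [|efs efs0 Hef] := finite_horizon J_C2 cC cD oM bM neM cM oG bG kappa_gt0
  kappa_inj kf_gt0 lambda_gt0 A0 bKL nu40 AM _ (2 * m + 1)%N (Delta := Delta1).
  by apply: nomD; rewrite d0.
exists efs => // ef /Hef[eas eas0 Hea]; exists eas => // ea /Hea[ews ews0 Hew].
exists ews => // ew /Hew hor E x [sol _] x0 t j Etj.
have x0l : enorm (lsubmx (x 0 0%N)) <= Delta1.
  by apply: le_trans (enorm_lsubmx _) _; rewrite /Delta1; lra.
have nuD1 : nu + MA <= Delta1 by rewrite /Delta1; lra.
have hor' N tau y : model_arc J C D F G kappa kf lambda d ef ea ew N tau y ->
    tau N.+1 + N%:R <= (2 * m + 1)%:R -> enorm (lsubmx (y 0%N 0)) <= Delta1 ->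
    dist (lsubmx (y N (tau N.+1))) A <=
    slack_KL beta (dist (lsubmx (y 0%N 0)) A) (tau N.+1 + N%:R) + nu / 2.
  move=> arc tauT y0; apply: le_trans (hor N tau y arc tauT y0) _.
  by rewrite lerD2l; lra.
have bound := restart_bound cC A0 sKL nu0 AM m1 nuD1 bm hor' sol x0l Etj.
have [[htE _] init _ _] := sol; have tE := tree_like_htd htE.
have [_ H1 _] := tE; have [tau [tau0 tauS tauE _]] := H1 _ _ Etj.
have t0 : 0 <= t by rewrite -tauE -tau0; exact: tau_le tauS _ _ _ _.
have S0 : S (rsubmx (x 0 0%N)) by case: init => -[].
have St : S (rsubmx (x t j)) := solution_invariant sol cC init Etj.
apply: le_trans (dist_rVprod_le A0 St) _; apply: le_trans bound _; rewrite lerD2r.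
have [_ bmono _ _ _] := sKL; apply: bmono; first exact: dist_ge0.
  apply: dist_lsubmx_le; have [a Aa] := A0.
  by exists (row_mx a (rsubmx (x 0 0%N))); split; rewrite ?row_mxKl ?row_mxKr.
by rewrite addr_ge0.
Qed.
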